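(* For all integers $n\ge 273$, $$\bigl(q(n)^2-q(n-1)q(n+1)\bigr)^2>\bigl(q(n-1)^2-q(n-2)q(n)\bigr)\bigl(q(n+1)^2-q(n)q(n+2)\bigr).$$
   Context: $q(n)$ denotes the number of partitions of $n$ into distinct parts. *)

(* Defs.v *)
From HB Require Import structures.
From mathcomp Require Import all_boot all_order all_algebra.

Set Implicit Arguments.
Unset Strict Implicit.
Unset Printing Implicit Defensive.

(* A partition of n into distinct parts is identified with the set of its parts,
   a set of positive integers with sum n; the parts of a partition of n are at
   most n, so they all live in 'I_n.+1. *)
Definition distinct_partitions (n : nat) : {set {set 'I_n.+1}} :=
  [set A : {set 'I_n.+1} |
     [forall i in A, 0 < i] && (\sum_(i in A) (i : nat) == n)].

Definition q (n : nat) : nat := #|distinct_partitions n|.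

(* Main.v *)
Require Import Defs.
From Stdlib Require Import Reals Factorial Lra Lia Psatz.
From Coquelicot Require Import Coquelicot.
From Stdlib Require Import Bool ZArith List.
Import ListNotations.

(* Up to the positive factor q(n), the difference of the two sides is the 3x3
   Toeplitz determinant of q(n+i-j) (Desnanot-Jacobi).  By Cauchy's formula on a
   circle of radius r, with F(z) = prod (1 + z^k), this is the determinant of the form
   (f, g) |-> int f g F(r e^(iy)) e^(-iny) dy on the span of 1, sin y, 1 - cos y.  The
   entries between functions of opposite parity are imaginary, so they enter the
   determinant through a positive definite quadratic form; what remains are
   conditions on integrals of even functions, the main one being
   (int (1 - cos) T)^2 < int T * int (1 - cos)^2 T with T the real part.

   At the saddle point r, T is nearly Gaussian, and for a Gaussian the right-hand side
   is three times the left-hand side, so crude estimates suffice.  Moments are compared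
   by integration by parts, using two-sided bounds of the logarithmic derivative of F
   near y = 0; away from 0, |F(r e^(iy))| is smaller by a factor exp(- c / (1 - r)).
   No asymptotic formula for q(n) is needed.  This works for n >= 9300, and the
   remaining n are checked by computation. *)

(** With d = 1 - r, the phase of F is controlled only by a multiple of y^3 / d^4, so at the end y =
    0.4 d of the main arc it is not known to stay below pi / 2, and T is not known to be positive
    there. Hence errors in the moments of T are charged to moments of |F|, which are positive and
    satisfy a recurrence that can be run downwards from a trivial bound. The peak has width of order
    d^(3/2), where the phase is of order d^(1/2), so every error is O(d) relative to the main terms;
    the assumption n >= 9300 serves to give d <= 0.0097, and at that value the errors still fit into
    the factor three. F is cut to a finite product over k <= m, so that only finite sums and
    products occur; m is polynomially large in n, which makes the truncation negligible. *)

Open Scope bool_scope.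
Open Scope Z_scope.

(** * Enumeration of distinct partitions *)

(* Number of sets of positive integers at most [m] with sum [z].  A sum in [Z]
   makes the recurrence unconditional: the count vanishes for [z < 0]. *)
Fixpoint cnt (m : nat) (z : Z) : Z :=
  match m with
  | O => if z =? 0 then 1 else 0
  | S i => cnt i z + cnt i (z - Z.of_nat m)
  end.

Lemma cnt_neg m z : z < 0 -> cnt m z = 0.
Proof.
revert z; induction m as [|m IH]; intros z Hz; cbn [cnt].
- destruct (Z.eqb_spec z 0); lia.
- rewrite !IH; lia.
Qed.

Lemma cnt_nonneg m z : 0 <= cnt m z.
Proof.
revert z; induction m as [|m IH]; intros z; cbn [cnt].
- destruct (z =? 0); lia.
- generalize (IH z) (IH (z - Z.of_nat (S m))); lia.
Qed.

Lemma cnt_stable m i z : z <= Z.of_nat m -> cnt (m + i) z = cnt m z.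
Proof.
intros Hz; induction i as [|i IH]; [now rewrite Nat.add_0_r|].
rewrite Nat.add_succ_r; cbn [cnt]; rewrite IH, (cnt_neg _ (z - _)) by lia; lia.
Qed.

(* Distinct partitions whose largest part is counted [j] times. *)
Fixpoint hcnt (B j : nat) (z : Z) : Z :=
  match B with
  | O => 0
  | S i => hcnt i j z + cnt i (z - Z.of_nat j * Z.of_nat B)
  end.

Lemma hcnt1 B z : hcnt B 1 z = cnt B z - cnt 0 z.
Proof.
induction B as [|B IH]; [simpl; lia|].
cbn [hcnt]; rewrite IH, Z.mul_1_l; cbn [cnt]; lia.
Qed.

Lemma hcnt_neg B j z : (0 < j)%nat -> z < Z.of_nat j -> hcnt B j z = 0.
Proof.
intros Hj Hz; induction B as [|B IH]; [easy|].
cbn [hcnt]; rewrite IH, cnt_neg; nia.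
Qed.

Lemma hcnt_stable B j z : (0 < j)%nat -> z <= Z.of_nat B ->
  hcnt (S B) j z = hcnt B j z.
Proof. intros Hj Hz; cbn [hcnt]; rewrite (cnt_neg B); nia. Qed.

(** Let b be the largest part, counted j times. If b - 1 is not a part, replacing b by b - 1 lowers
    the weighted sum by j. If b - 1 is a part, dropping b and counting b - 1 once more than b was
    counted also lowers it by j. The set {1} gives the last term. *)
Lemma hcnt_rec B j z : (0 < j)%nat -> z <= Z.of_nat B ->
  hcnt B j z = hcnt B j (z - Z.of_nat j)
               + (hcnt B (S j) (z - Z.of_nat j) + cnt 0 (z - Z.of_nat j)).
Proof.
intros Hj Hz.
assert (H : forall C, hcnt (S C) j z = hcnt C j (z - Z.of_nat j)
    + hcnt C (S j) (z - Z.of_nat j) + cnt 0 (z - Z.of_nat j)).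
{ induction C as [|C IH].
  - cbn [hcnt]; change (Z.of_nat 1) with 1; rewrite Z.mul_1_r; lia.
  - change (hcnt (S (S C)) j z) with
      (hcnt (S C) j z + cnt (S C) (z - Z.of_nat j * Z.of_nat (S (S C)))).
    rewrite IH; cbn [hcnt cnt].
    replace (z - Z.of_nat j * Z.of_nat (S (S C)))
      with (z - Z.of_nat j - Z.of_nat j * Z.of_nat (S C)) by lia.
    replace (z - Z.of_nat j - Z.of_nat j * Z.of_nat (S C) - Z.of_nat (S C))
      with (z - Z.of_nat j - Z.of_nat (S j) * Z.of_nat (S C)) by lia.
    lia. }
rewrite <- (hcnt_stable B) by lia; rewrite H; lia.
Qed.

(* [shift_add L pf nb] is the sequence [h] solving [h(k + j) = L(k) + h(k)],
   the queue [pf ++ rev nb] holding the last [j] values.  The test [v =? v]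
   forces [v], without which lazy conversion would build a huge closure. *)
Fixpoint shift_add (L pf nb : list Z) : list Z :=
  match L with
  | [] => []
  | x :: L' =>
    match (match pf with [] => (rev_append nb [], []) | _ => (pf, nb) end) with
    | (y :: pf', nb') =>
      let v := x + y in if v =? v then v :: shift_add L' pf' (v :: nb') else []
    | ([], _) => []
    end
  end.

(** Passes from row j + 1 to row j of [hcnt], both with 1 added at index 0 for the empty set. The
    entries 1, ..., j - 1 vanish because the largest part alone contributes at least j. *)
Definition step (j : nat) (L : list Z) : list Z :=
  1 :: repeat 0 (pred j) ++ shift_add L (repeat 0 j) [].

Fixpoint steps (j : nat) (L : list Z) : list Z :=
  match j with O => L | S i => steps i (step j L) end.

(** Row J + 1 is needed only at 0, where the empty set contributes 1. The pass for j lengthens the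
    known prefix by j, so J passes of additions yield about J^2 / 2 values. *)
Definition table (J : nat) : list Z := steps J [1].

Lemma shift_add_eq (h l : nat -> Z) j : (0 < j)%nat ->
  forall len i pf nb,
  (forall k, (k < i + len)%nat -> h (k + j)%nat = l k + h k) ->
  pf ++ rev nb = map h (seq i j) ->
  shift_add (map l (seq i len)) pf nb = map h (seq (i + j) len).
Proof.
intros Hj len; induction len as [|len IH]; intros i pf nb Hh Hq; [easy|].
cbn [seq map shift_add].
assert (E : exists pf' nb', (match pf with [] => (rev_append nb [], []) | _ => (pf, nb) end)
    = (h i :: pf', nb') /\ h i :: pf' ++ rev nb' = map h (seq i j)).
{ destruct j as [|j]; [lia|].
  destruct pf as [|y pf].
  - rewrite rev_append_rev, app_nil_r; cbn in Hq; rewrite Hq.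
    exists (map h (seq (S i) j)), []; cbn; now rewrite app_nil_r.
  - exists pf, nb; cbn in Hq |- *; injection Hq as -> Hq; now rewrite Hq. }
destruct E as (pf' & nb' & -> & Hq').
cbv zeta; rewrite Z.eqb_refl, <- Hh by lia; f_equal.
apply (IH (S i)); [intros; apply Hh; lia|]; cbn [rev].
destruct j as [|j]; [lia|].
rewrite seq_S, map_app; cbn [seq map] in Hq' |- *; injection Hq' as Hq'.
now rewrite app_assoc, Hq', Nat.add_succ_comm.
Qed.

(** The bound [B] on the parts is shared by all rows and large enough for [hcnt_rec] to apply at
    every index in range. *)
Lemma steps_eq B : forall j len, (j * S j / 2 + len <= B)%nat ->
  steps j (map (fun k => hcnt B (S j) (Z.of_nat k) + cnt 0 (Z.of_nat k)) (seq 0 len))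
  = map (fun k => hcnt B 1 (Z.of_nat k) + cnt 0 (Z.of_nat k))
      (seq 0 (j * S j / 2 + len)).
Proof.
induction j as [|j IH]; intros len Hlen; [easy|].
assert (E2 : (S j * S (S j) / 2 = S j + j * S j / 2)%nat).
{ replace (S j * S (S j))%nat with (S j * 2 + j * S j)%nat by lia.
  now rewrite Nat.div_add_l. }
cbn [steps]; unfold step; rewrite E2 in *.
replace (S j + j * S j / 2 + len)%nat with (j * S j / 2 + (S j + len))%nat by lia.
rewrite <- IH by lia; f_equal.
rewrite seq_app, map_app; cbn [seq map app pred].
assert (Z0 : forall k, (k < S j)%nat -> hcnt B (S j) (Z.of_nat k) = 0)
  by (intros; apply hcnt_neg; lia).
f_equal; [rewrite Z0; cbn; lia|].
f_equal.
- replace (repeat 0 j) with (map (fun _ => 0) (seq 1 j)) by now rewrite map_const, length_seq.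
  apply map_ext_in; intros k Hk; apply in_seq in Hk.
  rewrite Z0 by lia; destruct k; [lia|easy].
- transitivity (map (fun k => hcnt B (S j) (Z.of_nat k)) (seq (0 + S j) len)).
  2: { apply map_ext_in; intros [|k] Hk; apply in_seq in Hk; [lia|cbn [cnt Z.of_nat Z.eqb]; lia]. }
  apply (shift_add_eq (fun k => hcnt B (S j) (Z.of_nat k))
    (fun k => hcnt B (S (S j)) (Z.of_nat k) + cnt 0 (Z.of_nat k))).
  + lia.
  + intros k Hk; rewrite hcnt_rec by lia.
    rewrite Nat2Z.inj_add, Z.add_simpl_r; lia.
  + rewrite app_nil_r.
    replace (repeat 0 (S j)) with (map (fun _ => 0) (seq 0 (S j)))
      by now rewrite map_const, length_seq.
    apply map_ext_in; intros k Hk; apply in_seq in Hk; symmetry; apply Z0; lia.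
Qed.

Lemma table_eq J :
  table J = map (fun k => cnt k (Z.of_nat k)) (seq 0 (J * S J / 2 + 1)).
Proof.
pose (B := (J * S J / 2 + 1)%nat).
transitivity (map (fun k => hcnt B 1 (Z.of_nat k) + cnt 0 (Z.of_nat k))
  (seq 0 (J * S J / 2 + 1))).
- rewrite <- steps_eq by (unfold B; lia).
  unfold table; f_equal; cbn [seq map]; rewrite hcnt_neg by lia; easy.
- apply map_ext_in; intros k Hk; apply in_seq in Hk.
  rewrite hcnt1, Z.sub_add.
  replace B with (k + (B - k))%nat by (unfold B; lia).
  now apply cnt_stable.
Qed.

(** * The finite range, by verified computation *)

Definition two_log_concave_at (a : nat -> Z) (n : nat) : Prop :=
  (a (n - 1)%nat ^ 2 - a (n - 2)%nat * a n) * (a (n + 1)%nat ^ 2 - a n * a (n + 2)%nat)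
  < (a n ^ 2 - a (n - 1)%nat * a (n + 1)%nat) ^ 2.

(* Bounds for [y^2 - x z], divided by [4^e 2^s], when [x], [y], [z] are known up to
   [u] after division by [2^e]; [u = 0] is the exact case [e = s = 0]. *)
Fixpoint deltas (u s : Z) (l : list Z) : list (Z * Z) :=
  match l with
  | x :: ((y :: z :: _) as l') =>
    (Z.shiftr (y * y - (x + u) * (z + u)) s, Z.shiftr ((y + u) * (y + u) - x * z) s + u)
      :: deltas u s l'
  | _ => []
  end.

(** The lower bounds are tested for nonnegativity so that products of bounds compare with products
    of the true differences. *)
Fixpoint check_deltas (D : list (Z * Z)) : bool :=
  match D with
  | d1 :: ((d2 :: d3 :: _) as D') =>
    if (0 <=? fst d1) && (0 <=? fst d2) && (0 <=? fst d3)
       && (snd d1 * snd d3 <? fst d2 * fst d2)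
    then check_deltas D' else false
  | _ => true
  end.

(** One exponent [e] per block keeps 51 bits of its first entry; a block starting below 2^51 is
    treated exactly. Truncation disturbs a difference of products by about 2^51 or more, so dropping
    34 further bits costs little precision. *)
Definition check_block (l : list Z) : bool :=
  let e := Z.max 0 (Z.log2 (hd 0 l) - 50) in
  let u := Z.min e 1 in
  check_deltas (deltas u (34 * u) (map (fun a => Z.shiftr a e) l)).

(** Consecutive blocks overlap in 4 entries because the inequality at n involves the indices n - 2,
    ..., n + 2. *)
Fixpoint check_blocks (fuel : nat) (l : list Z) : bool :=
  match fuel with
  | O => true
  | S f => if check_block (firstn 204 l) then check_blocks f (skipn 200 l) else false
  end.

(** Each of x, y, z loses less than one unit of 2^e by truncation, which [u] restores. The shift by
    [s] rounds down, so only the upper bound needs a final [+ u]. *)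
Lemma delta_bounds e s u x y z (f := fun a => Z.shiftr a e) :
  0 <= e -> 0 <= s -> (u = 1 \/ u = 0 /\ e = 0 /\ s = 0) -> 0 <= x -> 0 <= y -> 0 <= z ->
  Z.shiftr (f y * f y - (f x + u) * (f z + u)) s * (2 ^ s * (2 ^ e * 2 ^ e)) <= y ^ 2 - x * z
  /\ y ^ 2 - x * z
     <= (Z.shiftr ((f y + u) * (f y + u) - f x * f z) s + u) * (2 ^ s * (2 ^ e * 2 ^ e)).
Proof.
intros He Hs Hu Hx Hy Hz.
destruct Hu as [-> | (-> & -> & ->)]; [|unfold f; rewrite !Z.shiftr_0_r; lia].
assert (HE : 0 < 2 ^ e) by now apply Z.pow_pos_nonneg.
assert (HS : 0 < 2 ^ s) by now apply Z.pow_pos_nonneg.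
assert (Hf : forall a, 0 <= a -> 0 <= f a /\ f a * 2 ^ e <= a <= (f a + 1) * 2 ^ e).
{ intros a Ha; unfold f; rewrite Z.shiftr_div_pow2 by easy.
  generalize (Z.div_pos a _ Ha HE) (Z.mul_div_le a _ HE) (Z.mul_succ_div_gt a _ HE); lia. }
destruct (Hf x Hx) as (X0 & X1 & X2), (Hf y Hy) as (Y0 & Y1 & Y2), (Hf z Hz) as (Z0 & Z1 & Z2).
assert (L : forall w, Z.shiftr w s * 2 ^ s <= w <= (Z.shiftr w s + 1) * 2 ^ s).
{ intros w; rewrite Z.shiftr_div_pow2 by easy.
  generalize (Z.mul_div_le w _ HS) (Z.mul_succ_div_gt w _ HS); lia. }
set (P := 2 ^ e) in *.
assert (Y3 : (f y * P) * (f y * P) <= y * y) by (apply Z.square_le_mono_nonneg; nia).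
assert (Y4 : y * y <= ((f y + 1) * P) * ((f y + 1) * P)) by (apply Z.square_le_mono_nonneg; nia).
assert (W1 : (f x * P) * (f z * P) <= x * z) by (apply Z.mul_le_mono_nonneg; nia).
assert (W2 : x * z <= ((f x + 1) * P) * ((f z + 1) * P)) by (apply Z.mul_le_mono_nonneg; nia).
assert (PP : 0 <= P * P) by nia.
rewrite Z.pow_2_r; split.
- destruct (L (f y * f y - (f x + 1) * (f z + 1))) as [H _].
  apply (Z.mul_le_mono_nonneg_r _ _ _ PP) in H; lia.
- destruct (L ((f y + 1) * (f y + 1) - f x * f z)) as [_ H].
  apply (Z.mul_le_mono_nonneg_r _ _ _ PP) in H; lia.
Qed.

Lemma check_deltas_correct e s u l : 0 <= e -> 0 <= s ->
  (u = 1 \/ u = 0 /\ e = 0 /\ s = 0) -> Forall (Z.le 0) l ->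
  check_deltas (deltas u s (map (fun a => Z.shiftr a e) l)) = true ->
  forall i, (i + 4 < length l)%nat -> two_log_concave_at (fun k => nth k l 0) (i + 2).
Proof.
intros He Hs Hu; induction l as [|x0 l IH]; [cbn; lia|].
destruct l as [|x1 [|x2 [|x3 [|x4 l]]]]; try (cbn; lia).
intros HF Hc i Hi.
change (map _ (x0 :: _)) with (Z.shiftr x0 e :: map (fun a => Z.shiftr a e) (x1 :: x2 :: x3 :: x4 :: l)) in Hc.
cbn [deltas check_deltas map] in Hc.
match type of Hc with (if ?b then _ else _) = true => destruct b eqn:Hb; [|easy] end.
inversion HF as [|? ? P0 HF1]; subst.
destruct i as [|i].
- clear IH Hc; cbn [fst snd] in Hb.
  rewrite !andb_true_iff, !Z.leb_le, Z.ltb_lt in Hb; destruct Hb as (((B1 & B2) & B3) & B4).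
  inversion HF1 as [|? ? P1 HF2]; inversion HF2 as [|? ? P2 HF3]; 
  inversion HF3 as [|? ? P3 HF4]; inversion HF4 as [|? ? P4 HF5]; subst.
  destruct (delta_bounds e s u x0 x1 x2) as [L1 U1]; try easy.
  destruct (delta_bounds e s u x1 x2 x3) as [L2 U2]; try easy.
  destruct (delta_bounds e s u x2 x3 x4) as [L3 U3]; try easy.
  unfold two_log_concave_at; cbn [Nat.add Nat.sub nth].
  set (C := 2 ^ s * (2 ^ e * 2 ^ e)) in *.
  assert (HC : 0 < C) by (unfold C; repeat apply Z.mul_pos_pos; now apply Z.pow_pos_nonneg).
  cbv beta zeta in *.
  set (D1 := x1 ^ 2 - x0 * x2) in *; set (D2 := x2 ^ 2 - x1 * x3) in *;
  set (D3 := x3 ^ 2 - x2 * x4) in *.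
  match type of B4 with ?h1 * ?h3 < ?l2 * _ => set (h_1 := h1) in *; set (h_3 := h3) in *; set (l_2 := l2) in * end.
  assert (N1 : 0 <= D1) by nia. assert (N3 : 0 <= D3) by nia.
  assert (D1 * D3 <= (h_1 * C) * (h_3 * C)) by (apply Z.mul_le_mono_nonneg; easy).
  assert (0 <= l_2 * C) by (apply Z.mul_nonneg_nonneg; lia).
  assert ((l_2 * C) * (l_2 * C) <= D2 * D2) by (apply Z.mul_le_mono_nonneg; lia).
  assert ((h_1 * h_3) * (C * C) < (l_2 * l_2) * (C * C))
    by (apply Z.mul_lt_mono_pos_r; [now apply Z.mul_pos_pos|easy]).
  lia.
- specialize (IH HF1 Hc i); cbn [length] in *.
  assert (IH' := IH ltac:(lia)); revert IH'.
  unfold two_log_concave_at.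
  replace (S i + 2 - 1)%nat with (S (i + 2 - 1)) by lia.
  replace (S i + 2 - 2)%nat with (S (i + 2 - 2)) by lia.
  now cbn [nth Nat.add].
Qed.

Lemma Forall_skipn {A} (P : A -> Prop) k l : Forall P l -> Forall P (skipn k l).
Proof.
revert l; induction k as [|k IH]; intros [|x l] H; try easy; cbn.
inversion H; now apply IH.
Qed.

Lemma check_block_correct l : Forall (Z.le 0) l -> check_block l = true ->
  forall i, (i + 4 < length l)%nat -> two_log_concave_at (fun k => nth k l 0) (i + 2).
Proof.
unfold check_block; intros HF Hc.
eapply check_deltas_correct; [| | | exact HF | exact Hc]; [lia|lia|].
destruct (Z.max_spec 0 (Z.log2 (hd 0 l) - 50)) as [[H ->]|[H ->]]; [left|right]; lia.
Qed.

Lemma check_blocks_correct fuel l : Forall (Z.le 0) l -> check_blocks fuel l = true ->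
  forall i, (i < 200 * fuel)%nat -> (i + 4 < length l)%nat ->
  two_log_concave_at (fun k => nth k l 0) (i + 2).
Proof.
revert l; induction fuel as [|fuel IH]; intros l HF Hc i Hi Hl; [lia|].
cbn [check_blocks] in Hc; destruct (check_block _) eqn:Hb; [|easy].
assert (Nth : forall a b (m : list Z), nth a (skipn b m) 0 = nth (b + a) m 0)
  by (intros; apply nth_skipn).
destruct (Nat.lt_ge_cases i 200) as [Hi200|Hi200].
- apply check_block_correct with (i := i) in Hb.
  + revert Hb; unfold two_log_concave_at.
    rewrite !nth_firstn.
    repeat match goal with |- context [Nat.ltb ?a 204] =>
      replace (Nat.ltb a 204) with true by (symmetry; apply Nat.ltb_lt; lia) end.
    exact (fun H => H).
  + rewrite <- (firstn_skipn 204 l) in HF; now apply Forall_app in HF.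
  + rewrite length_firstn; lia.
- assert (HF' : Forall (Z.le 0) (skipn 200 l))
    by now apply Forall_skipn.
  specialize (IH _ HF' Hc (i - 200)%nat); rewrite length_skipn in IH.
  assert (IH' := IH ltac:(lia) ltac:(lia)); revert IH'.
  unfold two_log_concave_at; rewrite !Nth.
  replace (200 + (i - 200 + 2 - 1))%nat with (i + 2 - 1)%nat by lia.
  replace (200 + (i - 200 + 2 - 2))%nat with (i + 2 - 2)%nat by lia.
  replace (200 + (i - 200 + 2))%nat with (i + 2)%nat by lia.
  replace (200 + (i - 200 + 2 + 1))%nat with (i + 2 + 1)%nat by lia.
  replace (200 + (i - 200 + 2 + 2))%nat with (i + 2 + 2)%nat by lia.
  exact (fun H => H).
Qed.

(** The first index used is 271 = 273 - 2, and 46 strides of 200 exhaust the remaining 9317 - 271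
    entries. *)
Lemma table_check : check_blocks 46 (skipn 271 (table 136)) = true.
Proof. vm_cast_no_check (eq_refl true). Qed.

Lemma two_log_concave_small n : 273 <= Z.of_nat n <= 9300 ->
  two_log_concave_at (fun k => cnt k (Z.of_nat k)) n.
Proof.
intros Hn; pose (f := fun k => cnt k (Z.of_nat k)).
assert (HT : exists L, Z.of_nat L = 9317 /\ table 136 = map f (seq 0 L)).
{ exists (136 * 137 / 2 + 1)%nat; split; [now vm_compute|apply table_eq]. }
destruct HT as (L & HL & ET).
assert (HC := table_check); revert HC ET; generalize (table 136); intros l HC ET.
assert (Hnth : forall k, (k < L)%nat -> nth k l 0 = f k).
{ intros k Hk; rewrite ET, nth_indep with (d' := f 0%nat) by (rewrite length_map, length_seq; lia).
  now rewrite map_nth, seq_nth by lia. }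
assert (HF : Forall (Z.le 0) (skipn 271 l)).
{ assert (HF : Forall (Z.le 0) l).
  { rewrite ET; apply Forall_map, Forall_forall; intros; apply cnt_nonneg. }
  now apply Forall_skipn. }
assert (H := check_blocks_correct 46 _ HF HC (n - 273)).
rewrite length_skipn, ET, length_map, length_seq, <- ET in H.
specialize (H ltac:(lia) ltac:(lia)); revert H.
fold f; unfold two_log_concave_at; rewrite !nth_skipn.
replace (271 + (n - 273 + 2 - 1))%nat with (n - 1)%nat by lia.
replace (271 + (n - 273 + 2 - 2))%nat with (n - 2)%nat by lia.
replace (271 + (n - 273 + 2))%nat with n by lia.
replace (271 + (n - 273 + 2 + 1))%nat with (n + 1)%nat by lia.
replace (271 + (n - 273 + 2 + 2))%nat with (n + 2)%nat by lia.
rewrite !Hnth by lia; exact (fun H => H).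
Qed.

Open Scope R_scope.

(** * Power sums *)

Fixpoint psum (f : nat -> R) (m : nat) : R :=
  match m with O => 0 | S i => psum f i + f (S i) end.

Lemma psum_le f g m : (forall k, (1 <= k <= m)%nat -> f k <= g k) ->
  psum f m <= psum g m.
Proof.
induction m as [|m IH]; intros H; simpl; [lra|].
apply Rplus_le_compat; [apply IH; intros; apply H|apply H]; lia.
Qed.

Lemma psum_ext f g m : (forall k, (1 <= k <= m)%nat -> f k = g k) ->
  psum f m = psum g m.
Proof. intros H; apply Rle_antisym; apply psum_le; intros; rewrite H by easy; lra. Qed.

Lemma psum_plus f g m : psum (fun k => f k + g k) m = psum f m + psum g m.
Proof. induction m as [|m IH]; simpl; [|rewrite IH]; ring. Qed.

Lemma psum_scal c f m : psum (fun k => c * f k) m = c * psum f m.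
Proof. induction m as [|m IH]; simpl; [|rewrite IH]; ring. Qed.

Lemma psum_ge0 f m : (forall k, (1 <= k <= m)%nat -> 0 <= f k) -> 0 <= psum f m.
Proof.
intros H; replace 0 with (psum (fun _ => 0) m).
- now apply psum_le.
- clear H; induction m as [|m IH]; simpl; [|rewrite IH]; ring.
Qed.

(** Truncated polylogarithm: the full series is an Eulerian polynomial in q divided by (1 - q)^(p +
    1), which explains the closed forms below. *)
Definition pw (p : nat) (q : R) (m : nat) : R := psum (fun k => INR k ^ p * q ^ k) m.

Lemma pw_ge0 p q m : 0 <= q -> 0 <= pw p q m.
Proof.
intros Hq; apply psum_ge0; intros k _.
apply Rmult_le_pos; apply pow_le; [apply pos_INR|easy].
Qed.

Lemma pw1_closed q m : (1 - q) ^ 2 * pw 1 q m = q - q ^ S m * (INR m + 1 - INR m * q).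
Proof.
unfold pw; induction m as [|m IH]; [simpl; ring|].
cbn [psum]; rewrite Rmult_plus_distr_l, IH, S_INR; simpl pow; ring.
Qed.

Lemma pw2_closed q m : (1 - q) ^ 3 * pw 2 q m = q * (1 + q) -
  q ^ S m * ((INR m + 1) ^ 2 - (2 * INR m ^ 2 + 2 * INR m - 1) * q + INR m ^ 2 * q ^ 2).
Proof.
unfold pw; induction m as [|m IH]; [simpl; ring|].
cbn [psum]; rewrite Rmult_plus_distr_l, IH, S_INR; simpl pow; ring.
Qed.

Lemma pw3_closed q m : (1 - q) ^ 4 * pw 3 q m = q * (1 + 4 * q + q ^ 2) -
  q ^ S m * ((INR m + 1) ^ 3 - (3 * INR m ^ 3 + 6 * INR m ^ 2 - 4) * q
     + (3 * INR m ^ 3 + 3 * INR m ^ 2 - 3 * INR m + 1) * q ^ 2 - INR m ^ 3 * q ^ 3).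
Proof.
unfold pw; induction m as [|m IH]; [simpl; ring|].
cbn [psum]; rewrite Rmult_plus_distr_l, IH, S_INR; simpl pow; ring.
Qed.

Section Bounds.

Variables (q : R) (m : nat).
Hypothesis (Hq : 0 < q < 1) (Hm : (1 <= m)%nat).

Let tail := 4 * (INR m + 1) ^ 3 * q ^ S m.

Let m1 : 1 <= INR m.
Proof. now apply (le_INR 1). Qed.

Lemma pw1_lower : q - tail <= (1 - q) ^ 2 * pw 1 q m.
Proof.
rewrite pw1_closed; unfold tail.
assert (0 < q ^ S m) by (apply pow_lt; lra).
generalize m1; intros Hm1.
assert (INR m + 1 - INR m * q <= 4 * (INR m + 1) ^ 3) by nra.
nra.
Qed.

Lemma pw2_lower : q * (1 + q) - tail <= (1 - q) ^ 3 * pw 2 q m.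
Proof.
rewrite pw2_closed; unfold tail.
assert (0 < q ^ S m) by (apply pow_lt; lra).
generalize m1; intros Hm1.
assert ((INR m + 1) ^ 2 - (2 * INR m ^ 2 + 2 * INR m - 1) * q + INR m ^ 2 * q ^ 2
  <= 4 * (INR m + 1) ^ 3).
{ assert (0 <= (2 * INR m ^ 2 + 2 * INR m - 1) * q) by (apply Rmult_le_pos; nra).
  assert (INR m ^ 2 * q ^ 2 <= INR m ^ 2) by (assert (q ^ 2 <= 1) by nra; assert (0 <= INR m ^ 2) by nra; nra).
  nra. }
nra.
Qed.

Lemma pw3_lower : q * (1 + 4 * q + q ^ 2) - tail <= (1 - q) ^ 4 * pw 3 q m.
Proof.
rewrite pw3_closed; unfold tail.
assert (0 < q ^ S m) by (apply pow_lt; lra).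
generalize m1; intros Hm1; set (a := INR m) in *.
assert (A2 : a <= a ^ 2) by nra.
assert (A3 : a ^ 2 <= a ^ 3) by (replace (a ^ 3) with (a * a ^ 2) by ring; nra).
assert ((a + 1) ^ 3 - (3 * a ^ 3 + 6 * a ^ 2 - 4) * q
  + (3 * a ^ 3 + 3 * a ^ 2 - 3 * a + 1) * q ^ 2 - a ^ 3 * q ^ 3 <= 4 * (a + 1) ^ 3).
{ assert (0 <= (3 * a ^ 3 + 6 * a ^ 2 - 4) * q) by (apply Rmult_le_pos; lra).
  assert (0 <= a ^ 3 * q ^ 3) by (apply Rmult_le_pos; [lra|apply pow_le; lra]).
  assert (Hq2 : 0 <= q ^ 2 <= 1) by nra.
  assert ((3 * a ^ 3 + 3 * a ^ 2 - 3 * a + 1) * q ^ 2 <= (3 * a ^ 3 + 3 * a ^ 2 - 3 * a + 1)) by nra.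
  replace ((a + 1) ^ 3) with (a ^ 3 + 3 * a ^ 2 + 3 * a + 1) by ring; lra. }
nra.
Qed.

(** Summation by parts; the boundary term at [m] is dropped thanks to its sign. *)
Lemma abel_upper (c c' : nat -> R) : c 0%nat = 0 -> 0 <= c m ->
  (forall k, c (S k) - c k = c' (S k)) ->
  (1 - q) * psum (fun k => c k * q ^ k) m <= psum (fun k => c' k * q ^ k) m.
Proof.
intros c0 cm Hc.
assert (E : (1 - q) * psum (fun k => c k * q ^ k) m
  = psum (fun k => c' k * q ^ k) m - c m * q ^ S m).
{ clear cm Hm tail m1; induction m as [|n IH]; [simpl; rewrite c0; ring|].
  cbn [psum]; rewrite Rmult_plus_distr_l, IH; rewrite <- Hc; simpl pow; ring. }
assert (0 <= c m * q ^ S m) by (apply Rmult_le_pos; [easy|apply pow_le; lra]).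
lra.
Qed.

Lemma pw1_upper : (1 - q) ^ 2 * pw 1 q m <= q.
Proof.
rewrite pw1_closed.
assert (0 < q ^ S m) by (apply pow_lt; lra).
assert (0 <= INR m + 1 - INR m * q) by (generalize (pos_INR m); nra).
nra.
Qed.

(** Rising factorials dominate k^p, and their generating series is exactly p! q / (1 - q)^(p + 1).
    Their backward differences are multiples of rising factorials of lower degree, which suits
    [abel_upper]. *)
Let rise (p : nat) (k : nat) : R :=
  let a := INR k in
  match p with
  | 2%nat => a * (a + 1) | 3%nat => a * (a + 1) * (a + 2)
  | 4%nat => a * (a + 1) * (a + 2) * (a + 3) | _ => a end.

Let rise_upper p : (1 <= p <= 4)%nat ->
  (1 - q) ^ S p * psum (fun k => rise p k * q ^ k) m <= INR (fact p) * q.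
Proof.
intros Hp; induction p as [|p IH]; [lia|].
destruct p as [|p].
- generalize pw1_upper; unfold pw; intros H; simpl fact; simpl INR.
  rewrite (psum_ext _ (fun k => INR k ^ 1 * q ^ k)); [lra|intros; simpl; ring].
- assert (IH' := IH ltac:(lia)); clear IH.
  assert (H := abel_upper (rise (S (S p))) (fun k => INR (S (S p)) * rise (S p) k)).
  assert (Hs : (1 - q) * psum (fun k => rise (S (S p)) k * q ^ k) m
     <= INR (S (S p)) * psum (fun k => rise (S p) k * q ^ k) m).
  { rewrite <- (psum_scal (INR (S (S p)))).
    replace (psum (fun k => INR (S (S p)) * (rise (S p) k * q ^ k)) m)
      with (psum (fun k => INR (S (S p)) * rise (S p) k * q ^ k) m)
      by (apply psum_ext; intros; ring).
    apply H.
    - unfold rise; destruct p as [|[|[|p]]]; simpl; ring.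
    - generalize (pos_INR m); intros; unfold rise; destruct p as [|[|[|p]]]; cbv zeta; try nra;
        repeat apply Rmult_le_pos; lra.
    - intros k; assert (Hp' : (p <= 2)%nat) by lia; unfold rise; rewrite S_INR.
      destruct p as [|[|[|p]]]; [simpl; ring|simpl; ring|simpl; ring|lia]. }
  assert (P : 0 <= (1 - q) ^ S (S p)) by (apply pow_le; lra).
  apply (Rmult_le_compat_l _ _ _ P) in Hs.
  change (fact (S (S p))) with ((S (S p)) * fact (S p))%nat; rewrite mult_INR.
  assert (0 <= INR (S (S p))) by apply pos_INR.
  apply (Rmult_le_compat_l _ _ _ H0) in IH'.
  replace ((1 - q) ^ S (S (S p))) with ((1 - q) ^ S (S p) * (1 - q)) by (simpl; ring).
  lra.
Qed.

Lemma pw_upper p : (1 <= p <= 4)%nat -> (1 - q) ^ S p * pw p q m <= INR (fact p) * q.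
Proof.
intros Hp; eapply Rle_trans; [|now apply rise_upper].
apply Rmult_le_compat_l; [apply pow_le; lra|].
apply psum_le; intros k Hk.
apply Rmult_le_compat_r; [apply pow_le; lra|].
generalize (pos_INR k); unfold rise; intros; destruct p as [|[|[|[|[|p]]]]]; try lia; simpl; try nra.
Qed.

End Bounds.

(** * The saddle point *)

(* Mean and variance of the sum of the random set containing each [k <= m]
   independently with probability [r^k / (1 + r^k)]. *)
Definition mean (r : R) (m : nat) : R := psum (fun k => INR k * (r ^ k / (1 + r ^ k))) m.
Definition variance (r : R) (m : nat) : R :=
  psum (fun k => INR k ^ 2 * (r ^ k / (1 + r ^ k) ^ 2)) m.

Lemma pow_mult_r r j k : (r ^ j) ^ k = (r ^ k) ^ j.
Proof. rewrite <- !pow_mult; f_equal; lia. Qed.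

Lemma pow_01 r k : 0 < r < 1 -> (1 <= k)%nat -> 0 < r ^ k < 1.
Proof. intros Hr Hk; split; [apply pow_lt; lra|]. 
apply pow_lt_1_compat; [lra|lia]. Qed.

Section Weights.

Variables (r d : R) (m : nat).
Hypothesis (Hr : 0 < r < 1) (Hrd : r = 1 - d) (Hm : (1 <= m)%nat).
Hypothesis (Htail : 4 * (INR m + 1) ^ 3 * r ^ S m <= / 1000000).

Lemma tail_le j : (1 <= j)%nat -> 4 * (INR m + 1) ^ 3 * (r ^ j) ^ S m <= / 1000000.
Proof.
intros Hj; eapply Rle_trans; [|exact Htail].
apply Rmult_le_compat_l.
- generalize (pos_INR m); intros; apply Rmult_le_pos; [lra|apply pow_le; lra].
- apply pow_incr; split; [apply pow_le; lra|].
  destruct j as [|j]; [lia|]; simpl.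
  assert (r ^ j <= 1) by (rewrite <- (pow1 j); apply pow_incr; lra).
  nra.
Qed.

Lemma psum_poly3 p a b c e :
  psum (fun k => INR k ^ p * (a * r ^ k + b * (r ^ k) ^ 2 + c * (r ^ k) ^ 3 + e * (r ^ k) ^ 4)) m
  = a * pw p r m + b * pw p (r ^ 2) m + c * pw p (r ^ 3) m + e * pw p (r ^ 4) m.
Proof.
unfold pw; rewrite <- !psum_scal, <- !psum_plus; apply psum_ext; intros k _.
rewrite !(pow_mult_r r _ k); ring.
Qed.

(** Uses x / (1 + x) <= x - x^2 / 2 on [0, 1]. For small d the bound is close to 7/8, against the
    true limit pi^2 / 12. *)
Lemma mean_upper : d <= / 50 -> d ^ 2 * mean r m <= 1 - d - (1 - d) ^ 2 / (2 * (2 - d) ^ 2) + / 1000.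
Proof.
intros Hd.
assert (H1 : mean r m <= psum (fun k => INR k ^ 1 *
  (1 * r ^ k + (- / 2) * (r ^ k) ^ 2 + 0 * (r ^ k) ^ 3 + 0 * (r ^ k) ^ 4)) m).
{ apply psum_le; intros k Hk; rewrite pow_1.
  apply Rmult_le_compat_l; [apply pos_INR|].
  assert (Hx := pow_01 r k Hr ltac:(lia)); set (x := r ^ k) in *.
  apply Rmult_le_reg_r with (1 + x); [lra|].
  unfold Rdiv; rewrite Rmult_assoc, Rinv_l by lra; nra. }
rewrite psum_poly3 in H1.
assert (U := pw1_upper r m Hr Hm).
assert (L := pw1_lower (r ^ 2) m (pow_01 r 2 Hr ltac:(lia)) Hm).
assert (T := tail_le 2 ltac:(lia)).
replace (1 - r) with d in U by lra.
assert (E : 1 - r ^ 2 = d * (2 - d)) by (rewrite Hrd; ring).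
rewrite E in L.
set (P := pw 1 (r ^ 2) m) in *; set (Q := pw 1 r m) in *.
assert (D : 0 < d) by lra.
assert (LP : (r ^ 2 - / 1000000) / (2 - d) ^ 2 <= d ^ 2 * P).
{ apply Rmult_le_reg_r with ((2 - d) ^ 2); [nra|].
  unfold Rdiv; rewrite Rmult_assoc, Rinv_l by nra.
  replace ((d * (2 - d)) ^ 2 * P) with (d ^ 2 * P * (2 - d) ^ 2) in L by ring; lra. }
assert (K : (1 - d) ^ 2 / (2 * (2 - d) ^ 2) - / 1000 <= / 2 * ((r ^ 2 - / 1000000) / (2 - d) ^ 2)).
{ rewrite <- Hrd.
  replace (/ 2 * ((r ^ 2 - / 1000000) / (2 - d) ^ 2)) with
    (r ^ 2 / (2 * (2 - d) ^ 2) - / 2000000 * / (2 - d) ^ 2) by (field; nra).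
  assert (/ (2 - d) ^ 2 <= 1) by (rewrite <- Rinv_1; apply Rinv_le_contravar; nra).
  nra. }
assert (D2 : 0 <= d ^ 2) by nra.
apply (Rmult_le_compat_l _ _ _ D2) in H1.
rewrite !Rmult_0_l, !Rplus_0_r, Rmult_1_l, Rmult_plus_distr_l in H1.
replace (d ^ 2 * (- / 2 * P)) with (- / 2 * (d ^ 2 * P)) in H1 by ring.
lra.
Qed.

Hypothesis (Hd : d <= 97 / 10000).

(** The quotient (1 - r^j) / d as a polynomial in d. *)
Let g (j : nat) : R := match j with 1%nat => 1 | 2%nat => 2 - d
  | 3%nat => 3 - 3 * d + d ^ 2 | _ => 4 - 6 * d + 4 * d ^ 2 - d ^ 3 end.

Let scaled_upper j p G c : (1 <= j <= 4)%nat -> (1 <= p <= 4)%nat -> 0 < G ->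
  G <= g j ^ S p -> INR (fact p) * r ^ j <= c * G -> d ^ S p * pw p (r ^ j) m <= c.
Proof.
intros Hj Hp HG Hg Hc.
assert (U := pw_upper (r ^ j) m (pow_01 r j Hr ltac:(lia)) Hm p Hp).
assert (E : 1 - r ^ j = d * g j)
  by (rewrite Hrd; unfold g; destruct j as [|[|[|[|[|j]]]]]; try lia; ring).
rewrite E, Rpow_mult_distr in U.
assert (Y : 0 <= d ^ S p * pw p (r ^ j) m).
{ apply Rmult_le_pos; [apply pow_le; lra|].
  apply pw_ge0, pow_le; lra. }
set (Y' := d ^ S p * pw p (r ^ j) m) in *.
apply Rmult_le_reg_r with G; [easy|].
replace (d ^ S p * g j ^ S p * pw p (r ^ j) m) with (g j ^ S p * Y') in U by (unfold Y'; ring).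
nra.
Qed.

Let d_pos : 0 < d. Proof. lra. Qed.

Let pow_lower k : 1 - INR k * d <= r ^ k.
Proof.
replace r with (1 + - d) by lra.
replace (1 - INR k * d) with (1 + INR k * - d) by ring.
generalize d_pos; intros; induction k as [|k IH]; [simpl; lra|].
rewrite S_INR; simpl pow.
assert (0 <= INR k) by apply pos_INR; nra.
Qed.

Let scaled_lower j p G c N : (2 <= j <= 4)%nat \/ j = 1%nat -> 0 < G -> 0 < g j ->
  g j ^ S p <= G -> N - / 1000000 <= (1 - r ^ j) ^ S p * pw p (r ^ j) m ->
  c * G <= N - / 1000000 -> c <= d ^ S p * pw p (r ^ j) m.
Proof.
intros Hj HG Hg0 Hg L Hc.
assert (E : 1 - r ^ j = d * g j)
  by (rewrite Hrd; unfold g; destruct j as [|[|[|[|[|j]]]]]; try lia; ring).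
rewrite E, Rpow_mult_distr in L.
assert (Y : 0 <= d ^ S p * pw p (r ^ j) m).
{ apply Rmult_le_pos; [apply pow_le; lra|].
  apply pw_ge0, pow_le; lra. }
set (Y' := d ^ S p * pw p (r ^ j) m) in *.
apply Rmult_le_reg_r with G; [easy|].
replace (d ^ S p * g j ^ S p * pw p (r ^ j) m) with (g j ^ S p * Y') in L by (unfold Y'; ring).
nra.
Qed.

(* Termwise bound [1 - 2 x + 2 x^2 - 3/4 x^3 <= 1 / (1 + x)^2], whose defect has a
   double zero at [x = 1], so that it loses little on the whole of [0, 1]. *)
Lemma variance_lower : 1588 / 1000 <= d ^ 3 * variance r m.
Proof.
assert (D := d_pos).
assert (H1 : psum (fun k => INR k ^ 2 *
  (1 * r ^ k + (- 2) * (r ^ k) ^ 2 + 2 * (r ^ k) ^ 3 + (- 3 / 4) * (r ^ k) ^ 4)) m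
  <= variance r m).
{ apply psum_le; intros k Hk.
  apply Rmult_le_compat_l; [apply pow_le, pos_INR|].
  assert (Hx := pow_01 r k Hr ltac:(lia)); set (x := r ^ k) in *.
  apply Rmult_le_reg_r with ((1 + x) ^ 2); [nra|].
  replace (x / (1 + x) ^ 2 * (1 + x) ^ 2) with x by (field; lra).
  assert (0 <= x ^ 3 * (1 - x) ^ 2 * (1 + 3 / 4 * x)) by
    (repeat apply Rmult_le_pos; try apply pow_le; lra).
  nra. }
rewrite psum_poly3 in H1.
assert (P : 0 <= d ^ 3) by (apply pow_le; lra).
apply (Rmult_le_compat_l _ _ _ P) in H1.
(* As d tends to 0 the scaled sums at r^j tend to 2 / j^3, so the bound would become 1.6247; the
   limit of the scaled variance itself is pi^2 / 6. *)
assert (A1 : 19708 / 10000 <= d ^ 3 * pw 2 (r ^ 1) m).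
{ apply (scaled_lower 1 2 1 _ (r ^ 1 * (1 + r ^ 1))); [lia|lra|simpl; lra|simpl; lra| |].
  - eapply Rle_trans; [|apply pw2_lower; [rewrite pow_1; lra|easy]].
    generalize (tail_le 1 ltac:(lia)); lra.
  - rewrite pow_1, Hrd; nra. }
assert (A2 : d ^ 3 * pw 2 (r ^ 2) m <= / 4).
{ apply (scaled_upper 2 2 (8 - 12 * d)); try lia; try (simpl; nra). }
assert (A3 : 708 / 10000 <= d ^ 3 * pw 2 (r ^ 3) m).
{ assert (B := pow_lower 3); simpl INR in B.
  apply (scaled_lower 3 2 27 _ (r ^ 3 * (1 + r ^ 3))); [lia|lra|simpl; nra| | |].
  - replace 27 with (3 ^ 3) by ring; apply pow_incr; unfold g; nra.
  - eapply Rle_trans; [|apply pw2_lower; [apply pow_01; [lra|lia]|easy]].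
    generalize (tail_le 3 ltac:(lia)); lra.
  - nra. }
assert (A4 : d ^ 3 * pw 2 (r ^ 4) m <= 317 / 10000).
{ apply (scaled_upper 4 2 (64 - 288 * d)); try lia; try lra.
  - assert (4 - 6 * d <= g 4) by (unfold g; nra).
    apply Rle_trans with ((4 - 6 * d) ^ 3); [simpl; nra|apply pow_incr; lra].
  - simpl INR; assert (r ^ 4 <= 1 - 4 * d + 6 * d ^ 2) by (rewrite Hrd; nra); nra. }
rewrite pow_1 in A1; lra.
Qed.

Lemma variance_upper : d ^ 3 * variance r m <= 2.
Proof.
assert (D := d_pos).
apply Rle_trans with (d ^ 3 * pw 2 (r ^ 1) m).
- apply Rmult_le_compat_l; [apply pow_le; lra|].
  apply psum_le; intros k Hk; apply Rmult_le_compat_l; [apply pow_le, pos_INR|].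
  rewrite pow_1; assert (Hx := pow_01 r k Hr ltac:(lia)).
  apply Rle_div_l; nra.
- apply (scaled_upper 1 2 1); try lia; try (simpl; lra).
Qed.

(** The sum is the third cumulant and governs the phase. The termwise majorant x - 4 x^2 + 9 x^3 - 6
    x^4 agrees with the Taylor expansion up to x^3, and its last coefficient makes it vanish at x =
    1 like the left-hand side. *)
Lemma skew_upper : d ^ 4 * psum (fun k => INR k ^ 3 *
   (r ^ k * (1 - r ^ k) / (1 + r ^ k) ^ 3)) m <= 5105 / 1000.
Proof.
assert (D := d_pos).
assert (H1 : psum (fun k => INR k ^ 3 *
   (r ^ k * (1 - r ^ k) / (1 + r ^ k) ^ 3)) m <= psum (fun k => INR k ^ 3 *
  (1 * r ^ k + (- 4) * (r ^ k) ^ 2 + 9 * (r ^ k) ^ 3 + (- 6) * (r ^ k) ^ 4)) m).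
{ apply psum_le; intros k Hk.
  apply Rmult_le_compat_l; [apply pow_le, pos_INR|].
  assert (Hx := pow_01 r k Hr ltac:(lia)); set (x := r ^ k) in *.
  apply Rle_div_l; [apply pow_lt; lra|].
  assert (0 <= x ^ 4 * (1 - x) * (10 + 15 * x + 6 * x ^ 2)).
  { repeat apply Rmult_le_pos; try lra; nra. }
  nra. }
rewrite psum_poly3 in H1.
assert (P : 0 <= d ^ 4) by (apply pow_le; lra).
apply (Rmult_le_compat_l _ _ _ P) in H1.
assert (A1 : d ^ 4 * pw 3 (r ^ 1) m <= 6).
{ apply (scaled_upper 1 3 1); try lia; try (simpl; lra). }
assert (A2 : 3604 / 10000 <= d ^ 4 * pw 3 (r ^ 2) m).
{ assert (B := pow_lower 2); simpl INR in B.
  apply (scaled_lower 2 3 16 _ (r ^ 2 * (1 + 4 * r ^ 2 + (r ^ 2) ^ 2))); [lia|lra|simpl; lra| | |].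
  - replace 16 with (2 ^ 4) by ring; apply pow_incr; unfold g; lra.
  - eapply Rle_trans; [|apply pw3_lower; [apply pow_01; [lra|lia]|easy]].
    generalize (tail_le 2 ltac:(lia)); lra.
  - set (x := r ^ 2) in *; assert (9806 / 10000 <= x) by lra.
    assert (9615 / 10000 <= x ^ 2) by nra. nra. }
assert (A3 : d ^ 4 * pw 3 (r ^ 3) m <= 749 / 10000).
{ apply (scaled_upper 3 3 (81 - 324 * d)); try lia; try lra.
  - assert (3 - 3 * d <= g 3) by (unfold g; nra).
    apply Rle_trans with ((3 - 3 * d) ^ 4); [simpl; nra|apply pow_incr; lra].
  - simpl INR; assert (r ^ 3 <= 1 - 3 * d + 3 * d ^ 2) by (rewrite Hrd; nra); nra. }
assert (A4 : 216 / 10000 <= d ^ 4 * pw 3 (r ^ 4) m).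
{ assert (B := pow_lower 4); simpl INR in B.
  apply (scaled_lower 4 3 256 _ (r ^ 4 * (1 + 4 * r ^ 4 + (r ^ 4) ^ 2))); [lia|lra| | | |].
  - unfold g; nra.
  - replace 256 with (4 ^ 4) by ring; apply pow_incr; unfold g; nra.
  - eapply Rle_trans; [|apply pw3_lower; [apply pow_01; [lra|lia]|easy]].
    generalize (tail_le 4 ltac:(lia)); lra.
  - set (x := r ^ 4) in *; assert (961 / 1000 <= x) by lra.
    assert (9235 / 10000 <= x ^ 2) by nra. nra. }
rewrite pow_1 in A1; lra.
Qed.

Lemma pw4_scaled_upper : d ^ 5 * pw 4 r m <= 24.
Proof.
generalize (scaled_upper 1 4 1 24); rewrite pow_1; intros H; apply H; try lia; try (simpl; lra).
Qed.

Lemma pw4_sq_scaled_upper : d ^ 5 * pw 4 (r ^ 2) m <= 77 / 100.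
Proof.
assert (D := d_pos).
apply (scaled_upper 2 4 (32 - 80 * d)); try lia; try lra.
- unfold g; nra.
- simpl INR; assert (r ^ 2 = 1 - 2 * d + d ^ 2) by (rewrite Hrd; ring); nra.
Qed.

End Weights.

Lemma mean_continuity m r : 0 <= r -> continuity_pt (fun r => mean r m) r.
Proof.
intros Hr; unfold mean; induction m as [|m IH]; cbn [psum].
- now apply continuity_const.
- apply continuity_pt_plus; [exact IH|].
  apply continuity_pt_filterlim.
  apply (ex_derive_continuous (fun r => INR (S m) * (r ^ S m / (1 + r ^ S m))) r).
  auto_derive.
  assert (0 <= r ^ S m) by now apply pow_le.
  simpl in *; lra.
Qed.

Lemma sum_INR m : psum INR m = INR m * (INR m + 1) / 2.
Proof. induction m as [|m IH]; [simpl; lra|cbn [psum]; rewrite IH, S_INR; lra]. Qed.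

(** Only the terms k <= i are kept, each with r^k / (1 + r^k) >= r^i / 2. This bounds r^i from above
    before anything is known about 1 - r. *)
Lemma mean_lower r i m : 0 < r < 1 -> (i <= m)%nat ->
  r ^ i * (INR i * (INR i + 1) / 4) <= mean r m.
Proof.
intros Hr Him.
apply Rle_trans with (mean r i).
- replace (r ^ i * (INR i * (INR i + 1) / 4)) with (r ^ i / 2 * psum INR i)
    by (rewrite sum_INR; field).
  rewrite <- psum_scal; apply psum_le; intros k Hk.
  rewrite (Rmult_comm _ (INR k)); apply Rmult_le_compat_l; [apply pos_INR|].
  assert (Hx := pow_01 r k Hr ltac:(lia)).
  assert (r ^ i <= r ^ k).
  { replace i with (k + (i - k))%nat by lia; rewrite pow_add.
    assert (r ^ (i - k) <= 1) by (rewrite <- (pow1 (i - k)); apply pow_incr; lra).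
    nra. }
  apply Rmult_le_reg_r with (2 * (1 + r ^ k)); [lra|].
  replace (r ^ k / (1 + r ^ k) * (2 * (1 + r ^ k))) with (2 * r ^ k) by (field; lra).
  nra.
- induction Him as [|m Him IH]; [lra|].
  unfold mean in *; cbn [psum].
  assert (0 <= INR (S m) * (r ^ S m / (1 + r ^ S m))); [|lra].
  assert (Hx := pow_01 r (S m) Hr ltac:(lia)).
  apply Rmult_le_pos; [apply pos_INR|apply Rdiv_le_0_compat; lra].
Qed.

Lemma mean_le r m : 0 < r < 1 -> (1 <= m)%nat -> (1 - r) ^ 2 * mean r m <= 1.
Proof.
intros Hr Hm; apply Rle_trans with ((1 - r) ^ 2 * pw 1 r m).
- apply Rmult_le_compat_l; [apply pow_le; lra|].
  apply psum_le; intros k Hk; rewrite pow_1; apply Rmult_le_compat_l; [apply pos_INR|].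
  assert (Hx := pow_01 r k Hr ltac:(lia)); apply Rle_div_l; nra.
- generalize (pw1_upper r m Hr Hm); lra.
Qed.

Lemma saddle_exists n : 9300 <= INR n -> exists m r,
  (n + 2 <= m)%nat /\ 0 < r < 1 /\ mean r m = INR n /\ 1 - r <= 97 / 10000 /\
  4 * (INR m + 1) ^ 3 * r ^ S m <= / 1000000.
Proof.
intros Hn.
set (a := INR n) in *.
(* With i = n^5, [mean_lower] forces r^i <= 4 / n^9, so r^(2 i) <= 16 / n^18, which beats the factor
   m^3 of order n^15 in the tail condition for m = 2 i. *)
pose (i := (n ^ 5)%nat).
assert (Ei : INR i = a ^ 5) by (unfold i; now rewrite pow_INR).
assert (A2 : a <= a ^ 2) by nra.
assert (A3 : 9300 * a ^ 2 <= a ^ 3) by (replace (a ^ 3) with (a * a ^ 2) by ring; nra).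
assert (A5 : a ^ 3 <= a ^ 5) by (replace (a ^ 5) with (a ^ 3 * a ^ 2) by ring; nra).
exists (2 * i)%nat.
assert (Hi : (n + 2 <= i)%nat) by (apply INR_le; rewrite plus_INR, Ei; fold a; simpl INR; nra).
assert (Em : INR (2 * i) = 2 * a ^ 5) by (rewrite mult_INR, Ei; simpl; ring).
destruct (Ranalysis5.IVT_interv (fun r => mean r (2 * i) - a) 0 1) as (r & Hr & E).
- intros r Hr; apply continuity_pt_minus; [apply mean_continuity; lra|].
  now apply continuity_const.
- lra.
- replace (mean 0 (2 * i)) with 0; [lra|].
  unfold mean; rewrite (psum_ext _ (fun k => 0 * 0)), psum_scal; [ring|].
  intros k Hk; rewrite pow_i by lia; field.
- replace (mean 1 (2 * i)) with (/ 2 * psum INR (2 * i)).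
  + rewrite sum_INR, Em; nra.
  + unfold mean; rewrite <- psum_scal; apply psum_ext; intros; rewrite pow1; field.
- assert (Hr0 : r <> 0).
  { intros ->; revert E; replace (mean 0 (2 * i)) with 0; [lra|].
    unfold mean; rewrite (psum_ext _ (fun k => 0 * 0)), psum_scal; [ring|].
    intros k Hk; rewrite pow_i by lia; field. }
  assert (Hr1 : r <> 1).
  { intros ->; revert E; replace (mean 1 (2 * i)) with (/ 2 * psum INR (2 * i)).
    - rewrite sum_INR, Em; nra.
    - unfold mean; rewrite <- psum_scal; apply psum_ext; intros; rewrite pow1; field. }
  exists r.
  assert (Hr' : 0 < r < 1) by lra.
  assert (Em' : mean r (2 * i) = a) by lra.
  assert (T : 4 * (INR (2 * i) + 1) ^ 3 * r ^ S (2 * i) <= / 1000000).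
  { assert (L := mean_lower r i (2 * i) Hr' ltac:(lia)); rewrite Em', Ei in L.
    assert (X : 0 < r ^ i) by (apply pow_lt; lra); set (x := r ^ i) in *.
    assert (Hx : x * a ^ 9 <= 4).
    { apply Rmult_le_reg_r with (a / 4); [lra|].
      replace (x * a ^ 9 * (a / 4)) with (x * (a ^ 5 * a ^ 5 / 4)) by field.
      assert (0 <= x * (a ^ 5 / 4)) by nra. nra. }
    assert (Hr2 : r ^ S (2 * i) <= x ^ 2).
    { unfold x; rewrite <- pow_mult, (Nat.mul_comm i); simpl pow.
      assert (0 < r ^ (2 * i)) by (apply pow_lt; lra). simpl in *; nra. }
    rewrite Em.
    assert (B : (2 * a ^ 5 + 1) ^ 3 <= 27 * a ^ 15).
    { replace (27 * a ^ 15) with ((3 * a ^ 5) ^ 3) by ring; apply pow_incr; nra. }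
    apply Rle_trans with (4 * (27 * a ^ 15) * x ^ 2).
    - apply Rmult_le_compat; try lra; [nra|apply pow_le; lra].
    - apply Rmult_le_reg_r with (a ^ 3); [nra|].
      replace (4 * (27 * a ^ 15) * x ^ 2 * a ^ 3) with (108 * (x * a ^ 9) ^ 2) by ring.
      assert (0 <= x * a ^ 9 ) by (apply Rmult_le_pos; [lra|apply pow_le; lra]).
      assert ((x * a ^ 9) ^ 2 <= 16) by nra. nra. }
  repeat split; try easy; try lia; try lra.
  (* Bootstrap: the crude bound d^2 n <= 1 gives d <= 0.0104, which bounds the error terms in
     [mean_upper]. If d > 0.0097, then d^2 n > 0.875, while [mean_upper] allows at most about
     0.868. *)
  assert (D1 := mean_le r (2 * i) Hr' ltac:(lia)); rewrite Em' in D1.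
  assert (D2 : 1 - r <= 104 / 10000).
  { apply Rnot_lt_le; intros D2; assert (1081 / 10000000 < (1 - r) ^ 2) by nra; nra. }
  assert (D3 := mean_upper r (1 - r) (2 * i) Hr' ltac:(lra) ltac:(lia) T ltac:(lra)).
  rewrite Em' in D3; set (d := 1 - r) in *.
  apply Rnot_lt_le; intros D4.
  assert (D5 : 123 / 1000 <= (1 - d) ^ 2 / (2 * (2 - d) ^ 2)).
  { apply (Rle_div_r (123 / 1000)); [apply Rmult_lt_0_compat; [lra|apply pow_lt; lra]|nra]. }
  assert (9409 / 100000000 < d ^ 2) by nra; nra.
Qed.

(** * The generating polynomial on a circle, in polar form *)

(* With [z = r e^(-iy)]: [sqmod r k y = |1 + z^k|^2] and
   [prod_(k <= m) (1 + z^k) = modulus r m y * e^(-i arg r m y)].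
   The logarithmic derivative of [modulus] is [- decay], and [phase'] is the
   derivative of [phase r m n] when [r] is the saddle point [mean r m = n]. *)
Definition sqmod (r : R) (k : nat) (y : R) : R :=
  1 + 2 * r ^ k * cos (INR k * y) + (r ^ k) ^ 2.

Fixpoint modulus (r : R) (m : nat) (y : R) : R :=
  match m with O => 1 | S i => modulus r i y * sqrt (sqmod r (S i) y) end.

Definition arg (r : R) (m : nat) (y : R) : R :=
  psum (fun k => atan (r ^ k * sin (INR k * y) / (1 + r ^ k * cos (INR k * y)))) m.

Definition phase (r : R) (m : nat) (n y : R) : R := n * y - arg r m y.

Definition decay (r : R) (m : nat) (y : R) : R :=
  psum (fun k => INR k * (r ^ k * sin (INR k * y) / sqmod r k y)) m.

Definition phase' (r : R) (m : nat) (y : R) : R :=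
  psum (fun k => INR k * (r ^ k * (1 - r ^ k) * (1 - cos (INR k * y))
    / ((1 + r ^ k) * sqmod r k y))) m.

(* The real part of [e^(ixy) prod_(k <= m) (1 + z^k)]. *)
Fixpoint trig (r : R) (m : nat) (x y : R) : R :=
  match m with
  | O => cos (x * y)
  | S i => trig r i x y + r ^ m * trig r i (x - INR m) y
  end.

Section Polar.

Variables (r : R).
Hypothesis (Hr : 0 < r < 1).

(** Every factor 1 + z^k lies in the right half-plane, so [atan] gives its argument and no branch
    problem arises in [arg]. *)
Lemma re_pos k y : (1 <= k)%nat -> 0 < 1 + r ^ k * cos (INR k * y).
Proof.
intros Hk; assert (Hx := pow_01 r k Hr Hk); generalize (COS_bound (INR k * y)); nra.
Qed.

Lemma sqmod_sum k y : sqmod r k y =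
  (1 + r ^ k * cos (INR k * y)) ^ 2 + (r ^ k * sin (INR k * y)) ^ 2.
Proof.
unfold sqmod; generalize (sin2_cos2 (INR k * y)); unfold Rsqr; intros H.
transitivity (1 + 2 * r ^ k * cos (INR k * y) + (r ^ k) ^ 2 *
  (sin (INR k * y) * sin (INR k * y) + cos (INR k * y) * cos (INR k * y))); [rewrite H|]; ring.
Qed.

Lemma sqmod_pos k y : (1 <= k)%nat -> 0 < sqmod r k y.
Proof.
intros Hk; rewrite sqmod_sum; generalize (re_pos k y Hk); intros; nra.
Qed.

Lemma modulus_pos m y : 0 < modulus r m y.
Proof.
induction m as [|m IH]; cbn [modulus]; [lra|].
apply Rmult_lt_0_compat; [easy|apply sqrt_lt_R0, sqmod_pos; lia].
Qed.

Lemma trig_polar m x y : trig r m x y = modulus r m y * cos (x * y - arg r m y).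
Proof.
revert x; induction m as [|m IH]; intros x; cbn [trig modulus].
- unfold arg; cbn [psum]; rewrite Rminus_0_r; ring.
- rewrite !IH; unfold arg; cbn [psum]; fold (arg r m y).
  set (k := S m).
  assert (Ha := re_pos k y ltac:(unfold k; lia)).
  assert (HD := sqmod_pos k y ltac:(unfold k; lia)).
  assert (ES := sqmod_sum k y).
  set (th := INR k * y) in *; set (a := 1 + r ^ k * cos th) in *; set (b := r ^ k * sin th) in *.
  set (s := sqrt (sqmod r k y)).
  assert (Hs : 0 < s) by now apply sqrt_lt_R0.
  assert (Es : sqrt (1 + (b / a)²) = s / a).
  { replace (1 + (b / a)²) with (sqmod r k y / a²) by (rewrite ES; unfold Rsqr; field; lra).
    rewrite sqrt_div_alt by (unfold Rsqr; nra); now rewrite sqrt_Rsqr by lra. }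
  assert (Ec : s * cos (atan (b / a)) = a) by (rewrite cos_atan, Es; field; lra).
  assert (En : s * sin (atan (b / a)) = b) by (rewrite sin_atan, Es; field; lra).
  replace (x * y - (arg r m y + atan (b / a))) with ((x * y - arg r m y) - atan (b / a)) by ring.
  replace ((x - INR k) * y - arg r m y) with ((x * y - arg r m y) - th) by (unfold th; ring).
  set (A := x * y - arg r m y); clearbody A; rewrite !cos_minus.
  transitivity (modulus r m y * (cos A * a + sin A * b)); [unfold a, b; ring|].
  transitivity (modulus r m y * (cos A * (s * cos (atan (b / a))) + sin A * (s * sin (atan (b / a)))));
    [now rewrite Ec, En|ring].
Qed.

Lemma is_derive_psum (f f' : nat -> R -> R) m y :
  (forall k, (1 <= k <= m)%nat -> is_derive (f k) y (f' k y)) ->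
  is_derive (fun y => psum (fun k => f k y) m) y (psum (fun k => f' k y) m).
Proof.
induction m as [|m IH]; intros H; cbn [psum].
- apply (is_derive_const (V := R_NormedModule)).
- apply (is_derive_plus (V := R_NormedModule)); [apply IH; intros; apply H; lia|apply H; lia].
Qed.

Lemma is_derive_modulus m y : is_derive (modulus r m) y (- decay r m y * modulus r m y).
Proof.
induction m as [|m IH]; unfold decay; cbn [modulus psum].
- replace (- 0 * 1) with 0 by ring; apply (is_derive_const (V := R_NormedModule)).
- fold (decay r m y); set (k := S m).
  assert (HD := sqmod_pos k y ltac:(unfold k; lia)).
  evar_last.
  + apply (is_derive_mult (modulus r m) (fun y => sqrt (sqmod r k y)) y); [exact IH| |apply Rmult_comm].
    apply (is_derive_comp sqrt (sqmod r k)).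
    * apply is_derive_Reals, derivable_pt_lim_sqrt; exact HD.
    * unfold sqmod; auto_derive; [easy|reflexivity].
  + assert (E := sqrt_sqrt (sqmod r k y) ltac:(lra)).
    assert (0 < sqrt (sqmod r k y)) by now apply sqrt_lt_R0.
    unfold plus, mult, scal; simpl; unfold mult; simpl.
    fold k. set (s := sqrt (sqmod r k y)) in *.
    rewrite <- E. field. lra.
Qed.

(** The saddle point condition turns n into a sum over k, and each difference of terms acquires the
    factor 1 - cos (k y). Hence the derivative vanishes to second order at y = 0. *)
Lemma is_derive_phase m n y : mean r m = n -> is_derive (phase r m n) y (phase' r m y).
Proof.
intros <-; unfold phase.
evar_last.
- apply (is_derive_minus (V := R_NormedModule)).
  + apply (is_derive_scal (fun y => y) y (mean r m) 1), (is_derive_id (K := R_AbsRing)).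
  + unfold arg; apply (is_derive_psum _ (fun k y =>
      INR k * (r ^ k * (cos (INR k * y) + r ^ k) / sqmod r k y))).
    intros k Hk; assert (Ha := re_pos k y ltac:(lia)); assert (ES := sqmod_sum k y).
    assert (HD := sqmod_pos k y ltac:(lia)).
    auto_derive; [lra|].
    unfold Rsqr; rewrite ES; simpl. 
    assert (E := sin2_cos2 (INR k * y)); unfold Rsqr in E.
    set (c := cos (INR k * y)) in *; set (s := sin (INR k * y)) in *; set (x := r ^ k) in *.
    field_simplify_eq; [|split; nra].
    transitivity (x ^ 2 * INR k * (s * s + c * c) + x * INR k * c); [ring|rewrite E; ring].
- unfold minus, plus, opp; simpl.
  rewrite Rmult_1_r; unfold mean, phase'.
  assert (E : forall a b, a + - b = a + (-1) * b) by (intros; ring).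
  rewrite E, <- psum_scal, <- psum_plus; apply psum_ext; intros k Hk.
  assert (HD := sqmod_pos k y ltac:(lia)); assert (Hx := pow_01 r k Hr ltac:(lia)).
  unfold sqmod in *; set (c := cos (INR k * y)) in *; set (x := r ^ k) in *.
  field; lra.
Qed.

Lemma trig_continuous m x y : continuous (trig r m x) y.
Proof.
revert x; induction m as [|m IH]; intros x; cbn [trig].
- apply (ex_derive_continuous (fun y => cos (x * y))); auto_derive; easy.
- apply (continuous_plus (V := R_NormedModule)); [apply IH|].
  apply (continuous_scal_r (V := R_NormedModule)), IH.
Qed.

(** Cauchy's formula on the half circle: only the constant term of the real part survives
    integration over [0, pi]. *)
Lemma RInt_trig m z :
  is_RInt (trig r m (IZR z)) 0 PI (PI * (r ^ Z.to_nat z * IZR (cnt m z))).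
Proof.
revert z; induction m as [|m IH]; intros z; cbn [trig cnt].
- destruct (Z.eqb_spec z 0) as [->|Hz].
  + apply (is_RInt_ext (fun _ => 1)); [intros; now rewrite Rmult_0_l, cos_0|].
    evar_last; [apply (is_RInt_const (V := R_NormedModule))|].
    unfold scal; simpl; unfold mult; simpl; ring.
  + assert (Hz' : IZR z <> 0) by now apply eq_IZR_contrapositive.
    evar_last.
    * apply (is_RInt_derive (fun y => sin (IZR z * y) / IZR z)).
      -- intros y _; auto_derive; [easy|field; easy].
      -- intros y _; apply (trig_continuous 0).
    * unfold minus, plus, opp; simpl.
      rewrite Rmult_0_r, sin_0, Rmult_0_r.
      replace (sin (IZR z * PI)) with 0; [unfold Rdiv; ring|].
      symmetry; apply sin_eq_0_1; now exists z.
- evar_last.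
  + apply (is_RInt_plus (V := R_NormedModule)); [apply IH|].
    apply (is_RInt_scal (V := R_NormedModule)).
    rewrite INR_IZR_INZ, <- minus_IZR; apply IH.
  + unfold plus, scal; simpl plus; simpl; unfold mult; simpl.
    rewrite plus_IZR.
    (* For z < m + 1 the truncation in [Z.to_nat] is harmless because the count it multiplies is
       0. *)
    destruct (Z.lt_ge_cases z (Z.of_nat (S m))) as [Hz|Hz].
    * rewrite (cnt_neg m (z - _)) by lia; ring.
    * replace (Z.to_nat z) with (S m + Z.to_nat (z - Z.of_nat (S m)))%nat by lia.
      rewrite pow_add; simpl; ring.
Qed.

End Polar.

(** * Elementary inequalities *)

Lemma derive_nonneg_le (f f' : R -> R) a b : a <= b ->
  (forall x, a <= x <= b -> is_derive f x (f' x)) ->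
  (forall x, a <= x <= b -> 0 <= f' x) -> f a <= f b.
Proof.
intros Hab Hd Hp.
destruct (MVT_gen f a b f') as (c & Hc & E).
- intros x; rewrite Rmin_left, Rmax_right by easy; intros; apply Hd; lra.
- intros x; rewrite Rmin_left, Rmax_right by easy; intros.
  apply continuity_pt_filterlim, (ex_derive_continuous f); exists (f' x); apply Hd; lra.
- rewrite Rmin_left, Rmax_right in Hc by easy.
  generalize (Hp c Hc); nra.
Qed.

Lemma one_minus_cos x : 1 - cos x = 2 * sin (x / 2) ^ 2.
Proof.
replace (cos x) with (cos (2 * (x / 2))) by (f_equal; field).
rewrite cos_2a_sin; ring.
Qed.

Lemma sin_abs_le x : 0 <= x -> - x <= sin x <= x.
Proof.
intros Hx; destruct (Req_dec x 0) as [->|Hx0]; [rewrite sin_0; lra|].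
split.
- destruct (Rle_lt_dec x 1) as [H|H].
  + generalize (sin_ge_0 x Hx) PI2_3_2; lra.
  + generalize (SIN_bound x); lra.
- generalize (sin_lt_x x ltac:(lra)); lra.
Qed.

Lemma one_minus_cos_bounds x : 0 <= x -> 0 <= 1 - cos x <= x ^ 2 / 2.
Proof.
intros Hx; rewrite one_minus_cos.
generalize (sin_abs_le (x / 2) ltac:(lra)); intros; nra.
Qed.

Lemma sin_lower x : 0 <= x -> x - x ^ 3 / 6 <= sin x.
Proof.
intros Hx; destruct (Rle_lt_dec x 4) as [H|H].
- destruct (pre_sin_bound x 0 Hx H) as [L _].
  unfold sin_approx, sin_term in L; simpl in L; lra.
- generalize (SIN_bound x); intros; nra.
Qed.

Lemma one_minus_cos_lower x : 0 <= x -> x ^ 2 / 2 - x ^ 4 / 24 <= 1 - cos x.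
Proof.
intros Hx.
assert (H := derive_nonneg_le (fun x => 1 - cos x - x ^ 2 / 2 + x ^ 4 / 24)
  (fun x => sin x - (x - x ^ 3 / 6)) 0 x Hx).
cbv beta in H; rewrite cos_0 in H.
assert (H' : 1 - 1 - 0 ^ 2 / 2 + 0 ^ 4 / 24 <= 1 - cos x - x ^ 2 / 2 + x ^ 4 / 24); [|lra].
apply H.
- intros t _; auto_derive; [easy|field].
- intros t Ht; generalize (sin_lower t ltac:(lra)); lra.
Qed.

Lemma exp_1_lower : 2718 / 1000 <= exp 1.
Proof.
generalize (exp_ge_taylor 1 6 ltac:(lra)); simpl; lra.
Qed.

Lemma exp_ge_linear v : 0 <= v -> 2718 / 1000 * v <= exp v.
Proof.
intros Hv; replace v with (1 + (v - 1)) at 2 by ring; rewrite exp_plus.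
generalize exp_1_lower (exp_ineq1_le (v - 1)); intros; nra.
Qed.

Lemma pow_le_exp d k : 0 < d < 1 -> (1 - d) ^ k <= exp (- (INR k * d)).
Proof.
intros Hd; apply Rle_trans with (exp (- d) ^ k).
- apply pow_incr; generalize (exp_ineq1_le (- d)); lra.
- induction k as [|k IH]; [simpl; rewrite Rmult_0_l, Ropp_0, exp_0; lra|].
  rewrite S_INR; simpl pow.
  replace (- ((INR k + 1) * d)) with (- d + - (INR k * d)) by ring; rewrite exp_plus.
  apply Rmult_le_compat_l; [left; apply exp_pos|easy].
Qed.

(* The maximum of [u^2 e^(-u)] is [4 / e^2]. *)
Lemma pow_mul_sq_le d k : 0 < d < 1 -> (1 - d) ^ k * (INR k * d) ^ 2 <= 5415 / 10000.
Proof.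
intros Hd; set (u := INR k * d).
assert (Hu : 0 <= u) by (apply Rmult_le_pos; [apply pos_INR|lra]).
apply Rle_trans with (exp (- u) * u ^ 2).
{ apply Rmult_le_compat_r; [nra|now apply pow_le_exp]. }
assert (H := exp_ge_linear (u / 2) ltac:(lra)).
assert (E : exp (- u) * (exp (u / 2) * exp (u / 2)) = 1).
{ rewrite <- !exp_plus; replace (- u + (u / 2 + u / 2)) with 0 by field; apply exp_0. }
assert (0 < exp (- u)) by apply exp_pos.
set (w := exp (- u)) in *; set (z := exp (u / 2)) in *.
assert ((1359 / 1000 * u) * (1359 / 1000 * u) <= z * z) by (apply Rmult_le_compat; lra).
nra.
Qed.

(** * Bounds near the saddle point *)

Section MainArc.

Variables (r d : R) (m : nat).
Hypothesis (Hr : 0 < r < 1) (Hrd : r = 1 - d) (Hm : (1 <= m)%nat).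
Hypothesis (Htail : 4 * (INR m + 1) ^ 3 * r ^ S m <= / 1000000).
Hypothesis (Hd : d <= 97 / 10000).

Let d_pos : 0 < d. Proof. lra. Qed.

Let V := variance r m.

Let excess k y := 2 * r ^ k * (1 - cos (INR k * y)) / (1 + r ^ k) ^ 2.

Lemma sqmod_excess k y : sqmod r k y = (1 + r ^ k) ^ 2 * (1 - excess k y).
Proof.
assert (0 < r ^ k) by (apply pow_lt; lra).
unfold sqmod, excess; field; lra.
Qed.

(** On the window y <= 0.4 d, [pow_mul_sq_le] bounds r^k (k y)^2 by 0.16 * 0.5415 < 0.0867,
    uniformly in k. *)
Lemma excess_bounds k y : (1 <= k)%nat -> 0 <= y <= 4 / 10 * d ->
  0 <= excess k y <= 867 / 10000 /\ excess k y <= r ^ k * (INR k * y) ^ 2.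
Proof.
intros Hk Hy.
assert (Hx := pow_01 r k Hr Hk).
assert (HK : 0 <= INR k) by apply pos_INR.
assert (Hc := one_minus_cos_bounds (INR k * y) ltac:(nra)).
assert (B := pow_mul_sq_le d k ltac:(lra)); rewrite <- Hrd in B.
unfold excess; set (x := r ^ k) in *; set (u := 1 - cos (INR k * y)) in *.
assert (E : 0 <= 2 * x * u / (1 + x) ^ 2).
{ apply Rdiv_le_0_compat; nra. }
assert (F : 2 * x * u / (1 + x) ^ 2 <= x * (INR k * y) ^ 2).
{ apply Rle_div_l; [nra|].
  assert (2 * x * u <= x * (INR k * y) ^ 2) by nra.
  assert (0 <= x * (INR k * y) ^ 2) by nra. nra. }
repeat split; try lra.
eapply Rle_trans; [exact F|].
assert ((INR k * y) ^ 2 <= 16 / 100 * (INR k * d) ^ 2).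
{ replace (16 / 100 * (INR k * d) ^ 2) with ((INR k * (4 / 10 * d)) ^ 2) by field.
  apply pow_incr; nra. }
nra.
Qed.

Lemma inv_excess_bound a : 0 <= a <= 867 / 10000 -> 1 <= / (1 - a) <= 1095 / 1000.
Proof.
intros Ha; split.
- rewrite <- Rinv_1 at 1; apply Rinv_le_contravar; lra.
- replace (1095 / 1000) with (/ (1000 / 1095)) by field; apply Rinv_le_contravar; lra.
Qed.

(** With a the excess and x = r^k, 1 / (1 - a) = 1 + a / (1 - a) and a <= x (k y)^2. The extra
    factor x turns the cubic error into the fourth power sum at r^2, and 1.095 * 0.77 < 1. *)
Lemma decay_upper y : 0 <= y <= 4 / 10 * d -> decay r m y <= V * y + y ^ 3 / d ^ 5.
Proof.
intros Hy.
apply Rle_trans with (psum (fun k => y * (INR k ^ 2 * (r ^ k / (1 + r ^ k) ^ 2))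
   + (1095 / 1000 * y ^ 3) * (INR k ^ 4 * (r ^ 2) ^ k)) m).
- apply psum_le; intros k Hk.
  destruct (excess_bounds k y ltac:(lia) Hy) as [A1 A2].
  assert (Hi := inv_excess_bound _ A1).
  rewrite sqmod_excess; set (a := excess k y) in *.
  assert (Hx := pow_01 r k Hr ltac:(lia)); rewrite pow_mult_r; set (x := r ^ k) in *.
  assert (HK : 0 <= INR k) by apply pos_INR.
  assert (HS := sin_abs_le (INR k * y) ltac:(nra)); set (th := INR k * y) in *.
  replace (x * sin th / ((1 + x) ^ 2 * (1 - a))) with (x / (1 + x) ^ 2 * (sin th * / (1 - a)))
    by (field; split; lra).
  assert (S : sin th * / (1 - a) <= th + 1095 / 1000 * (th * (x * th ^ 2))).
  { apply Rle_trans with (th * / (1 - a)); [nra|].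
    replace (/ (1 - a)) with (1 + a * / (1 - a)) by (field; lra).
    assert (a * / (1 - a) <= (x * th ^ 2) * (1095 / 1000)) by (apply Rmult_le_compat; lra).
    assert (0 <= th) by (unfold th; nra). nra. }
  assert (X : 0 <= x / (1 + x) ^ 2 <= x).
  { split; [apply Rdiv_le_0_compat; nra|apply Rle_div_l; nra]. }
  set (z := x / (1 + x) ^ 2) in *.
  apply Rle_trans with (INR k * (z * (th + 1095 / 1000 * (th * (x * th ^ 2))))).
  + apply Rmult_le_compat_l; [easy|]; apply Rmult_le_compat_l; lra.
  + unfold th.
    replace (INR k * (z * (INR k * y + 1095 / 1000 * (INR k * y * (x * (INR k * y) ^ 2)))))
      with (y * (INR k ^ 2 * z) + 1095 / 1000 * y ^ 3 * (INR k ^ 4 * (x * z))) by ring.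
    assert (0 <= INR k ^ 4) by (apply pow_le; lra).
    assert (0 <= y ^ 3) by (apply pow_le; lra).
    assert (INR k ^ 4 * (x * z) <= INR k ^ 4 * x ^ 2) by (apply Rmult_le_compat_l; nra).
    nra.
- rewrite psum_plus, !psum_scal; fold (variance r m) (pw 4 (r ^ 2) m); fold V.
  assert (K := pw4_sq_scaled_upper r d m Hr Hrd Hm Hd).
  assert (P : 0 < d ^ 5) by (apply pow_lt; lra).
  assert (Y : 0 <= y ^ 3) by (apply pow_le; lra).
  assert (Q : 1095 / 1000 * pw 4 (r ^ 2) m <= / d ^ 5).
  { apply Rmult_le_reg_l with (d ^ 5); [easy|]; rewrite Rinv_r by lra; lra. }
  unfold Rdiv at 2; rewrite (Rmult_comm V).
  assert (y ^ 3 * (1095 / 1000 * pw 4 (r ^ 2) m) <= y ^ 3 * / d ^ 5)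
    by (apply Rmult_le_compat_l; lra).
  lra.
Qed.

Lemma decay_lower y : 0 <= y <= 4 / 10 * d -> V * y - 4 * y ^ 3 / d ^ 5 <= decay r m y.
Proof.
intros Hy.
apply Rle_trans with (psum (fun k => y * (INR k ^ 2 * (r ^ k / (1 + r ^ k) ^ 2))
   + (- y ^ 3 / 6) * (INR k ^ 4 * r ^ k)) m).
- rewrite psum_plus, !psum_scal; fold (variance r m) (pw 4 r m); fold V.
  assert (K := pw4_scaled_upper r d m Hr Hrd Hm).
  assert (P : 0 < d ^ 5) by (apply pow_lt; lra).
  assert (Y : 0 <= y ^ 3) by (apply pow_le; lra).
  assert (Q : pw 4 r m <= 24 * / d ^ 5).
  { apply Rmult_le_reg_l with (d ^ 5); [easy|].
    replace (d ^ 5 * (24 * / d ^ 5)) with 24 by (field; lra); lra. }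
  assert (y ^ 3 * pw 4 r m <= y ^ 3 * (24 * / d ^ 5)) by (apply Rmult_le_compat_l; lra).
  unfold Rdiv; lra.
- apply psum_le; intros k Hk.
  destruct (excess_bounds k y ltac:(lia) Hy) as [A1 A2].
  assert (Hi := inv_excess_bound _ A1).
  rewrite sqmod_excess; set (a := excess k y) in *.
  assert (Hx := pow_01 r k Hr ltac:(lia)); set (x := r ^ k) in *.
  assert (HK : 0 <= INR k) by apply pos_INR.
  assert (HS := sin_lower (INR k * y) ltac:(nra)); set (th := INR k * y) in *.
  assert (Hth : 0 <= th) by (unfold th; nra).
  replace (x * sin th / ((1 + x) ^ 2 * (1 - a))) with (x / (1 + x) ^ 2 * (sin th * / (1 - a)))
    by (field; split; lra).
  assert (S : th - th ^ 3 / 6 <= sin th * / (1 - a)).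
  (* Dividing a negative sine by 1 - a lowers it, but then th > 3 and the left-hand side is already
     below -1.5, against at least -1.095 on the right. *)
  { destruct (Rle_lt_dec 0 (sin th)) as [S|S]; [nra|].
    assert (3 < th).
    { apply Rnot_le_lt; intros H3; generalize (sin_ge_0 th Hth).
      generalize PI2_3_2; lra. }
    generalize (SIN_bound th); intros; nra. }
  assert (X : 0 <= x / (1 + x) ^ 2 <= x).
  { split; [apply Rdiv_le_0_compat; nra|apply Rle_div_l; nra]. }
  set (z := x / (1 + x) ^ 2) in *.
  apply Rle_trans with (INR k * (z * (th - th ^ 3 / 6))).
  + unfold th.
    replace (INR k * (z * (INR k * y - (INR k * y) ^ 3 / 6)))
      with (y * (INR k ^ 2 * z) + - y ^ 3 / 6 * (INR k ^ 4 * z)) by field.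
    assert (0 <= INR k ^ 4) by (apply pow_le; lra).
    assert (0 <= y ^ 3) by (apply pow_le; lra).
    assert (INR k ^ 4 * z <= INR k ^ 4 * x) by (apply Rmult_le_compat_l; lra).
    nra.
  + apply Rmult_le_compat_l; [easy|]; apply Rmult_le_compat_l; lra.
Qed.

(** The constant 559/200 is 5.105 * 1.095 / 2 rounded up: the third cumulant times the loss from the
    excess times the 1/2 of 1 - cos t <= t^2 / 2. *)
Lemma phase'_bounds y : 0 <= y <= 4 / 10 * d ->
  0 <= phase' r m y <= 559 / 200 * (y ^ 2 / d ^ 4).
Proof.
intros Hy; unfold phase'; split.
- apply psum_ge0; intros k Hk; apply Rmult_le_pos; [apply pos_INR|].
  assert (Hx := pow_01 r k Hr ltac:(lia)).
  assert (HD := sqmod_pos r Hr k y ltac:(lia)).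
  apply Rdiv_le_0_compat; [|nra].
  generalize (COS_bound (INR k * y)); intros; repeat apply Rmult_le_pos; lra.
- apply Rle_trans with (psum (fun k => (1095 / 2000 * y ^ 2) *
     (INR k ^ 3 * (r ^ k * (1 - r ^ k) / (1 + r ^ k) ^ 3))) m).
  + apply psum_le; intros k Hk.
    destruct (excess_bounds k y ltac:(lia) Hy) as [A1 A2].
    assert (Hi := inv_excess_bound _ A1).
    rewrite sqmod_excess; set (a := excess k y) in *.
    assert (Hx := pow_01 r k Hr ltac:(lia)); set (x := r ^ k) in *.
    assert (HK : 0 <= INR k) by apply pos_INR.
    assert (HS := one_minus_cos_bounds (INR k * y) ltac:(nra)); set (u := 1 - cos (INR k * y)) in *.
    replace (x * (1 - x) * u / ((1 + x) * ((1 + x) ^ 2 * (1 - a))))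
      with (x * (1 - x) / (1 + x) ^ 3 * (u * / (1 - a))) by (field; split; lra).
    assert (X : 0 <= x * (1 - x) / (1 + x) ^ 3).
    { apply Rdiv_le_0_compat; [nra|apply pow_lt; lra]. }
    set (z := x * (1 - x) / (1 + x) ^ 3) in *.
    assert (u * / (1 - a) <= (INR k * y) ^ 2 / 2 * (1095 / 1000)) by (apply Rmult_le_compat; lra).
    replace (1095 / 2000 * y ^ 2 * (INR k ^ 3 * z))
      with (INR k * (z * ((INR k * y) ^ 2 / 2 * (1095 / 1000)))) by field.
    apply Rmult_le_compat_l; [easy|]; apply Rmult_le_compat_l; lra.
  + rewrite psum_scal.
    assert (K := skew_upper r d m Hr Hrd Hm Htail Hd).
    assert (P : 0 < d ^ 4) by (apply pow_lt; lra).
    set (S := psum _ m) in *.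
    assert (Q : S <= 5105 / 1000 * / d ^ 4).
    { apply Rmult_le_reg_l with (d ^ 4); [easy|].
      replace (d ^ 4 * (5105 / 1000 * / d ^ 4)) with (5105 / 1000) by (field; lra); lra. }
    assert (Y : 0 <= y ^ 2) by nra.
    assert (0 < / d ^ 4) by now apply Rinv_0_lt_compat.
    assert (y ^ 2 * S <= y ^ 2 * (5105 / 1000 * / d ^ 4)) by (apply Rmult_le_compat_l; lra).
    unfold Rdiv; nra.
Qed.

Lemma phase_bounds n y : mean r m = n -> 0 <= y <= 4 / 10 * d ->
  0 <= phase r m n y <= 559 / 600 * (y ^ 3 / d ^ 4).
Proof.
intros Hn Hy.
assert (P0 : phase r m n 0 = 0).
{ unfold phase, arg; rewrite Rmult_0_r, Rminus_0_l; apply Ropp_eq_0_compat.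
  rewrite (psum_ext _ (fun k => 0 * 0)), psum_scal; [ring|].
  intros; rewrite !Rmult_0_r, sin_0, Rmult_0_r; unfold Rdiv; rewrite Rmult_0_l; apply atan_0. }
split.
- rewrite <- P0; apply derive_nonneg_le with (phase' r m); [lra| |].
  + intros; now apply is_derive_phase.
  + intros; apply phase'_bounds; lra.
- assert (H := derive_nonneg_le (fun y => 559 / 600 * (y ^ 3 / d ^ 4) - phase r m n y)
    (fun y => 559 / 200 * (y ^ 2 / d ^ 4) - phase' r m y) 0 y ltac:(lra)).
  cbv beta in H; rewrite P0 in H.
  assert (H' : 559 / 600 * (0 ^ 3 / d ^ 4) - 0 <= 559 / 600 * (y ^ 3 / d ^ 4) - phase r m n y).
  + apply H.
    * intros t Ht; apply (is_derive_minus (V := R_NormedModule)); [|now apply is_derive_phase].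
      auto_derive; [easy|field; lra].
    * intros t Ht; generalize (phase'_bounds t ltac:(lra)); lra.
  + replace (0 ^ 3 / d ^ 4) with 0 in H' by (field; lra); lra.
Qed.

End MainArc.

(** * Bounds away from the saddle point *)

Lemma cos_sum q m y :
  (1 - 2 * q * cos y + q ^ 2) * psum (fun k => q ^ k * cos (INR k * y)) m
  = q * cos y - q ^ 2 - q ^ S m * cos (INR (S m) * y) + q ^ S (S m) * cos (INR m * y).
Proof.
induction m as [|m IH].
- simpl; rewrite Rmult_0_l, cos_0, Rmult_1_l; ring.
- cbn [psum]; rewrite Rmult_plus_distr_l, IH.
  assert (E : cos (INR (S (S m)) * y) = 2 * cos y * cos (INR (S m) * y) - cos (INR m * y)).
  { rewrite !S_INR.
    replace ((INR m + 1 + 1) * y) with ((INR m + 1) * y + y) by ring.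
    replace (INR m * y) with ((INR m + 1) * y - y) by ring.
    rewrite cos_plus, cos_minus; ring. }
  rewrite E; simpl pow; ring.
Qed.

Lemma geom_sum q m : (1 - q) * psum (fun k => q ^ k) m = q - q ^ S m.
Proof.
induction m as [|m IH]; [simpl; ring|].
cbn [psum]; rewrite Rmult_plus_distr_l, IH; simpl pow; ring.
Qed.

(** The subtracted fraction is the value of the full series, a Poisson kernel with denominator D =
    |1 - q e^(iy)|^2; the right-hand side bounds the truncation at [m]. *)
Lemma versin_sum q m y (D := (1 - q) ^ 2 + 2 * q * (1 - cos y)) : 0 < q < 1 ->
  Rabs ((1 - q) * psum (fun k => q ^ k * (1 - cos (INR k * y))) m
    - q * (1 + q) * (1 - cos y) / D) <= q ^ S m * (1 + 2 / (1 - q)).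
Proof.
intros Hq.
assert (HD : (1 - q) ^ 2 <= D) by (unfold D; generalize (COS_bound y); nra).
assert (H0 : 0 < (1 - q) ^ 2) by nra.
assert (X : 0 < q ^ S m) by (apply pow_lt; lra).
replace ((1 - q) * _ - _) with (q ^ S m * (- 1 + (1 - q) *
  (cos (INR (S m) * y) - q * cos (INR m * y)) / D)).
- rewrite Rabs_mult, (Rabs_pos_eq (q ^ S m)) by lra.
  apply Rmult_le_compat_l; [lra|].
  generalize (COS_bound (INR (S m) * y)) (COS_bound (INR m * y)); intros C1 C2.
  set (c1 := cos (INR (S m) * y)) in *; set (c2 := cos (INR m * y)) in *.
  assert (HB : Rabs ((1 - q) * (c1 - q * c2) / D) <= 2 / (1 - q)).
  { unfold Rdiv; rewrite Rabs_mult, (Rabs_pos_eq (/ D)) by (left; apply Rinv_0_lt_compat; lra).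
    apply Rle_trans with ((1 - q) * 2 * / (1 - q) ^ 2); [|right; field; lra].
    apply Rmult_le_compat; [apply Rabs_pos|left; apply Rinv_0_lt_compat; lra| |
      apply Rinv_le_contravar; lra].
    assert (- 2 <= c1 - q * c2 <= 2) by nra; apply Rabs_le; nra. }
  eapply Rle_trans; [apply Rabs_triang|].
  rewrite (Rabs_left (- 1)); lra.
- assert (E : psum (fun k => q ^ k * (1 - cos (INR k * y))) m
    = psum (fun k => q ^ k) m + (- 1) * psum (fun k => q ^ k * cos (INR k * y)) m).
  { rewrite <- psum_scal, <- psum_plus; apply psum_ext; intros; ring. }
  assert (G := geom_sum q m); assert (C := cos_sum q m y).
  replace (1 - 2 * q * cos y + q ^ 2) with D in C by (unfold D; ring).
  rewrite E; set (P := psum (fun k => q ^ k) m) in *;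
  set (S' := psum (fun k => q ^ k * cos (INR k * y)) m) in *.
  replace ((1 - q) * (P + -1 * S')) with ((1 - q) * P - (1 - q) * (D * S') / D) by (field; lra).
  rewrite G, C; unfold D in *; simpl pow; field.
  simpl in HD; lra.
Qed.

Definition damping (r : R) (m : nat) (y : R) : R :=
  psum (fun k => (1 - cos (INR k * y)) * (r ^ k / (1 + r ^ k) ^ 2)) m.

(** Factor by factor: |1 + z^k|^2 / (1 + r^k)^2 = 1 - 2 b <= e^(-2 b), where b is the k-th term of
    [damping]. *)
Lemma modulus_damping r m y : 0 < r < 1 ->
  modulus r m y <= modulus r m 0 * exp (- damping r m y).
Proof.
intros Hr; induction m as [|m IH]; unfold damping; cbn [psum modulus].
- rewrite Ropp_0, exp_0; lra.
- fold (damping r m y); set (k := S m).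
  assert (Hx := pow_01 r k Hr ltac:(unfold k; lia)).
  assert (M := modulus_pos r Hr m y).
  rewrite Ropp_plus_distr, exp_plus.
  assert (E0 : sqrt (sqmod r k 0) = 1 + r ^ k).
  { replace (sqmod r k 0) with ((1 + r ^ k) ^ 2)
      by (unfold sqmod; rewrite Rmult_0_r, cos_0; ring).
    apply sqrt_pow2; lra. }
  rewrite E0; set (e := exp (- damping r m y)) in *.
  replace (modulus r m 0 * (1 + r ^ k) * (e * _)) with
    ((modulus r m 0 * e) * ((1 + r ^ k) * exp (- ((1 - cos (INR k * y)) * (r ^ k / (1 + r ^ k) ^ 2))))) by ring.
  apply Rmult_le_compat; [lra|apply sqrt_pos|easy|].
  set (b := (1 - cos (INR k * y)) * (r ^ k / (1 + r ^ k) ^ 2)).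
  assert (0 < exp (- b)) by apply exp_pos.
  rewrite <- (sqrt_pow2 ((1 + r ^ k) * exp (- b))) by nra.
  apply sqrt_le_1_alt.
  replace (((1 + r ^ k) * exp (- b)) ^ 2) with ((1 + r ^ k) ^ 2 * exp (- (2 * b))).
  + replace (sqmod r k y) with ((1 + r ^ k) ^ 2 * (1 - 2 * b))
      by (unfold sqmod, b; field; lra).
    apply Rmult_le_compat_l; [nra|].
    generalize (exp_ineq1_le (- (2 * b))); lra.
  + replace (- (2 * b)) with (- b + - b) by ring; rewrite exp_plus; ring.
Qed.

Section MinorArc.

Variables (r d : R) (m : nat).
Hypothesis (Hr : 0 < r < 1) (Hrd : r = 1 - d) (Hm : (1 <= m)%nat).
Hypothesis (Htail : 4 * (INR m + 1) ^ 3 * r ^ S m <= / 1000000).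
Hypothesis (Hd : d <= 97 / 10000).

(** The tail condition forces r^(m+1) <= 1/4, and Bernoulli's inequality then bounds (m + 1) d from
    below. This absorbs the factor 2 / (1 - q) of [versin_sum]. *)
Let inv_d_le : / d <= 2 * (INR m + 1).
Proof.
assert (D : 0 < d) by lra.
assert (B : 1 - INR (S m) * d <= r ^ S m).
{ rewrite Hrd; generalize (S m) as k; induction k as [|k IH]; [simpl; lra|].
  rewrite S_INR; simpl pow; assert (0 <= INR k) by apply pos_INR; nra. }
rewrite S_INR in B; assert (M : 1 <= INR m) by now apply (le_INR 1).
apply Rmult_le_reg_l with d; [easy|]; rewrite Rinv_r by lra.
assert (r ^ S m <= / 4).
{ assert (1 <= (INR m + 1) ^ 3) by (rewrite <- (pow1 3); apply pow_incr; lra).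
  assert (0 < r ^ S m) by (apply pow_lt; lra). nra. }
nra.
Qed.

Let versin_sum_pow j y (q := r ^ j) : (1 <= j)%nat ->
  Rabs ((1 - q) * psum (fun k => q ^ k * (1 - cos (INR k * y))) m
    - q * (1 + q) * (1 - cos y) / ((1 - q) ^ 2 + 2 * q * (1 - cos y))) <= / 1000000.
Proof.
intros Hj; assert (Hq : 0 < q < 1) by now apply pow_01.
eapply Rle_trans; [now apply versin_sum|].
assert (T := tail_le r m Hr Hm Htail j Hj); fold q in T.
assert (X : 0 < q ^ S m) by (apply pow_lt; lra).
assert (M : 1 <= INR m) by now apply (le_INR 1).
assert (H : / (1 - q) <= / d).
{ apply Rinv_le_contravar; [lra|]; unfold q.
  destruct j as [|j]; [lia|]; simpl.
  assert (r ^ j <= 1) by (rewrite <- (pow1 j); apply pow_incr; lra). nra. }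
assert (1 + 2 / (1 - q) <= 4 * (INR m + 1) ^ 3); [|nra].
unfold Rdiv; generalize inv_d_le; intros; nra.
Qed.

(** The minorant of 1 / (1 + x)^2 from [variance_lower] reduces the sum to Poisson kernels at r,
    r^2, r^3, r^4. In the limit d = 0 the bound is W/(1+W) - W/(4+W) + (2/3) W/(9+W) - (3/16)
    W/(16+W); the constants are these, worsened to hold for all d <= 0.0097. *)
Lemma damping_lower y (W := 2 * (1 - cos y) / d ^ 2) :
  995 / 1000 * (W / (101 / 100 + W)) - 1005 / 1000 * (W / (396 / 100 + W))
  + 6569 / 10000 * (W / (927 / 100 + W)) - 1904 / 10000 * (W / (1553 / 100 + W)) - / 100000
  <= d * damping r m y.
Proof.
assert (D : 0 < d) by lra.
set (C := fun j => psum (fun k => (r ^ j) ^ k * (1 - cos (INR k * y))) m).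
assert (HQ : C 1%nat - 2 * C 2%nat + 2 * C 3%nat - 3 / 4 * C 4%nat <= damping r m y).
{ unfold C.
  replace (psum _ m - _ + _ - _) with (psum (fun k => (1 - cos (INR k * y)) *
    (1 * r ^ k + (- 2) * (r ^ k) ^ 2 + 2 * (r ^ k) ^ 3 + (- 3 / 4) * (r ^ k) ^ 4)) m).
  - apply psum_le; intros k Hk; apply Rmult_le_compat_l; [generalize (COS_bound (INR k * y)); lra|].
    assert (Hx := pow_01 r k Hr ltac:(lia)); set (x := r ^ k) in *.
    apply Rmult_le_reg_r with ((1 + x) ^ 2); [nra|].
    replace (x / (1 + x) ^ 2 * (1 + x) ^ 2) with x by (field; lra).
    assert (0 <= x ^ 3 * (1 - x) ^ 2 * (1 + 3 / 4 * x)) by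
      (repeat apply Rmult_le_pos; try apply pow_le; lra).
    nra.
  - unfold Rminus; rewrite !Ropp_mult_distr_l, <- !psum_scal, <- !psum_plus.
    apply psum_ext; intros k _; rewrite !(pow_mult_r r _ k); field. }
assert (HW : 1 - cos y = W * d ^ 2 / 2) by (unfold W; field; lra).
assert (W0 : 0 <= W) by (unfold W; apply Rdiv_le_0_compat; [generalize (COS_bound y); lra|nra]).
assert (B1 := versin_sum_pow 1 y ltac:(lia)); assert (B2 := versin_sum_pow 2 y ltac:(lia));
assert (B3 := versin_sum_pow 3 y ltac:(lia)); assert (B4 := versin_sum_pow 4 y ltac:(lia)).
fold (C 1%nat) in B1; fold (C 2%nat) in B2; fold (C 3%nat) in B3; fold (C 4%nat) in B4.
apply Rabs_le_between in B1; apply Rabs_le_between in B2;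
apply Rabs_le_between in B3; apply Rabs_le_between in B4.
rewrite HW in *; clearbody W.
assert (F : forall q g, 0 < q -> 0 < g -> 1 - q = d * g ->
  q * (1 + q) * (W * d ^ 2 / 2) / ((1 - q) ^ 2 + 2 * q * (W * d ^ 2 / 2))
  = q * (1 + q) / 2 * (W / (g ^ 2 + q * W))).
{ intros q g Hq Hg ->.
  replace ((d * g) ^ 2 + 2 * q * (W * d ^ 2 / 2)) with (d ^ 2 * (g ^ 2 + q * W)) by field.
  assert (0 < g ^ 2 + q * W) by nra.
  field; lra. }
assert (Up : forall q g A, 0 < q <= 1 -> 0 < g -> 0 < A -> A <= g ^ 2 ->
  0 <= q * (1 + q) / 2 * (W / (g ^ 2 + q * W)) <= W / (A + W)).
{ intros q g A Hq Hg HA HAg.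
  assert (0 < g ^ 2 + q * W) by nra.
  split; [apply Rmult_le_pos; [nra|apply Rdiv_le_0_compat; lra]|].
  apply Rle_trans with (q * (W / (g ^ 2 + q * W))).
  - apply Rmult_le_compat_r; [apply Rdiv_le_0_compat; lra|nra].
  - replace (q * (W / (g ^ 2 + q * W))) with (W / ((g ^ 2 + q * W) / q)) by (field; lra).
    apply Rmult_le_compat_l; [easy|]; apply Rinv_le_contravar; [lra|].
    apply (Rle_div_r (A + W)); nra. }
assert (Low : forall q g A c, 0 < q <= 1 -> 0 < g -> g ^ 2 <= A * q -> 0 <= c <= (1 + q) / 2 ->
  c * (W / (A + W)) <= q * (1 + q) / 2 * (W / (g ^ 2 + q * W))).
{ intros q g A c Hq Hg HAg Hc.
  assert (0 < g ^ 2 + q * W) by nra.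
  assert (0 < A) by nra.
  replace (q * (1 + q) / 2 * (W / (g ^ 2 + q * W))) with
    ((1 + q) / 2 * (W / (g ^ 2 / q + W))) by (field; nra).
  assert (g ^ 2 / q <= A) by (apply Rle_div_l; lra).
  assert (0 < g ^ 2 / q) by (apply Rdiv_lt_0_compat; nra).
  assert (0 <= W / (A + W)) by (apply Rdiv_le_0_compat; nra).
  apply Rmult_le_compat; [lra|easy|lra|].
  apply Rmult_le_compat_l; [easy|]; apply Rinv_le_contravar; lra. }
rewrite (F (r ^ 1) 1) in B1 by (rewrite ?pow_1; lra).
rewrite (F (r ^ 2) (2 - d)) in B2 by (try apply pow_lt; rewrite ?Hrd; try ring; lra).
rewrite (F (r ^ 3) (3 - 3 * d + d ^ 2)) in B3
  by (try apply pow_lt; rewrite ?Hrd; try ring; nra).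
rewrite (F (r ^ 4) (4 - 6 * d + 4 * d ^ 2 - d ^ 3)) in B4
  by (try apply pow_lt; rewrite ?Hrd; try ring; nra).
clear F HW.
assert (Q2 := pow_01 r 2 Hr ltac:(lia)); assert (Q3 := pow_01 r 3 Hr ltac:(lia));
assert (Q4 := pow_01 r 4 Hr ltac:(lia)).
assert (R3 : 1 - 3 * d <= r ^ 3) by (rewrite Hrd; nra).
assert (L1 := Low (r ^ 1) 1 (101 / 100) (995 / 1000)); rewrite pow_1 in L1.
assert (L1' := L1 ltac:(lra) ltac:(lra) ltac:(lra) ltac:(rewrite Hrd; nra)); clear L1.
assert (U2 := Up (r ^ 2) (2 - d) (396 / 100) ltac:(lra) ltac:(lra) ltac:(lra)
  ltac:(clear - D Hd; nra)).
assert (L3 := Low (r ^ 3) (3 - 3 * d + d ^ 2) (927 / 100) (9854 / 10000)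
  ltac:(lra) ltac:(nra) ltac:(clear - D Hd R3; nra) ltac:(lra)).
assert (U4 := Up (r ^ 4) (4 - 6 * d + 4 * d ^ 2 - d ^ 3) (1553 / 100)
  ltac:(lra) ltac:(clear - D Hd; nra) ltac:(lra) ltac:(clear - D Hd; nra)).
clear Up Low.
rewrite pow_1 in B1.
set (G1 := r * (1 + r) / 2 * _) in *. set (G2 := r ^ 2 * (1 + r ^ 2) / 2 * _) in *.
set (G3 := r ^ 3 * (1 + r ^ 3) / 2 * _) in *. set (G4 := r ^ 4 * (1 + r ^ 4) / 2 * _) in *.
assert (CP : forall j, 0 <= d * C j).
{ intros j; apply Rmult_le_pos; [lra|]; apply psum_ge0; intros k _.
  apply Rmult_le_pos; [apply pow_le, pow_le; lra|generalize (COS_bound (INR k * y)); lra]. }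
assert (P2 := CP 2%nat); assert (P3 := CP 3%nat); assert (P4 := CP 4%nat).
replace ((1 - r) * C 1%nat) with (d * C 1%nat) in B1 by (rewrite Hrd; ring).
replace ((1 - r ^ 2) * C 2%nat) with (d * C 2%nat * (2 - d)) in B2 by (rewrite Hrd; ring).
replace ((1 - r ^ 3) * C 3%nat) with (d * C 3%nat * (3 - 3 * d + d ^ 2)) in B3
  by (rewrite Hrd; ring).
replace ((1 - r ^ 4) * C 4%nat) with (d * C 4%nat * (4 - 6 * d + 4 * d ^ 2 - d ^ 3)) in B4
  by (rewrite Hrd; ring).
apply (Rmult_le_compat_l _ _ _ (Rlt_le _ _ D)) in HQ.
clearbody G1 G2 G3 G4.
set (X2 := d * C 2%nat) in *; set (X3 := d * C 3%nat) in *; set (X4 := d * C 4%nat) in *.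
assert (2 * X2 <= 1005 / 1000 * (G2 + / 1000000)).
{ assert (X2 * (2 - 97 / 10000) <= X2 * (2 - d)) by (apply Rmult_le_compat_l; lra). lra. }
assert (2 / 3 * (G3 - / 1000000) <= 2 * X3).
{ assert (X3 * (3 - 3 * d + d ^ 2) <= X3 * 3)
    by (apply Rmult_le_compat_l; [easy|clear - D Hd; nra]). lra. }
assert (3 / 4 * X4 <= 1904 / 10000 * (G4 + / 1000000)).
{ assert (X4 * (4 - 6 * (97 / 10000)) <= X4 * (4 - 6 * d + 4 * d ^ 2 - d ^ 3))
    by (apply Rmult_le_compat_l; [easy|clear - D Hd; nra]). lra. }
unfold X2, X3, X4 in *; lra.
Qed.

Let f_lower W f (a1 := 995 / 1000) (a2 := 1005 / 1000) (a3 := 6569 / 10000)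
  (a4 := 1904 / 10000) (A1 := 101 / 100) (A2 := 396 / 100) (A3 := 927 / 100) (A4 := 1553 / 100) : 0 <= W ->
  0 <= a1 * W * (A2 + W) * (A3 + W) * (A4 + W) - a2 * W * (A1 + W) * (A3 + W) * (A4 + W)
     + a3 * W * (A1 + W) * (A2 + W) * (A4 + W) - a4 * W * (A1 + W) * (A2 + W) * (A3 + W)
     - (/ 100000 + f) * (A1 + W) * (A2 + W) * (A3 + W) * (A4 + W) ->
  f <= a1 * (W / (A1 + W)) - a2 * (W / (A2 + W)) + a3 * (W / (A3 + W)) - a4 * (W / (A4 + W))
     - / 100000.
Proof.
intros HW H.
match type of H with 0 <= ?N =>
  assert (E : a1 * (W / (A1 + W)) - a2 * (W / (A2 + W)) + a3 * (W / (A3 + W))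
    - a4 * (W / (A4 + W)) - / 100000 - f = N / ((A1 + W) * (A2 + W) * (A3 + W) * (A4 + W))) end.
{ unfold A1, A2, A3, A4; field; lra. }
assert (0 <= a1 * (W / (A1 + W)) - a2 * (W / (A2 + W)) + a3 * (W / (A3 + W))
    - a4 * (W / (A4 + W)) - / 100000 - f); [|lra].
rewrite E; apply Rdiv_le_0_compat; [exact H|].
unfold A1, A2, A3, A4; repeat apply Rmult_lt_0_compat; lra.
Qed.

(** Each f lies slightly below the bound of [damping_lower] at W = 0.9999 c^2. That bound tends to
    about 0.456 for large W, so nothing much is gained beyond c = 2. *)
Lemma modulus_minor c f y :
  (c = 4 / 10 /\ f = 1055 / 10000) \/ (c = 5 / 10 /\ f = 1515 / 10000)
  \/ (c = 65 / 100 /\ f = 219 / 1000) \/ (c = 9 / 10 /\ f = 313 / 1000)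
  \/ (c = 2 /\ f = 44 / 100) ->
  c * d <= y <= PI -> modulus r m y <= modulus r m 0 * exp (- (f / d)).
Proof.
intros Hcf Hy; assert (D : 0 < d) by lra.
assert (Hc : 4 / 10 <= c <= 2) by lra.
eapply Rle_trans; [now apply modulus_damping|].
apply Rmult_le_compat_l; [left; now apply modulus_pos|].
set (W := 2 * (1 - cos y) / d ^ 2).
assert (HW : 9999 / 10000 * c ^ 2 <= W).
{ assert (0 <= c * d) by nra.
  assert (cos y <= cos (c * d)) by (apply cos_decr_1; lra).
  assert (L := one_minus_cos_lower (c * d) ltac:(easy)).
  unfold W; apply (Rle_div_r (9999 / 10000 * c ^ 2)); [apply pow_lt; lra|].
  assert (0 <= d ^ 2 <= 95 / 1000000) by nra.
  assert (0 <= c ^ 2 <= 4) by nra.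
  assert ((c * d) ^ 4 <= (c ^ 2 * d ^ 2) * (4 * (95 / 1000000))).
  { replace ((c * d) ^ 4) with ((c ^ 2 * d ^ 2) * (c ^ 2 * d ^ 2)) by ring.
    apply Rmult_le_compat_l; [nra|]; apply Rmult_le_compat; lra. }
  nra. }
assert (K := damping_lower y); cbv zeta in K; fold W in K.
assert (Hf : f <= d * damping r m y).
{ eapply Rle_trans; [|exact K]; clear K; clearbody W.
  apply f_lower; [nra|].
  (* Expanding around the left end of the range leaves a quartic in t >= 0, whose nonnegativity is
     linear in the powers of t. *)
  set (t := W - 9999 / 10000 * c ^ 2) in *.
  assert (T : 0 <= t) by (unfold t; lra).
  replace W with (t + 9999 / 10000 * c ^ 2) by (unfold t; ring); clearbody t.
  assert (0 <= t ^ 2) by (apply pow_le; lra).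
  assert (0 <= t ^ 3) by (apply pow_le; lra).
  assert (0 <= t ^ 4) by (apply pow_le; lra).
  destruct Hcf as [[-> ->]|[[-> ->]|[[-> ->]|[[-> ->]|[-> ->]]]]]; lra. }
destruct (Rle_lt_or_eq_dec (f / d) (damping r m y)) as [L|L].
- apply (Rle_div_l f); lra.
- left; apply exp_increasing; lra.
- right; f_equal; lra.
Qed.

End MinorArc.

(** * Moments *)

Definition cont (f : R -> R) : Prop := forall x, continuous f x.

Lemma cont_ex_RInt f a b : cont f -> ex_RInt f a b.
Proof. intros H; apply (ex_RInt_continuous (V := R_CompleteNormedModule)); intros; apply H. Qed.

Lemma cont_plus f g : cont f -> cont g -> cont (fun y => f y + g y).
Proof. intros Hf Hg x; now apply (continuous_plus (V := R_NormedModule)). Qed.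

Lemma cont_mult f g : cont f -> cont g -> cont (fun y => f y * g y).
Proof. intros Hf Hg x; now apply (continuous_mult (K := R_AbsRing)). Qed.

Lemma cont_const c : cont (fun _ => c).
Proof. intros x; apply continuous_const. Qed.

Lemma cont_derive (f f' : R -> R) : (forall x, is_derive f x (f' x)) -> cont f.
Proof. intros H x; apply (ex_derive_continuous f); now exists (f' x). Qed.

Lemma cont_pow k : cont (fun y => y ^ k).
Proof. apply cont_derive with (fun y => INR k * y ^ pred k); intros; auto_derive; [easy|ring]. Qed.

Lemma cont_cos : cont cos.
Proof. intros x; apply continuous_cos. Qed.

Lemma cont_sin : cont sin.
Proof. intros x; apply continuous_sin. Qed.

Create HintDb cont.
#[local] Hint Resolve cont_plus cont_mult cont_const cont_pow cont_cos cont_sin : cont.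

Lemma RInt_add f g a b : cont f -> cont g ->
  RInt (fun y => f y + g y) a b = RInt f a b + RInt g a b.
Proof. intros; apply (RInt_plus (V := R_CompleteNormedModule)); now apply cont_ex_RInt. Qed.

Lemma RInt_cmul c f a b : cont f -> RInt (fun y => c * f y) a b = c * RInt f a b.
Proof. intros; apply (RInt_scal (V := R_CompleteNormedModule)); now apply cont_ex_RInt. Qed.

Lemma RInt_mono f g a b : a <= b -> cont f -> cont g ->
  (forall x, a <= x <= b -> f x <= g x) -> RInt f a b <= RInt g a b.
Proof.
intros Hab Hf Hg H; apply RInt_le; [easy|now apply cont_ex_RInt|now apply cont_ex_RInt|].
intros; apply H; lra.
Qed.

Lemma RInt_nonneg f a b : a <= b -> cont f ->
  (forall x, a <= x <= b -> 0 <= f x) -> 0 <= RInt f a b.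
Proof.
intros Hab Hf H; apply RInt_ge_0; [easy|now apply cont_ex_RInt|intros; apply H; lra].
Qed.

Lemma RInt_split f a b c : cont f -> RInt f a c = RInt f a b + RInt f b c.
Proof.
intros H; symmetry; apply (RInt_Chasles (V := R_CompleteNormedModule)); now apply cont_ex_RInt.
Qed.

Lemma RInt_le_const f a b M : a <= b -> cont f -> (forall x, a <= x <= b -> f x <= M) ->
  RInt f a b <= (b - a) * M.
Proof.
intros Hab Hf H; apply Rle_trans with (RInt (fun _ => M) a b).
- apply RInt_mono; auto with cont.
- rewrite RInt_const; unfold scal; simpl; unfold mult; simpl; lra.
Qed.

(** Only [h] has to be integrable. This allows integration by parts with a logarithmic derivative
    known only through pointwise bounds. *)
Lemma derive_le_RInt (F f h : R -> R) a b : a <= b -> cont h ->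
  (forall x, a <= x <= b -> is_derive F x (f x)) ->
  (forall x, a <= x <= b -> f x <= h x) -> F b - F a <= RInt h a b.
Proof.
intros Hab Hh HF Hf.
assert (H := derive_nonneg_le (fun y => RInt h a y - F y) (fun y => h y - f y) a b Hab).
cbv beta in H; rewrite RInt_point in H; unfold zero in H; simpl in H.
assert (0 - F a <= RInt h a b - F b); [apply H|lra].
- intros x Hx; apply (is_derive_minus (V := R_NormedModule)); [|now apply HF].
  apply (is_derive_RInt (V := R_NormedModule) h _ a); [|apply Hh].
  apply filter_forall; intros; apply (RInt_correct (V := R_CompleteNormedModule)), cont_ex_RInt, Hh.
- intros x Hx; generalize (Hf x Hx); lra.
Qed.

(* From [e^v >= 2.718 v] at [v = f / (p d)]. *)
Lemma exp_neg_le_pow f d A p : 0 < f -> 0 < d -> 0 < A -> (0 < p)%nat ->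
  INR p <= 2718 / 1000 * f * A -> exp (- (f / d)) <= (A * d) ^ p.
Proof.
intros Hf Hd HA Hp H.
assert (P : 0 < INR p) by now apply (lt_INR 0).
set (v := f / (INR p * d)).
assert (Hv : 0 < v) by (apply Rdiv_lt_0_compat; nra).
assert (E : exp (- (f / d)) = exp (- v) ^ p).
{ replace (- (f / d)) with (INR p * - v) by (unfold v; field; lra).
  generalize v; clear; intros v; induction p as [|p IH]; [simpl; now rewrite Rmult_0_l, exp_0|].
  rewrite S_INR, Rmult_plus_distr_r, Rmult_1_l, exp_plus, IH; simpl; ring. }
rewrite E; apply pow_incr; split; [left; apply exp_pos|].
assert (L := exp_ge_linear v ltac:(lra)).
rewrite exp_Ropp; replace (A * d) with (/ (/ (A * d))) by (field; nra).
apply Rinv_le_contravar; [apply Rinv_0_lt_compat; nra|].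
eapply Rle_trans; [|exact L].
unfold v; replace (2718 / 1000 * (f / (INR p * d))) with (2718 / 1000 * f / INR p * / d) by (field; lra).
replace (/ (A * d)) with (/ A * / d) by (field; lra).
apply Rmult_le_compat_r; [left; now apply Rinv_0_lt_compat|].
apply (Rle_div_r (/ A)); [easy|].
apply Rmult_le_reg_l with A; [easy|]; rewrite <- Rmult_assoc, Rinv_r by lra; lra.
Qed.

(** T may be negative, so replacing the weight w by b is not monotone; the cost is charged to the
    modulus m. *)
Lemma perturbed_weight w b e T m : - m <= T <= m -> b - e <= w <= b ->
  b * T - e * m <= w * T <= b * T + e * m.
Proof.
intros HT Hw; replace (w * T) with (b * T - (b - w) * T) by ring.
assert (- (e * m) <= (b - w) * T <= e * m); [|lra].
assert ((b - w) * m <= e * m) by (apply Rmult_le_compat_r; lra).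
split; nra.
Qed.

(** * Integration by parts on the main arc *)

Section Moments.

Variables (mo ph p ph' : R -> R) (d V : R).

Hypothesis mo_pos : forall y, 0 < mo y.
Hypothesis mo_derive : forall y, is_derive mo y (- p y * mo y).
Hypothesis ph_derive : forall y, is_derive ph y (ph' y).
Hypothesis Hd : 0 < d <= 97 / 10000.
Hypothesis HV : 1588 / 1000 <= d ^ 3 * V <= 2.
Hypothesis p_upper : forall y, 0 <= y <= 4 / 10 * d -> p y <= V * y + y ^ 3 / d ^ 5.
Hypothesis p_lower : forall y, 0 <= y <= 4 / 10 * d -> V * y - 4 * y ^ 3 / d ^ 5 <= p y.
Hypothesis ph'_bounds : forall y, 0 <= y <= 4 / 10 * d -> 0 <= ph' y <= 559 / 200 * (y ^ 2 / d ^ 4).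
Hypothesis ph_bounds : forall y, 0 <= y <= 4 / 10 * d -> 0 <= ph y <= 559 / 600 * (y ^ 3 / d ^ 4).

Let T y := mo y * cos (ph y).
Let U y := mo y * sin (ph y).
Let y1 := 4 / 10 * d.
Let M k : R := RInt (fun y => y ^ k * mo y) 0 y1.
Let t k : R := RInt (fun y => y ^ k * T y) 0 y1.

Let cont_mo : cont mo.
Proof. exact (cont_derive _ _ mo_derive). Qed.

Let T_derive y : is_derive T y (- p y * T y - ph' y * U y).
Proof.
unfold T, U; evar_last.
- apply (is_derive_mult mo (fun y => cos (ph y)) y); [apply mo_derive| |apply Rmult_comm].
  apply (is_derive_comp cos ph); [apply is_derive_cos|apply ph_derive].
- unfold plus, mult, scal; simpl; unfold mult; simpl; ring.
Qed.

Let cont_T : cont T.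
Proof. exact (cont_derive _ _ T_derive). Qed.

Hint Resolve cont_mo cont_T : cont.

Let pow_mul_derive (f f' : R -> R) k y : is_derive f y (f' y) ->
  is_derive (fun y => y ^ S k * f y) y (INR (S k) * y ^ k * f y + y ^ S k * f' y).
Proof.
intros H; evar_last.
- apply (is_derive_mult (fun y => y ^ S k) f y); [|exact H|apply Rmult_comm].
  apply (is_derive_pow (fun y => y)), (is_derive_id (K := R_AbsRing)).
- unfold plus, mult, one; simpl pred; simpl; ring.
Qed.

Let M_nonneg k : 0 <= M k.
Proof.
apply RInt_nonneg; [unfold y1; lra|auto with cont|].
intros y Hy; apply Rmult_le_pos; [apply pow_le; lra|left; apply mo_pos].
Qed.

(** Integrate the derivative of y^(k+1) |F| and drop the nonnegative boundary term. Without the last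
    term this is the Gaussian moment recurrence. *)
Let M_rec k : V * M (S (S k)) <= INR (S k) * M k + 4 / d ^ 5 * M (S (S (S (S k)))).
Proof.
assert (H := derive_le_RInt (fun y => y ^ S k * mo y)
  (fun y => INR (S k) * y ^ k * mo y + y ^ S k * (- p y * mo y))
  (fun y => INR (S k) * (y ^ k * mo y) + ((- V) * (y ^ S (S k) * mo y)
    + 4 / d ^ 5 * (y ^ S (S (S (S k))) * mo y))) 0 y1 ltac:(unfold y1; lra)).
rewrite !RInt_add, !RInt_cmul in H by auto 10 with cont.
fold (M k) (M (S (S k))) (M (S (S (S (S k))))) in H.
assert (P : 0 <= y1 ^ S k * mo y1).
{ apply Rmult_le_pos; [apply pow_le; unfold y1; lra|left; apply mo_pos]. }
assert (y1 ^ S k * mo y1 - 0 ^ S k * mo 0 <= INR (S k) * M k +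
  (- V * M (S (S k)) + 4 / d ^ 5 * M (S (S (S (S k)))))).
- apply H; [auto 10 with cont| |].
  + intros y _; now apply (pow_mul_derive mo (fun y => - p y * mo y)).
  + intros y Hy; assert (L := p_lower y Hy).
    assert (0 <= y ^ S k * mo y) by (apply Rmult_le_pos; [apply pow_le; lra|left; apply mo_pos]).
    apply (Rmult_le_compat_r (y ^ S k * mo y)) in L; [|easy].
    replace (y ^ S (S k)) with (y * y ^ S k) by (simpl; ring).
    replace (y ^ S (S (S (S k)))) with (y ^ 3 * y ^ S k) by (simpl; ring).
    unfold Rdiv in *; lra.
- rewrite (pow_i (S k)) in H0 by lia; lra.
Qed.

Let y1_pos : 0 <= y1. Proof. unfold y1; lra. Qed.

Let phase_sq y : 0 <= y <= y1 -> ph y ^ 2 <= (559 / 600) ^ 2 / d ^ 8 * y ^ 6.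
Proof.
intros Hy; assert (B := ph_bounds y Hy).
replace ((559 / 600) ^ 2 / d ^ 8 * y ^ 6) with ((559 / 600 * (y ^ 3 / d ^ 4)) ^ 2) by (field; lra).
apply pow_incr; lra.
Qed.

(** Here 312481 = 559^2; this constant returns in all errors quadratic in the phase. *)
Let phase_prod y : 0 <= y <= y1 -> 0 <= ph' y * ph y <= 312481 / 120000 / d ^ 8 * y ^ 5.
Proof.
intros Hy; assert (B := ph_bounds y Hy); assert (B' := ph'_bounds y Hy); split; [nra|].
replace (312481 / 120000 / d ^ 8 * y ^ 5) with
  (559 / 200 * (y ^ 2 / d ^ 4) * (559 / 600 * (y ^ 3 / d ^ 4))) by (field; lra).
apply Rmult_le_compat; lra.
Qed.

Let T_abs y : - mo y <= T y <= mo y.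
Proof. unfold T; generalize (COS_bound (ph y)) (mo_pos y); nra. Qed.

Let T_lower y : 0 <= y <= y1 -> mo y - (559 / 600) ^ 2 / d ^ 8 / 2 * (y ^ 6 * mo y) <= T y.
Proof.
intros Hy; assert (S := phase_sq y Hy); assert (B := ph_bounds y Hy).
assert (C := one_minus_cos_bounds (ph y) ltac:(lra)).
assert (P := mo_pos y); unfold T.
assert (mo y * (1 - cos (ph y)) <= mo y * ((559 / 600) ^ 2 / d ^ 8 * y ^ 6 / 2))
  by (apply Rmult_le_compat_l; lra).
lra.
Qed.

(** Limits how negative T can be. For x <= 2.8 it follows from 2 (1 - x^2/8)^2 - 1 + 0.15 x^2 = (x^2
    - 5.6)^2 / 32 + 0.02. *)
Let cos_ge x : 0 <= x -> - (15 / 100) * x ^ 2 <= cos x.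
Proof.
intros Hx; destruct (Rle_lt_dec x (28 / 10)) as [H|H].
- replace (cos x) with (2 * cos (x / 2) ^ 2 - 1).
  + assert (L := one_minus_cos_bounds (x / 2) ltac:(lra)).
    assert ((1 - (x / 2) ^ 2 / 2) ^ 2 <= cos (x / 2) ^ 2) by (apply pow_incr; nra).
    assert (0 <= (x ^ 2 - 56 / 10) ^ 2) by apply pow2_ge_0. lra.
  + replace (cos x) with (cos (2 * (x / 2))) by (f_equal; field).
    rewrite cos_2a_cos; ring.
- generalize (COS_bound x); nra.
Qed.

Let sin_ge x : 0 <= x -> - (x / 3) <= sin x.
Proof.
intros Hx; destruct (Rle_lt_dec x 3) as [H|H].
- generalize (sin_ge_0 x Hx) PI2_3_2; lra.
- generalize (SIN_bound x); lra.
Qed.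

(* Integration by parts against [T' = - p T - ph' U], first with [y T], then with [y^3 T]. *)
Let t2_upper : V * t 2%nat <= t 0%nat + 4 / d ^ 5 * M 4%nat
  + 312481 / 360000 / d ^ 8 * M 6%nat + y1 * mo y1.
Proof.
assert (H := derive_le_RInt (fun y => y ^ 1 * T y)
  (fun y => INR 1 * y ^ 0 * T y + y ^ 1 * (- p y * T y - ph' y * U y))
  (fun y => y ^ 0 * T y + ((- V) * (y ^ 2 * T y) + (4 / d ^ 5 * (y ^ 4 * mo y)
     + 312481 / 360000 / d ^ 8 * (y ^ 6 * mo y)))) 0 y1 y1_pos).
rewrite !RInt_add, !RInt_cmul in H by auto 10 with cont.
fold (t 0%nat) (t 2%nat) (M 4%nat) (M 6%nat) in H.
assert (y1 ^ 1 * T y1 - 0 ^ 1 * T 0 <= t 0%nat + ((- V) * t 2%nat + (4 / d ^ 5 * M 4%nat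
  + 312481 / 360000 / d ^ 8 * M 6%nat))).
- apply H; [auto 10 with cont|intros; now apply (pow_mul_derive T (fun y => - p y * T y - ph' y * U y))|].
  intros y Hy; assert (PU := p_upper y Hy); assert (PL := p_lower y Hy).
  assert (TA := T_abs y); assert (B := ph_bounds y Hy); assert (B' := ph'_bounds y Hy).
  assert (PP := phase_prod y Hy).
  assert (X : y * p y * T y >= V * y ^ 2 * T y - 4 / d ^ 5 * (y ^ 4 * mo y)).
  { assert (D5 : 0 < / d ^ 5) by (apply Rinv_0_lt_compat, pow_lt; lra).
    set (e := / d ^ 5) in *; unfold Rdiv in PU, PL |- *; fold e in PU, PL |- *.
    assert (0 <= y ^ 3) by (apply pow_le; lra).
    assert (0 <= y ^ 3 * e) by nra.
    (* The lower bound for p is used where T >= 0 and the upper bound where T < 0; the larger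
       constant 4 covers both. *)
    assert ((p y - V * y) * T y >= - (4 * (y ^ 3 * e)) * mo y).
    { destruct (Rle_lt_dec 0 (T y)); nra. }
    replace (V * y ^ 2 * T y) with (y * (V * y * T y)) by ring.
    replace (4 * e * (y ^ 4 * mo y)) with (y * (4 * (y ^ 3 * e) * mo y)) by ring.
    nra. }
  assert (Y : - (y * (ph' y * U y)) <= 312481 / 360000 / d ^ 8 * (y ^ 6 * mo y)).
  { assert (S := sin_ge (ph y) ltac:(lra)); unfold U.
    assert (Z : 0 <= y * mo y) by (generalize (mo_pos y); nra).
    assert (- (ph' y * sin (ph y)) <= 312481 / 120000 / d ^ 8 * y ^ 5 / 3) by nra.
    replace (312481 / 360000 / d ^ 8 * (y ^ 6 * mo y)) with
      ((y * mo y) * (312481 / 120000 / d ^ 8 * y ^ 5 / 3)) by (field; lra).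
    replace (- (y * (ph' y * (mo y * sin (ph y))))) with
      ((y * mo y) * (- (ph' y * sin (ph y)))) by ring.
    apply Rmult_le_compat_l; lra. }
  simpl INR; rewrite !pow_1; simpl (y ^ 0); lra.
- rewrite !pow_1 in H0; generalize (T_abs y1); intros; nra.
Qed.

Let t4_lower : 3 * t 2%nat <= V * t 4%nat + / d ^ 5 * M 6%nat
  + 312481 / 600000 / d ^ 13 * M 12%nat + 312481 / 120000 / d ^ 8 * M 8%nat + y1 ^ 3 * mo y1.
Proof.
assert (H := derive_le_RInt (fun y => y ^ 3 * (- 1 * T y))
  (fun y => INR 3 * y ^ 2 * (- 1 * T y) + y ^ 3 * (- 1 * (- p y * T y - ph' y * U y)))
  (fun y => (- 3) * (y ^ 2 * T y) + (V * (y ^ 4 * T y) + (/ d ^ 5 * (y ^ 6 * mo y)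
     + (312481 / 600000 / d ^ 13 * (y ^ 12 * mo y) + 312481 / 120000 / d ^ 8 * (y ^ 8 * mo y)))))
  0 y1 y1_pos).
rewrite !RInt_add, !RInt_cmul in H by auto 10 with cont.
fold (t 2%nat) (t 4%nat) (M 6%nat) (M 12%nat) (M 8%nat) in H.
assert (y1 ^ 3 * (- 1 * T y1) - 0 ^ 3 * (- 1 * T 0) <= (- 3) * t 2%nat + (V * t 4%nat + (/ d ^ 5 * M 6%nat
  + (312481 / 600000 / d ^ 13 * M 12%nat + 312481 / 120000 / d ^ 8 * M 8%nat)))).
- apply H; [auto 10 with cont| |].
  + intros y _; apply (pow_mul_derive (fun y => - 1 * T y) (fun y => - 1 * (- p y * T y - ph' y * U y))).
    apply (is_derive_scal T), T_derive.
  + intros y Hy; assert (PU := p_upper y Hy); assert (PL := p_lower y Hy).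
    assert (TA := T_abs y); assert (B := ph_bounds y Hy); assert (B' := ph'_bounds y Hy).
    assert (PP := phase_prod y Hy); assert (SQ := phase_sq y Hy); assert (P := mo_pos y).
    assert (Y3 : 0 <= y ^ 3) by (apply pow_le; lra).
    assert (X : p y * T y <= V * y * T y + y ^ 3 / d ^ 5 * mo y
      + 312481 / 600000 / d ^ 13 * (y ^ 9 * mo y)).
    { assert (D5 : 0 < / d ^ 5) by (apply Rinv_0_lt_compat, pow_lt; lra).
      assert (C := cos_ge (ph y) ltac:(lra)).
      assert (TL : - T y <= 15 / 100 * ((559 / 600) ^ 2 / d ^ 8 * y ^ 6) * mo y).
      { unfold T; nra. }
      replace (312481 / 600000 / d ^ 13 * (y ^ 9 * mo y)) with
        (4 * (y ^ 3 / d ^ 5) * (15 / 100 * ((559 / 600) ^ 2 / d ^ 8 * y ^ 6) * mo y)) by (field; lra).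
      assert (0 <= (559 / 600) ^ 2 / d ^ 8 * y ^ 6) by nra.
      set (w := 15 / 100 * ((559 / 600) ^ 2 / d ^ 8 * y ^ 6) * mo y) in *.
      assert (W0 : 0 <= w) by (unfold w; nra).
      replace (4 * y ^ 3 / d ^ 5) with (4 * (y ^ 3 / d ^ 5)) in PL by (field; lra).
      assert (Z : 0 <= y ^ 3 / d ^ 5) by (unfold Rdiv; nra).
      set (z := y ^ 3 / d ^ 5) in *; clearbody w z.
      (* Where T >= 0 the better constant 1 of [p_upper] applies. Where T < 0 the constant 4 is
         needed, but -T is quadratic in the phase there, so it only multiplies a term in y^9. *)
      destruct (Rle_lt_dec 0 (T y)) as [TT|TT].
      - assert (p y * T y <= (V * y + z) * T y) by nra. nra.
      - assert (p y * T y <= (V * y - 4 * z) * T y) by nra.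
        assert (4 * z * - T y <= 4 * z * w) by (apply Rmult_le_compat_l; lra). nra. }
    assert (Y : ph' y * U y <= 312481 / 120000 / d ^ 8 * (y ^ 5 * mo y)).
    { assert (S := sin_abs_le (ph y) ltac:(lra)); unfold U.
      assert (ph' y * sin (ph y) <= 312481 / 120000 / d ^ 8 * y ^ 5) by nra.
      nra. }
    apply (Rmult_le_compat_l _ _ _ Y3) in X; apply (Rmult_le_compat_l _ _ _ Y3) in Y.
    replace (INR 3) with 3 by (simpl; ring). unfold Rdiv in *; lra.
- generalize (T_abs y1); intros.
  assert (0 <= y1 ^ 3) by (apply pow_le, y1_pos).
  rewrite (pow_i 3) in H0 by lia; nra.
Qed.

Let t2_lower : M 2%nat - (559 / 600) ^ 2 / d ^ 8 / 2 * M 8%nat <= t 2%nat.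
Proof.
unfold M; rewrite <- RInt_cmul by auto with cont.
assert (RInt (fun y => y ^ 2 * mo y) 0 y1 <= RInt (fun y => y ^ 2 * T y +
  (559 / 600) ^ 2 / d ^ 8 / 2 * (y ^ 8 * mo y)) 0 y1).
- apply RInt_mono; [apply y1_pos|auto with cont|auto with cont|].
  intros y Hy; assert (L := T_lower y Hy).
  apply (Rmult_le_compat_l (y ^ 2)) in L; [|nra]. lra.
- rewrite RInt_add in H by auto with cont; fold (t 2%nat) in H; lra.
Qed.

Let M0_upper : M 0%nat <= V * M 2%nat + / d ^ 5 * M 4%nat + y1 * mo y1.
Proof.
assert (H := derive_le_RInt (fun y => y ^ 1 * (- 1 * mo y))
  (fun y => INR 1 * y ^ 0 * (- 1 * mo y) + y ^ 1 * (- 1 * (- p y * mo y)))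
  (fun y => (- 1) * (y ^ 0 * mo y) + (V * (y ^ 2 * mo y) + / d ^ 5 * (y ^ 4 * mo y))) 0 y1 y1_pos).
rewrite !RInt_add, !RInt_cmul in H by auto 10 with cont.
fold (M 0%nat) (M 2%nat) (M 4%nat) in H.
assert (y1 ^ 1 * (- 1 * mo y1) - 0 ^ 1 * (- 1 * mo 0) <= (- 1) * M 0%nat + (V * M 2%nat + / d ^ 5 * M 4%nat)).
- apply H; [auto 10 with cont| |].
  + intros y _; apply (pow_mul_derive (fun y => - 1 * mo y) (fun y => - 1 * (- p y * mo y))).
    apply (is_derive_scal mo), mo_derive.
  + intros y Hy; assert (PU := p_upper y Hy); assert (P := mo_pos y).
    assert (0 <= y * mo y) by nra.
    apply (Rmult_le_compat_r (y * mo y)) in PU; [|easy].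
    simpl INR; simpl (y ^ 0); rewrite !pow_1; unfold Rdiv in *; lra.
- rewrite !pow_1 in H0; lra.
Qed.

Hypothesis p_nonneg : forall y, 0 <= y <= 4 / 10 * d -> 0 <= p y.

(** Since [mo] decreases on the arc, mo' >= - (V y + y^3 / d^5) mo(0), and this is integrated. *)
Let mo_lower y : 0 <= y <= y1 -> mo 0 * (1 - V * y ^ 2 / 2 - y ^ 4 / (4 * d ^ 5)) <= mo y.
Proof.
intros Hy.
assert (Dec : forall z, 0 <= z <= y1 -> mo z <= mo 0).
{ intros z Hz.
  assert (H := derive_nonneg_le (fun y => - 1 * mo y) (fun y => - 1 * (- p y * mo y)) 0 z ltac:(lra)).
  cbv beta in H; assert (- 1 * mo 0 <= - 1 * mo z); [apply H|lra].
  - intros; apply (is_derive_scal mo), mo_derive.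
  - intros x Hx; assert (P := p_nonneg x ltac:(unfold y1 in *; lra)); generalize (mo_pos x); nra. }
assert (H := derive_nonneg_le (fun y => mo y + mo 0 * (V * y ^ 2 / 2 + y ^ 4 / (4 * d ^ 5)))
  (fun y => - p y * mo y + mo 0 * (V * y + y ^ 3 / d ^ 5)) 0 y ltac:(lra)).
cbv beta in H.
assert (mo 0 + mo 0 * (V * 0 ^ 2 / 2 + 0 ^ 4 / (4 * d ^ 5))
  <= mo y + mo 0 * (V * y ^ 2 / 2 + y ^ 4 / (4 * d ^ 5))).
- apply H.
  + intros x _; apply (is_derive_plus (V := R_NormedModule)); [apply mo_derive|].
    auto_derive; [simpl; lra|field; lra].
  + intros x Hx; assert (Hx' : 0 <= x <= 4 / 10 * d) by (unfold y1 in *; lra).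
    assert (PU := p_upper x Hx'); assert (P0 := p_nonneg x Hx').
    assert (D := Dec x Hx'); assert (P := mo_pos x); nra.
- replace (0 ^ 2) with 0 in H0 by ring; replace (0 ^ 4) with 0 in H0 by ring.
  unfold Rdiv in *; lra.
Qed.

(* The window [d * sqrt d] is comparable to the width of the Gaussian peak. *)
Let M0_lower s : 0 < s -> s ^ 2 = d -> 666 / 1000 * (d * s) * mo 0 <= M 0%nat.
Proof.
intros Hs Es.
assert (Hs1 : s <= 1 / 10) by nra.
assert (Hh : 0 <= d * s <= y1) by (unfold y1; nra).
unfold M; rewrite (RInt_split _ 0 (d * s)) by auto with cont.
assert (P : 0 <= RInt (fun y => y ^ 0 * mo y) (d * s) y1).
{ apply RInt_nonneg; [lra|auto with cont|]; intros y _; simpl; generalize (mo_pos y); lra. }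
assert (H := derive_le_RInt (fun y => mo 0 * (y - V * y ^ 3 / 6 - y ^ 5 / (20 * d ^ 5)))
  (fun y => mo 0 * (1 - V * y ^ 2 / 2 - y ^ 4 / (4 * d ^ 5)))
  (fun y => y ^ 0 * mo y) 0 (d * s) ltac:(lra)).
cbv beta in H.
assert (Z : mo 0 * (d * s - V * (d * s) ^ 3 / 6 - (d * s) ^ 5 / (20 * d ^ 5))
  - mo 0 * (0 - V * 0 ^ 3 / 6 - 0 ^ 5 / (20 * d ^ 5)) <= RInt (fun y => y ^ 0 * mo y) 0 (d * s)).
- apply H; [auto with cont| |].
  + intros x _; auto_derive; [simpl; lra|field; lra].
  + intros x Hx; simpl (x ^ 0); rewrite Rmult_1_l; apply mo_lower; lra.
- replace (mo 0 * (0 - V * 0 ^ 3 / 6 - 0 ^ 5 / (20 * d ^ 5))) with 0 in Z by (field; lra).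
  replace ((d * s) ^ 5 / (20 * d ^ 5)) with (s * d ^ 2 / 20) in Z
    by (rewrite <- Es at 1; field; lra).
  replace (V * (d * s) ^ 3 / 6) with (d ^ 3 * V * (d * s) / 6) in Z.
  + assert (X : d ^ 3 * V * (d * s) / 6 <= 2 * (d * s) / 6) by nra.
    assert (Y : s * d ^ 2 / 20 <= 97 / 200000 * (d * s)) by nra.
    assert (MP := mo_pos 0).
    (* Here 1 - 2/6 - 97/200000 > 0.666. *)
    assert (666 / 1000 * (d * s) <= d * s - d ^ 3 * V * (d * s) / 6 - s * d ^ 2 / 20) by nra.
    nra.
  + replace ((d * s) ^ 3) with (d ^ 3 * s * s ^ 2) by ring; rewrite Es; field.
Qed.

(* Used downwards from the crude bound [M 16 <= y1^2 M 14]. *)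
Let M_chain k rho' rho : M (S (S (S (S k)))) <= rho' * d ^ 3 * M (S (S k)) ->
  0 <= rho' -> INR (S k) <= (1588 / 1000 - 388 / 10000 * rho') * rho ->
  0 < 1588 / 1000 - 388 / 10000 * rho' -> M (S (S k)) <= rho * d ^ 3 * M k.
Proof.
intros H Hr Hrho Hpos; assert (R := M_rec k).
assert (D3 : 0 < d ^ 3) by (apply pow_lt; lra).
assert (E : d ^ 3 * (4 / d ^ 5 * M (S (S (S (S k))))) <= 388 / 10000 * rho' * M (S (S k))).
{ apply Rle_trans with (d ^ 3 * (4 / d ^ 5 * (rho' * d ^ 3 * M (S (S k))))).
  - apply Rmult_le_compat_l; [lra|]; apply Rmult_le_compat_l; [|easy].
    apply Rdiv_le_0_compat; [lra|apply pow_lt; lra].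
  - replace (d ^ 3 * (4 / d ^ 5 * (rho' * d ^ 3 * M (S (S k))))) with
      (4 * d * (rho' * M (S (S k)))) by (field; lra).
    assert (0 <= rho' * M (S (S k))) by (apply Rmult_le_pos; [easy|apply M_nonneg]).
    nra. }
assert (M2 := M_nonneg (S (S k))); assert (M0 := M_nonneg k).
apply (Rmult_le_compat_l (d ^ 3)) in R; [|lra].
set (c := 1588 / 1000 - 388 / 10000 * rho') in *.
assert (F : c * M (S (S k)) <= d ^ 3 * (INR (S k) * M k)) by (unfold c; nra).
apply Rmult_le_reg_l with c; [easy|].
assert (d ^ 3 * (INR (S k) * M k) <= d ^ 3 * (c * rho * M k)) by
  (apply Rmult_le_compat_l; [lra|]; apply Rmult_le_compat_r; lra).
lra.
Qed.

Let moments : M 4%nat <= 208 / 100 * d ^ 3 * M 2%nat /\ M 6%nat <= 7551 / 1000 * d ^ 6 * M 2%nat /\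
  M 8%nat <= 4093 / 100 * d ^ 9 * M 2%nat /\ M 12%nat <= 3249 * d ^ 15 * M 2%nat.
Proof.
assert (D3 : 0 < d ^ 3) by (apply pow_lt; lra).
(* Start of the chain: with y <= 0.4 d the error coefficient is 4 * 0.16 = 0.64, and 13 / (1.588 -
   0.64) < 13.72. *)
assert (M14 : M 14%nat <= 1372 / 100 * d ^ 3 * M 12%nat).
{ assert (R := M_rec 12).
  assert (B : M 16%nat <= 16 / 100 * d ^ 2 * M 14%nat).
  { unfold M; rewrite <- RInt_cmul by auto with cont.
    apply RInt_mono; [apply y1_pos|auto with cont|auto with cont|].
    intros y Hy; replace (y ^ 16) with (y ^ 2 * y ^ 14) by ring.
    rewrite Rmult_assoc; apply Rmult_le_compat_r.
    - apply Rmult_le_pos; [apply pow_le; lra|left; apply mo_pos].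
    - replace (16 / 100 * d ^ 2) with (y1 ^ 2) by (unfold y1; field); apply pow_incr; lra. }
  replace (INR 13) with 13 in R by (simpl; ring).
  apply (Rmult_le_compat_l (d ^ 3)) in R; [|lra].
  assert (E : d ^ 3 * (4 / d ^ 5 * M 16%nat) <= 64 / 100 * M 14%nat).
  { apply Rle_trans with (d ^ 3 * (4 / d ^ 5 * (16 / 100 * d ^ 2 * M 14%nat))).
    - apply Rmult_le_compat_l; [lra|]; apply Rmult_le_compat_l; [|easy].
      apply Rdiv_le_0_compat; [lra|apply pow_lt; lra].
    - right; field; lra. }
  assert (P14 := M_nonneg 14); assert (P12 := M_nonneg 12).
  assert (0 <= d ^ 3 * M 12%nat) by nra.
  nra. }
(* Each ratio is (k + 1) / (1.588 - 0.0388 rho') rounded up, where 0.0388 = 4 * 0.0097. *)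
assert (M12 := M_chain 10 _ (1043 / 100) M14 ltac:(lra) ltac:(simpl; lra) ltac:(lra)).
assert (M10 := M_chain 8 _ (761 / 100) M12 ltac:(lra) ltac:(simpl; lra) ltac:(lra)).
assert (M8 := M_chain 6 _ (542 / 100) M10 ltac:(lra) ltac:(simpl; lra) ltac:(lra)).
assert (M6 := M_chain 4 _ (363 / 100) M8 ltac:(lra) ltac:(simpl; lra) ltac:(lra)).
assert (M4 := M_chain 2 _ (208 / 100) M6 ltac:(lra) ltac:(simpl; lra) ltac:(lra)).
assert (P2 := M_nonneg 2).
assert (Comp : forall A B rho k c c', A <= rho * d ^ 3 * B -> B <= c * d ^ k * M 2%nat ->
  0 <= rho -> rho * c <= c' -> A <= c' * d ^ (3 + k) * M 2%nat).
{ intros A B rho k c c' HA HB Hrho Hc.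
  apply (Rle_trans _ _ _ HA), Rle_trans with (rho * d ^ 3 * (c * d ^ k * M 2%nat)).
  - apply Rmult_le_compat_l; [nra|easy].
  - rewrite pow_add.
    replace (rho * d ^ 3 * (c * d ^ k * M 2%nat)) with (rho * c * (d ^ 3 * d ^ k * M 2%nat)) by ring.
    rewrite (Rmult_assoc c'); apply Rmult_le_compat_r; [|easy].
    repeat apply Rmult_le_pos; try apply pow_le; lra. }
assert (N6 := Comp _ _ _ 3%nat _ (7551 / 1000) M6 M4 ltac:(lra) ltac:(lra)).
assert (N8 := Comp _ _ _ _ _ (4093 / 100) M8 N6 ltac:(lra) ltac:(lra)).
assert (N10 := Comp _ _ _ _ _ (3115 / 10) M10 N8 ltac:(lra) ltac:(lra)).
assert (N12 := Comp _ _ _ _ _ 3249 M12 N10 ltac:(lra) ltac:(lra)).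
simpl Nat.add in *; repeat split; try easy.
Qed.

(** * Tails beyond the main arc and positivity of the form *)

Hypothesis mo_minor : forall c f y,
  (c = 4 / 10 /\ f = 1055 / 10000) \/ (c = 5 / 10 /\ f = 1515 / 10000)
  \/ (c = 65 / 100 /\ f = 219 / 1000) \/ (c = 9 / 10 /\ f = 313 / 1000)
  \/ (c = 2 /\ f = 44 / 100) ->
  c * d <= y <= PI -> mo y <= mo 0 * exp (- (f / d)).

Variable s : R.
Hypothesis (Hs : 0 < s) (Es : s ^ 2 = d).

Let s_le : s <= 985 / 10000. Proof. nra. Qed.

(** With s the square root of d, half-integral powers of d become powers of s. In the applications k
    is close to f / 0.0097, where the power bound is sharpest at the largest d, and A is k / (2.718
    f) rounded up. *)
Let exp_small f A k K : (3 <= k)%nat -> 0 < f -> 0 < A -> INR k <= 2718 / 1000 * f * A ->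
  A ^ k * (985 / 10000) ^ (2 * k - 5) <= K -> exp (- (f / d)) <= K * (d ^ 2 * s).
Proof.
intros Hp Hf HA HpA HK.
eapply Rle_trans; [apply (exp_neg_le_pow f d A k); lra || lia|].
replace (d ^ 2 * s) with (s ^ 5) by (rewrite <- Es; ring).
rewrite Rpow_mult_distr, <- Es, <- pow_mult.
replace (2 * k)%nat with ((2 * k - 5) + 5)%nat by lia.
rewrite pow_add, <- Rmult_assoc; apply Rmult_le_compat_r; [apply pow_le; lra|].
eapply Rle_trans; [|exact HK].
replace (2 * k - 5 + 5 - 5)%nat with (2 * k - 5)%nat by lia.
apply Rmult_le_compat_l; [apply pow_le; lra|apply pow_incr; lra].
Qed.

Let exp1 : exp (- (1055 / 10000 / d)) <= 206 / 100 * (d ^ 2 * s).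
Proof. apply (exp_small _ (38365 / 1000) 11); [lia|lra|lra|simpl; lra|simpl; lra]. Qed.

Let exp2 : exp (- (1515 / 10000 / d)) <= 18 / 1000 * (d ^ 2 * s).
Proof. apply (exp_small _ (3886 / 100) 16); [lia|lra|lra|simpl; lra|simpl; lra]. Qed.

Let exp3 : exp (- (219 / 1000 / d)) <= 2 / 100000 * (d ^ 2 * s).
Proof. apply (exp_small _ (3865 / 100) 23); [lia|lra|lra|simpl; lra|simpl; lra]. Qed.

Let exp4 : exp (- (313 / 1000 / d)) <= 2 / 1000000000 * (d ^ 2 * s).
Proof. apply (exp_small _ (3762 / 100) 32); [lia|lra|lra|simpl; lra|simpl; lra]. Qed.

(** Used on [2 d, pi], where neither the length of the interval nor 1 - cos y supplies powers of d;
    hence d^7 s instead of d^2 s. *)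
Let exp5 : exp (- (44 / 100 / d)) <= 27 / 1000000 * (d ^ 7 * s).
Proof.
eapply Rle_trans; [apply (exp_neg_le_pow (44 / 100) d (3764 / 100) 45); try lra; [lia|simpl; lra]|].
replace (d ^ 7 * s) with (s ^ 15) by (rewrite <- Es; ring).
replace ((3764 / 100 * d) ^ 45) with ((3764 / 100) ^ 45 * s ^ 75 * s ^ 15) by (rewrite <- Es; ring).
apply Rmult_le_compat_r; [apply pow_le; lra|].
apply Rle_trans with ((3764 / 100) ^ 45 * (985 / 10000) ^ 75).
- apply Rmult_le_compat_l; [apply pow_le; lra|apply pow_incr; lra].
- simpl; lra.
Qed.

(** Converts bounds relative to the peak value into bounds relative to the second moment, by
    comparing both with M 0: 2.021 / 0.665 < 3.04. *)
Let peak : mo 0 * (d ^ 4 * s) <= 304 / 100 * M 2%nat.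
Proof.
assert (H0 := M0_upper); assert (L := M0_lower s Hs Es); destruct moments as (M4 & _).
assert (P := mo_pos 0); assert (P2 := M_nonneg 2).
assert (R1 : mo y1 <= mo 0 * (206 / 100 * (d ^ 2 * s))).
{ eapply Rle_trans; [apply (mo_minor (4 / 10) (1055 / 10000)); [lra|]|].
  - fold y1; generalize PI2_3_2; unfold y1; lra.
  - apply Rmult_le_compat_l; [lra|exact exp1]. }
assert (D3 : 0 < d ^ 3) by (apply pow_lt; lra).
apply (Rmult_le_compat_l (d ^ 3)) in H0; [|lra].
apply (Rmult_le_compat_l (d ^ 3)) in L; [|lra].
assert (E4 : d ^ 3 * (/ d ^ 5 * M 4%nat) <= 208 / 100 * d * M 2%nat).
{ replace (d ^ 3 * (/ d ^ 5 * M 4%nat)) with (/ d ^ 2 * M 4%nat) by (field; lra).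
  apply Rle_trans with (/ d ^ 2 * (208 / 100 * d ^ 3 * M 2%nat)); [|right; field; lra].
  apply Rmult_le_compat_l; [left; apply Rinv_0_lt_compat, pow_lt; lra|easy]. }
assert (E1 : d ^ 3 * (y1 * mo y1) <= 1 / 1000 * (mo 0 * (d ^ 4 * s))).
{ apply Rle_trans with (d ^ 3 * (y1 * (mo 0 * (206 / 100 * (d ^ 2 * s))))).
  - apply Rmult_le_compat_l; [lra|]; apply Rmult_le_compat_l; [apply y1_pos|easy].
  - replace (d ^ 3 * (y1 * (mo 0 * (206 / 100 * (d ^ 2 * s))))) with
      ((824 / 1000 * d ^ 2) * (mo 0 * (d ^ 4 * s))) by (unfold y1; field).
    apply Rmult_le_compat_r; [|nra].
    repeat apply Rmult_le_pos; try apply pow_le; lra. }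
assert (d ^ 3 * (V * M 2%nat) <= 2 * M 2%nat) by nra.
assert (208 / 100 * d * M 2%nat <= 21 / 1000 * M 2%nat) by nra.
lra.
Qed.

Let tail2 := RInt (fun y => (1 - cos y) * (1 - cos y) * mo y) y1 PI.

(** A single decay rate would be too weak: near 0.4 d only the smallest rate is available, but there
    (1 - cos y)^2 is small as well. The range is therefore cut at 0.5 d, 0.65 d, 0.9 d and 2 d. *)
Lemma tail2_upper : tail2 <= 116 / 10000 * d ^ 3 * M 2%nat.
Proof.
assert (P3 := PI2_3_2); assert (P4 := PI_4); assert (P := mo_pos 0).
assert (PK := peak).
assert (CF : cont (fun y => (1 - cos y) * (1 - cos y) * mo y)).
{ apply cont_mult; [|exact cont_mo].
  apply cont_mult; apply (cont_plus (fun _ => 1) (fun y => - cos y)); auto with cont;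
  intros x; apply (continuous_opp (V := R_NormedModule)), cont_cos. }
assert (Piece : forall c f b K, (c = 4 / 10 /\ f = 1055 / 10000) \/ (c = 5 / 10 /\ f = 1515 / 10000)
  \/ (c = 65 / 100 /\ f = 219 / 1000) \/ (c = 9 / 10 /\ f = 313 / 1000) \/ (c = 2 /\ f = 44 / 100) ->
  c <= b <= 2 -> exp (- (f / d)) <= K * (d ^ 2 * s) ->
  RInt (fun y => (1 - cos y) * (1 - cos y) * mo y) (c * d) (b * d)
  <= (b - c) * b ^ 4 / 4 * K * (d ^ 3 * (mo 0 * (d ^ 4 * s)))).
{ intros c f b K Hcf Hb HK.
  replace ((b - c) * b ^ 4 / 4 * K * (d ^ 3 * (mo 0 * (d ^ 4 * s)))) with
    ((b * d - c * d) * (((b * d) ^ 2 / 2 * ((b * d) ^ 2 / 2)) * (mo 0 * (K * (d ^ 2 * s))))) by field.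
  assert (0 <= c * d) by (apply Rmult_le_pos; lra).
  assert (c * d <= b * d <= 2 * d) by (split; apply Rmult_le_compat_r; lra).
  apply RInt_le_const; [lra|exact CF|].
  intros y Hy.
  assert (C := one_minus_cos_bounds y ltac:(lra)).
  assert (y ^ 2 <= (b * d) ^ 2) by (apply pow_incr; lra).
  apply Rmult_le_compat; [apply Rmult_le_pos; lra|left; apply mo_pos|
    apply Rmult_le_compat; lra|].
  eapply Rle_trans; [apply (mo_minor c f); [easy|lra]|].
  apply Rmult_le_compat_l; lra. }
assert (I1 := Piece _ _ (5 / 10) _ (or_introl (conj eq_refl eq_refl)) ltac:(lra) exp1).
assert (I2 := Piece (5 / 10) _ (65 / 100) _ ltac:(right; left; split; reflexivity) ltac:(lra) exp2).
assert (I3 := Piece (65 / 100) _ (9 / 10) _ ltac:(right; right; left; split; reflexivity) ltac:(lra) exp3).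
assert (I4 := Piece (9 / 10) _ 2 _ ltac:(right; right; right; left; split; reflexivity) ltac:(lra) exp4).
assert (I5 : RInt (fun y => (1 - cos y) * (1 - cos y) * mo y) (2 * d) PI <=
  16 * (27 / 1000000) * (d ^ 3 * (mo 0 * (d ^ 4 * s)))).
{ apply Rle_trans with ((PI - 2 * d) * (2 * 2 * (mo 0 * (27 / 1000000 * (d ^ 7 * s))))).
  - apply RInt_le_const; [lra|exact CF|].
    intros y Hy; generalize (COS_bound y); intros C.
    apply Rmult_le_compat; [apply Rmult_le_pos; lra|left; apply mo_pos|
      apply Rmult_le_compat; lra|].
    eapply Rle_trans; [apply (mo_minor 2 (44 / 100)); [lra|easy]|].
    apply Rmult_le_compat_l; [lra|exact exp5].
  - replace (16 * (27 / 1000000) * (d ^ 3 * (mo 0 * (d ^ 4 * s)))) with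
      (4 * (2 * 2 * (mo 0 * (27 / 1000000 * (d ^ 7 * s))))) by field.
    apply Rmult_le_compat_r; [|lra].
    repeat apply Rmult_le_pos; try apply pow_le; lra. }
unfold tail2, y1.
rewrite (RInt_split _ _ (5 / 10 * d)), (RInt_split _ (5 / 10 * d) (65 / 100 * d)),
  (RInt_split _ (65 / 100 * d) (9 / 10 * d)), (RInt_split _ (9 / 10 * d) (2 * d)) by exact CF.
assert (D3 : 0 <= d ^ 3) by (apply pow_le; lra).
apply (Rmult_le_compat_l _ _ _ D3) in PK.
assert (Z := Rmult_le_pos _ _ D3 (M_nonneg 2)).
set (X := d ^ 3 * (mo 0 * (d ^ 4 * s))) in *; lra.
Qed.

Let cont_versin : cont (fun y => 1 - cos y).
Proof.
apply (cont_plus (fun _ => 1) (fun y => - cos y)); auto with cont.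
intros x; apply (continuous_opp (V := R_NormedModule)), cont_cos.
Qed.

Hint Resolve cont_versin : cont.

Let versin_far y : y1 <= y <= PI -> 799 / 10000 * d ^ 2 <= 1 - cos y <= 2.
Proof.
intros Hy; split; [|generalize (COS_bound y); lra].
assert (cos y <= cos y1) by (apply cos_decr_1; unfold y1 in *; lra).
assert (L := one_minus_cos_lower y1 y1_pos).
assert (y1 ^ 4 <= 1 / 1000 * d ^ 2).
{ replace (y1 ^ 4) with (256 / 10000 * d ^ 2 * d ^ 2) by (unfold y1; field).
  assert (0 <= d ^ 2 <= 1 / 100) by (clear - Hd; nra); nra. }
replace (y1 ^ 2) with (16 / 100 * d ^ 2) in L by (unfold y1; field).
assert (0 <= d ^ 2) by (apply pow_le; lra); lra.
Qed.

Let tail1 := RInt (fun y => (1 - cos y) * mo y) y1 PI.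
Let tail0 := RInt mo y1 PI.

Let y1_le_PI : y1 <= PI. Proof. generalize PI2_3_2; unfold y1; lra. Qed.

(** On the tail 1 - cos y >= 0.0799 d^2, so a tail with one factor 1 - cos y fewer costs one
    division by this quantity. The same argument then gives [tail0_upper]. *)
Let tail1_upper : tail1 <= 146 / 1000 * d * M 2%nat.
Proof.
assert (H : RInt (fun y => 799 / 10000 * d ^ 2 * ((1 - cos y) * mo y)) y1 PI <= tail2).
{ apply RInt_mono; [exact y1_le_PI|auto 10 with cont|auto 10 with cont|].
  intros y Hy; assert (F := versin_far y Hy); assert (P := mo_pos y).
  rewrite (Rmult_assoc (1 - cos y)); apply Rmult_le_compat_r; [|lra].
  apply Rmult_le_pos; nra. }
rewrite RInt_cmul in H by auto with cont; fold tail1 in H.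
assert (T2 := tail2_upper); assert (P2 := M_nonneg 2).
assert (D2 : 0 < d ^ 2) by nra.
apply Rmult_le_reg_l with (799 / 10000 * d ^ 2); [lra|].
replace (799 / 10000 * d ^ 2 * (146 / 1000 * d * M 2%nat))
  with (799 * 146 / 10000000 * (d ^ 3 * M 2%nat)) by field.
assert (0 <= d ^ 3 * M 2%nat) by (apply Rmult_le_pos; [apply pow_le; lra|easy]).
lra.
Qed.

Let tail0_upper : d ^ 3 * tail0 <= 1 / 1000 * M 2%nat.
Proof.
assert (H : RInt (fun y => 799 / 10000 * d ^ 2 * mo y) y1 PI <= tail1).
{ apply RInt_mono; [exact y1_le_PI|auto 10 with cont|auto 10 with cont|].
  intros y Hy; assert (F := versin_far y Hy); assert (P := mo_pos y).
  apply Rmult_le_compat_r; lra. }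
rewrite RInt_cmul in H by auto with cont; fold tail0 in H.
assert (T1 := tail1_upper); assert (P2 := M_nonneg 2).
replace (d ^ 3 * tail0) with (10000 / 799 * d * (799 / 10000 * d ^ 2 * tail0)) by field.
apply Rle_trans with (10000 / 799 * d * (146 / 1000 * d * M 2%nat)).
- apply Rmult_le_compat_l; [nra|lra].
- replace (10000 / 799 * d * (146 / 1000 * d * M 2%nat)) with (1460 / 799 * d ^ 2 * M 2%nat) by field.
  apply Rmult_le_compat_r; [easy|nra].
Qed.

(** The constants evaluate the error terms at d = 0.0097 using [moments]. The loss in the fourth
    moment comes mostly from the quadratic phase term with M 8, about 1.03 out of 1.271. *)
Let moment_bounds (mu := M 2%nat) :
  0 < mu /\ 0 <= t 2%nat <= mu /\ 8276 / 10000 * mu <= t 2%nat /\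
  d ^ 3 * V * t 2%nat <= d ^ 3 * t 0%nat + 1446 / 10000 * mu /\
  3 * t 2%nat <= d ^ 3 * V * (t 4%nat / d ^ 3) + 1271 / 1000 * mu.
Proof.
assert (PK := peak); assert (P0 := mo_pos 0).
assert (D3 : 0 < d ^ 3) by (apply pow_lt; lra).
assert (D4 : 0 < d ^ 4 * s) by (apply Rmult_lt_0_compat; [apply pow_lt|]; lra).
assert (Hmu : 0 < mu) by (unfold mu; nra).
destruct moments as (M4 & M6 & M8 & M12); fold mu in PK, M4, M6, M8, M12.
assert (R1 : mo y1 <= 627 / 100 * (mu / d ^ 2)).
{ apply Rle_trans with (mo 0 * (206 / 100 * (d ^ 2 * s))).
  - eapply Rle_trans; [apply (mo_minor (4 / 10) (1055 / 10000)); [lra|]|].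
    + fold y1; generalize y1_le_PI; lra.
    + apply Rmult_le_compat_l; [lra|exact exp1].
  - apply Rmult_le_reg_r with (d ^ 2); [apply pow_lt; lra|].
    replace (627 / 100 * (mu / d ^ 2) * d ^ 2) with (627 / 100 * mu) by (field; lra).
    replace (mo 0 * (206 / 100 * (d ^ 2 * s)) * d ^ 2) with (206 / 100 * (mo 0 * (d ^ 4 * s))) by ring.
    lra. }
assert (Scale : forall j k c m', 0 <= c -> m' <= c * d ^ (j + k) * mu -> / d ^ j * m' <= c * d ^ k * mu).
{ intros j k c m' Hc H; assert (Dj : 0 < d ^ j) by (apply pow_lt; lra).
  apply Rmult_le_reg_l with (d ^ j); [easy|].
  rewrite <- Rmult_assoc, Rinv_r by lra; rewrite Rmult_1_l.
  replace (d ^ j * (c * d ^ k * mu)) with (c * d ^ (j + k) * mu) by (rewrite pow_add; ring); easy. }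
assert (d2 : 0 <= d ^ 2 <= 941 / 10000000) by (clear - Hd; nra).
assert (T2 : t 2%nat <= mu).
{ unfold t, mu, M; apply RInt_mono; [exact y1_pos|auto with cont|auto with cont|].
  intros y Hy; apply Rmult_le_compat_l; [apply pow2_ge_0|apply T_abs]. }
assert (S8 := Scale 8%nat 1%nat (4093 / 100) _ ltac:(lra) M8).
assert (L2 : 8276 / 10000 * mu <= t 2%nat).
{ assert (L := t2_lower); fold mu in L.
  replace ((559 / 600) ^ 2 / d ^ 8 / 2 * M 8%nat) with (312481 / 720000 * (/ d ^ 8 * M 8%nat)) in L
    by (field; lra).
  assert (d * mu <= 97 / 10000 * mu) by (apply Rmult_le_compat_r; lra).
  rewrite pow_1 in S8; lra. }
repeat split; try lra.
- assert (L := t2_upper).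
  apply (Rmult_le_compat_l (d ^ 3)) in L; [|lra].
  assert (E4 := Scale 2%nat 1%nat (208 / 100) _ ltac:(lra) M4).
  assert (E6 := Scale 5%nat 1%nat (7551 / 1000) _ ltac:(lra) M6).
  assert (E1 : d ^ 3 * (y1 * mo y1) <= 3 / 10000 * mu).
  { apply Rle_trans with (d ^ 3 * (y1 * (627 / 100 * (mu / d ^ 2)))).
    - apply Rmult_le_compat_l; [lra|]; apply Rmult_le_compat_l; [exact y1_pos|easy].
    - replace (d ^ 3 * (y1 * (627 / 100 * (mu / d ^ 2)))) with (2508 / 1000 * d ^ 2 * mu)
        by (unfold y1; field; lra).
      apply Rmult_le_compat_r; lra. }
  replace (d ^ 3 * (t 0%nat + 4 / d ^ 5 * M 4%nat + 312481 / 360000 / d ^ 8 * M 6%nat + y1 * mo y1))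
    with (d ^ 3 * t 0%nat + 4 * (/ d ^ 2 * M 4%nat) + 312481 / 360000 * (/ d ^ 5 * M 6%nat)
      + d ^ 3 * (y1 * mo y1)) in L by (field; lra).
  assert (d * mu <= 97 / 10000 * mu) by (apply Rmult_le_compat_r; lra).
  rewrite pow_1 in *; lra.
- assert (L := t4_lower).
  assert (E6 := Scale 5%nat 1%nat (7551 / 1000) _ ltac:(lra) M6).
  assert (E12 := Scale 13%nat 2%nat 3249 _ ltac:(lra) M12).
  assert (E1 : y1 ^ 3 * mo y1 <= 4 / 1000 * mu).
  { apply Rle_trans with (y1 ^ 3 * (627 / 100 * (mu / d ^ 2))).
    - apply Rmult_le_compat_l; [apply pow_le, y1_pos|easy].
    - replace (y1 ^ 3 * (627 / 100 * (mu / d ^ 2))) with (64 * 627 / 100000 * d * mu)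
        by (unfold y1; field; lra).
      apply Rmult_le_compat_r; lra. }
  replace (d ^ 3 * V * (t 4%nat / d ^ 3)) with (V * t 4%nat) by (field; lra).
  replace (312481 / 600000 / d ^ 13 * M 12%nat) with (312481 / 600000 * (/ d ^ 13 * M 12%nat)) in L
    by (field; lra).
  replace (312481 / 120000 / d ^ 8 * M 8%nat) with (312481 / 120000 * (/ d ^ 8 * M 8%nat)) in L
    by (field; lra).
  assert (d * mu <= 97 / 10000 * mu) by (apply Rmult_le_compat_r; lra).
  assert (d ^ 2 * mu <= 941 / 10000000 * mu) by (apply Rmult_le_compat_r; lra).
  rewrite pow_1 in *; lra.
Qed.

(** To leading order B0, B2, B11 and B22 are t 0, t 2 / 2, t 2 and t 4 / 4, so the last inequality
    compares t 2 ^ 2 with t 0 * t 4. *)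
Lemma trig_form_positive
  (B0 := RInt T 0 PI) (B2 := RInt (fun y => (1 - cos y) * T y) 0 PI)
  (B11 := RInt (fun y => sin y * sin y * T y) 0 PI)
  (B22 := RInt (fun y => (1 - cos y) * (1 - cos y) * T y) 0 PI) :
  0 < B0 /\ 0 < B11 /\ B2 ^ 2 < B0 * B22.
Proof.
destruct moment_bounds as (Hmu & Ht2 & L2 & L0 & L4); set (mu := M 2%nat) in *.
destruct moments as (M4 & M6 & _ & _); fold mu in M4, M6.
assert (T0 := tail0_upper); assert (T1 := tail1_upper); assert (T2 := tail2_upper).
fold mu in T0, T1, T2.
assert (D3 : 0 < d ^ 3 <= 1 / 1000000) by (split; [apply pow_lt; lra|
  apply Rle_trans with ((1 / 100) ^ 3); [apply pow_incr; lra|lra]]).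
assert (d3 : 0 <= d ^ 6 <= d ^ 3 * (1 / 1000000)) by (clear - D3; nra).
set (v := d ^ 3 * V) in *.
assert (Far : forall w : R -> R, cont w -> (forall y, 0 <= w y) ->
  - RInt (fun y => w y * mo y) y1 PI <= RInt (fun y => w y * T y) y1 PI
  <= RInt (fun y => w y * mo y) y1 PI).
{ intros w Hw Pw; split.
  - replace (- RInt (fun y => w y * mo y) y1 PI) with (- 1 * RInt (fun y => w y * mo y) y1 PI) by ring.
    rewrite <- RInt_cmul by auto with cont.
    apply RInt_mono; [exact y1_le_PI|auto 10 with cont|auto 10 with cont|].
    intros y _; assert (Z := Rmult_le_compat_l (w y) _ _ (Pw y) (proj1 (T_abs y))); lra.
  - apply RInt_mono; [exact y1_le_PI|auto 10 with cont|auto 10 with cont|].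
    intros y _; apply Rmult_le_compat_l; [apply Pw|apply T_abs]. }
assert (PC : forall y, 0 <= 1 - cos y) by (intros; generalize (COS_bound y); lra).
assert (F1 := Far (fun y => 1 - cos y) ltac:(auto with cont) PC); cbv beta in F1; fold tail1 in F1.
assert (F2 := Far (fun y => (1 - cos y) * (1 - cos y)) ltac:(auto with cont)
  ltac:(intros; apply Rmult_le_pos; apply PC)); cbv beta in F2; fold tail2 in F2.
assert (F3 := Far (fun y => sin y * sin y) ltac:(auto with cont) (fun y => Rle_0_sqr (sin y))); cbv beta in F3.
assert (N0 : t 0%nat - tail0 <= B0).
{ unfold B0; rewrite (RInt_split _ 0 y1) by auto with cont.
  assert (E : RInt T 0 y1 = t 0%nat) by (apply RInt_ext; intros; simpl; ring).
  rewrite E; assert (- tail0 <= RInt T y1 PI); [|lra].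
  unfold tail0; replace (- RInt mo y1 PI) with (- 1 * RInt mo y1 PI) by ring.
  rewrite <- RInt_cmul by auto with cont.
  apply RInt_mono; [exact y1_le_PI|auto with cont|auto with cont|].
  intros y _; generalize (T_abs y); lra. }
assert (N1 : Rabs (B2 - / 2 * t 2%nat) <= / 24 * M 4%nat + tail1).
{ assert (C : Rabs (RInt (fun y => (1 - cos y) * T y) 0 y1 - / 2 * t 2%nat) <= / 24 * M 4%nat).
  { apply Rabs_le; split.
    - assert (X : RInt (fun y => / 2 * (y ^ 2 * T y) + (- / 24) * (y ^ 4 * mo y)) 0 y1
        <= RInt (fun y => (1 - cos y) * T y) 0 y1).
      + apply RInt_mono; [exact y1_pos|auto 10 with cont|auto 10 with cont|].
        intros y Hy; assert (C1 := one_minus_cos_bounds y ltac:(lra)).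
        assert (C2 := one_minus_cos_lower y ltac:(lra)).
        assert (Z := perturbed_weight (1 - cos y) (y ^ 2 / 2) (y ^ 4 / 24) _ _ (T_abs y) ltac:(lra)); lra.
      + rewrite RInt_add, !RInt_cmul in X by auto 10 with cont.
        fold (t 2%nat) (M 4%nat) in X; lra.
    - assert (X : RInt (fun y => (1 - cos y) * T y) 0 y1 <=
        RInt (fun y => / 2 * (y ^ 2 * T y) + / 24 * (y ^ 4 * mo y)) 0 y1).
      + apply RInt_mono; [exact y1_pos|auto 10 with cont|auto 10 with cont|].
        intros y Hy; assert (C1 := one_minus_cos_bounds y ltac:(lra)).
        assert (C2 := one_minus_cos_lower y ltac:(lra)).
        assert (Z := perturbed_weight (1 - cos y) (y ^ 2 / 2) (y ^ 4 / 24) _ _ (T_abs y) ltac:(lra)); lra.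
      + rewrite RInt_add, !RInt_cmul in X by auto 10 with cont.
        fold (t 2%nat) (M 4%nat) in X; lra. }
  unfold B2; rewrite (RInt_split _ 0 y1) by auto with cont.
  apply Rabs_le_between in C; apply Rabs_le; lra. }
assert (N11 : t 2%nat - / 3 * M 4%nat - 2 * tail1 <= B11).
{ unfold B11; rewrite (RInt_split _ 0 y1) by auto with cont.
  assert (X : RInt (fun y => y ^ 2 * T y + (- / 3) * (y ^ 4 * mo y)) 0 y1
        <= RInt (fun y => sin y * sin y * T y) 0 y1).
  - apply RInt_mono; [exact y1_pos|auto 10 with cont|auto 10 with cont|].
    intros y Hy; assert (S1 := sin_abs_le y ltac:(lra)); assert (S2 := sin_lower y ltac:(lra)).
    assert (Y : 0 <= y ^ 2 - sin y * sin y <= / 3 * y ^ 4).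
    { assert (Hy1 : 0 <= y <= 1) by (unfold y1 in Hy; lra).
      clear - S1 S2 Hy1; set (z := sin y) in *; clearbody z.
      split; [nra|]; assert (0 <= y - y ^ 3 / 6) by nra; nra. }
    assert (Z := perturbed_weight (sin y * sin y) (y ^ 2) (/ 3 * y ^ 4) _ _ (T_abs y) ltac:(lra)); lra.
  - rewrite RInt_add, !RInt_cmul in X by auto 10 with cont.
    fold (t 2%nat) (M 4%nat) in X.
    assert (Z : RInt (fun y => sin y * sin y * mo y) y1 PI <= 2 * tail1).
    { unfold tail1; rewrite <- RInt_cmul by auto with cont.
      apply RInt_mono; [exact y1_le_PI|auto 10 with cont|auto 10 with cont|].
      intros y _; rewrite <- Rmult_assoc; apply Rmult_le_compat_r; [left; apply mo_pos|].
      assert (S := sin2_cos2 y); assert (C := COS_bound y); unfold Rsqr in S; clear - S C; nra. }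
    lra. }
assert (N2 : / 4 * t 4%nat - / 24 * M 6%nat - tail2 <= B22).
{ unfold B22; rewrite (RInt_split _ 0 y1) by auto with cont.
  assert (X : RInt (fun y => / 4 * (y ^ 4 * T y) + (- / 24) * (y ^ 6 * mo y)) 0 y1
        <= RInt (fun y => (1 - cos y) * (1 - cos y) * T y) 0 y1).
  - apply RInt_mono; [exact y1_pos|auto 10 with cont|auto 10 with cont|].
    intros y Hy; assert (C1 := one_minus_cos_bounds y ltac:(lra)).
    assert (C2 := one_minus_cos_lower y ltac:(lra)).
    assert (Y : 0 <= / 4 * y ^ 4 - (1 - cos y) * (1 - cos y) <= / 24 * y ^ 6).
    { assert (Y2 : 0 <= y ^ 2 <= 1) by (clear - Hy Hd; unfold y1 in Hy; nra).
      set (c := 1 - cos y) in *; clearbody c.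
      assert (E4 : y ^ 4 = y ^ 2 * y ^ 2) by ring; rewrite E4 in *.
      replace (y ^ 6) with (y ^ 2 * y ^ 2 * y ^ 2) by ring.
      set (z := y ^ 2) in *; clearbody z; clear - C1 C2 Y2.
      split; nra. }
    assert (Z := perturbed_weight ((1 - cos y) * (1 - cos y)) (/ 4 * y ^ 4) (/ 24 * y ^ 6) _ _
      (T_abs y) ltac:(lra)); lra.
  - rewrite RInt_add, !RInt_cmul in X by auto 10 with cont.
    fold (t 4%nat) (M 6%nat) in X; lra. }
clear Far F1 F2 F3 PC; clearbody B0 B2 B11 B22 mu tail0 tail1 tail2.
clear - Hd HV Hmu Ht2 L2 L0 L4 M4 M6 T0 T1 T2 D3 d3 N0 N1 N11 N2.
change (d ^ 3 * V) with v in HV.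
assert (Ev : 1588 / 1000 <= v <= 2) by exact HV; clearbody v; clear HV.
set (e := d ^ 3) in *; replace (d ^ 6) with (e * e) in * by (unfold e; ring).
assert (Dm : d * mu <= 97 / 10000 * mu) by (apply Rmult_le_compat_r; lra).
assert (Em : e * mu <= 1 / 1000000 * mu) by (apply Rmult_le_compat_r; lra).
assert (T1' : tail1 <= 1417 / 1000000 * mu) by lra.
assert (M4' : M 4%nat <= 3 / 1000000 * mu) by nra.
set (tau := t 2%nat / mu).
assert (Et : t 2%nat = tau * mu) by (unfold tau; field; lra).
assert (Htau : 8276 / 10000 <= tau <= 1).
{ split; [apply (Rle_div_r (8276 / 10000))|apply (Rle_div_l (t 2%nat))]; lra. }
rewrite Et in *; clearbody tau.
(* The shift 0.0917 is (0.1446 + 0.001) / 1.588 rounded up, and 1.364 is 1.271 + 2 * 4 * 0.0116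
   rounded up. The factor v of P0 and P4 cancels in their product. *)
assert (P0 : v * (tau - 917 / 10000) * mu <= e * B0).
{ assert (e * (t 0%nat - tail0) <= e * B0) by (apply Rmult_le_compat_l; lra). nra. }
assert (P4 : (3 * tau - 1364 / 1000) * mu <= v * (4 * B22 / e)).
{ apply Rle_trans with (v * (4 * (/ 4 * t 4%nat - / 24 * M 6%nat - tail2) / e)).
  - replace (v * (4 * (/ 4 * t 4%nat - / 24 * M 6%nat - tail2) / e)) with
      (v * (t 4%nat / e) - v * (/ 6 * (M 6%nat / e) + 4 * (tail2 / e))) by (field; lra).
    assert (M 6%nat / e <= 1 / 100000 * mu) by (apply Rle_div_l; nra).
    assert (tail2 / e <= 116 / 10000 * mu) by (apply Rle_div_l; nra).
    nra.
  - apply Rmult_le_compat_l; [lra|].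
    unfold Rdiv; apply Rmult_le_compat_r; [left; apply Rinv_0_lt_compat|]; lra. }
assert (P2 : Rabs (2 * B2) <= (tau + 29 / 10000) * mu).
{ apply Rabs_le_between in N1; apply Rabs_le; nra. }
assert (Q0 : 0 < B0).
{ apply Rmult_lt_reg_l with e; [lra|]; rewrite Rmult_0_r.
  eapply Rlt_le_trans; [|exact P0]; repeat apply Rmult_lt_0_compat; lra. }
repeat split; [easy|nra|].
assert (P2' : (2 * B2) ^ 2 <= ((tau + 29 / 10000) * mu) ^ 2).
{ rewrite <- (pow2_abs (2 * B2)); apply pow_incr; split; [apply Rabs_pos|easy]. }
(* Without errors this is tau^2 < 3 tau^2; at the smallest tau = 0.8276 the sides are about 0.690
   and 0.823. *)
assert (XY : (tau + 29 / 10000) ^ 2 < (tau - 917 / 10000) * (3 * tau - 1364 / 1000)) by nra.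
assert (W : (v * (tau - 917 / 10000) * mu) * ((3 * tau - 1364 / 1000) * mu)
  <= (e * B0) * (v * (4 * B22 / e))).
{ apply Rmult_le_compat; [| |easy|easy]; repeat apply Rmult_le_pos; lra. }
replace ((e * B0) * (v * (4 * B22 / e))) with (v * (4 * (B0 * B22))) in W by (field; lra).
assert (W' : (tau - 917 / 10000) * (3 * tau - 1364 / 1000) * mu ^ 2 <= 4 * (B0 * B22)).
{ apply Rmult_le_reg_l with v; lra. }
assert (0 < mu ^ 2) by (apply pow_lt; lra).
assert ((tau + 29 / 10000) ^ 2 * mu ^ 2 < (tau - 917 / 10000) * (3 * tau - 1364 / 1000) * mu ^ 2)
  by (apply Rmult_lt_compat_r; lra).
lra.
Qed.

End Moments.

(** * From the trigonometric form to the Toeplitz determinant *)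

(* [c] times the 3x3 Toeplitz determinant with diagonals [a], [b], [c], [x], [y] is the difference
   of the two sides; in the real basis [1, sin, 1 - cos] the determinant is, up to a factor 4, the
   sum of a positive term and of a positive definite quadratic form. *)
Lemma toeplitz_positive (a b c x y : R)
  (B0 := c) (B2 := c - (b + x) / 2) (B11 := c / 2 - (a + y) / 4)
  (B22 := 3 / 2 * c - (b + x) + (a + y) / 4) :
  0 < B0 -> 0 < B11 -> B2 ^ 2 < B0 * B22 ->
  (b ^ 2 - a * c) * (x ^ 2 - c * y) < (c ^ 2 - b * x) ^ 2.
Proof.
intros H0 H11 H.
(* Up to a factor i, these are the entries of sin y against 1 and against 1 - cos y. *)
set (O1 := (b - x) / 2); set (O3 := O1 - (a - y) / 4).
assert (E : (c ^ 2 - b * x) ^ 2 - (b ^ 2 - a * c) * (x ^ 2 - c * y)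
  = 4 * B0 * (B11 * (B0 * B22 - B2 ^ 2)) + 4 * (B0 * O3 - B2 * O1) ^ 2
    + 4 * O1 ^ 2 * (B0 * B22 - B2 ^ 2)).
{ unfold B0, B11, B2, B22, O3, O1; field. }
assert (0 < B0 * (B11 * (B0 * B22 - B2 ^ 2))) by (repeat apply Rmult_lt_0_compat; lra).
assert (0 <= (B0 * O3 - B2 * O1) ^ 2) by apply pow2_ge_0.
assert (0 <= O1 ^ 2 * (B0 * B22 - B2 ^ 2)) by (apply Rmult_le_pos; [apply pow2_ge_0|lra]).
lra.
Qed.

Lemma two_log_concave_large n : (9300 <= Z.of_nat n)%Z ->
  two_log_concave_at (fun k => cnt k (Z.of_nat k)) n.
Proof.
intros Hn.
assert (HnR : 9300 <= INR n) by (rewrite INR_IZR_INZ; now apply IZR_le).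
destruct (saddle_exists n HnR) as (m & r & Hm & Hr & Hmean & Hd & Htail).
set (d := 1 - r) in *.
assert (Hrd : r = 1 - d) by (unfold d; ring).
assert (Hm1 : (1 <= m)%nat) by lia.
assert (Hd' : 0 < d <= 97 / 10000) by (unfold d in *; lra).
assert (HV : 1588 / 1000 <= d ^ 3 * variance r m <= 2).
{ split; [now apply variance_lower|now apply variance_upper]. }
assert (D3 : 0 < d ^ 3) by (apply pow_lt; lra).
(* After scaling by d^3 the lower bound for [decay] is at least y (1.588 - 4 * 0.16). *)
assert (Hdec : forall y, 0 <= y <= 4 / 10 * d -> 0 <= decay r m y).
{ intros y Hy; eapply Rle_trans; [|apply (decay_lower r d m); easy].
  apply Rmult_le_reg_l with (d ^ 3); [easy|]; rewrite Rmult_0_r.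
  replace (d ^ 3 * (variance r m * y - 4 * y ^ 3 / d ^ 5)) with
    (y * (d ^ 3 * variance r m - 4 * (y / d) ^ 2)) by (field; lra).
  assert (0 <= y / d <= 4 / 10) by (split; [apply Rdiv_le_0_compat|apply Rle_div_l]; lra).
  apply Rmult_le_pos; nra. }
destruct (trig_form_positive (modulus r m) (phase r m (INR n)) (decay r m) (phase' r m) d
  (variance r m) (modulus_pos r Hr m) (is_derive_modulus r Hr m)
  (fun y => is_derive_phase r Hr m (INR n) y Hmean) Hd' HV
  (decay_upper r d m Hr Hrd Hm1 Hd) (decay_lower r d m Hr Hrd Hm1 Hd)
  (phase'_bounds r d m Hr Hrd Hm1 Htail Hd)
  (fun y => phase_bounds r d m Hr Hrd Hm1 Htail Hd (INR n) y Hmean) Hdec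
  (modulus_minor r d m Hr Hrd Hm1 Htail Hd) (sqrt d)
  ltac:(apply sqrt_lt_R0; lra) ltac:(rewrite pow2_sqrt; lra)) as (P0 & P11 & P2).
set (T := fun y => modulus r m y * cos (phase r m (INR n) y)) in *.
set (I := fun z => PI * (r ^ Z.to_nat z * IZR (cnt m z))).
pose (N := Z.of_nat n).
assert (HI : forall z, is_RInt (trig r m (IZR z)) 0 PI (I z)) by (intros; now apply RInt_trig).
assert (HT : forall j y, trig r m (IZR (N + j)) y = modulus r m y * cos (phase r m (INR n) y + IZR j * y)).
{ intros j y; rewrite (trig_polar r Hr); f_equal; f_equal.
  unfold phase, N; rewrite plus_IZR, <- INR_IZR_INZ; ring. }
assert (Hlin : forall a b e f : R, is_RInt (fun y => a * trig r m (IZR (N + 0)) y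
    + (b * (trig r m (IZR (N + 1)) y + trig r m (IZR (N + -1)) y)
       + e * (trig r m (IZR (N + 2)) y + trig r m (IZR (N + -2)) y))) 0 PI
    (a * I (N + 0)%Z + (b * (I (N + 1)%Z + I (N + -1)%Z) + e * (I (N + 2)%Z + I (N + -2)%Z)))).
{ intros a b e _.
  assert (Add : forall (f g : R -> R) u v, is_RInt f 0 PI u -> is_RInt g 0 PI v ->
    is_RInt (fun y => f y + g y) 0 PI (u + v)) by exact (fun f g u v => is_RInt_plus f g 0 PI u v).
  assert (Mul : forall k (f : R -> R) u, is_RInt f 0 PI u -> is_RInt (fun y => k * f y) 0 PI (k * u))
    by exact (fun k f u => is_RInt_scal f 0 PI k u).
  exact (Add _ _ _ _ (Mul a _ _ (HI _)) (Add _ _ _ _ (Mul b _ _ (Add _ _ _ _ (HI _) (HI _)))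
    (Mul e _ _ (Add _ _ _ _ (HI _) (HI _))))). }
(* Since cos (phase + j y) + cos (phase - j y) = 2 cos (phase) cos (j y), pairing the coefficients
   at n + j and n - j leaves the integral of T against an even trigonometric polynomial. *)
assert (Hform : forall a b e (w : R -> R), (forall y, w y = a + 2 * b * cos y + 2 * e * cos (2 * y)) ->
  RInt (fun y => w y * T y) 0 PI = 
    (a * I (N + 0)%Z + (b * (I (N + 1)%Z + I (N + -1)%Z) + e * (I (N + 2)%Z + I (N + -2)%Z)))).
{ intros a b e w Hw; apply is_RInt_unique.
  eapply is_RInt_ext; [|exact (Hlin a b e 0)].
  intros y _; cbv beta; rewrite !HT, Hw; unfold T.
  replace (phase r m (INR n) y + 0 * y) with (phase r m (INR n) y) by ring.
  replace (phase r m (INR n) y + 1 * y) with (phase r m (INR n) y + y) by ring.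
  replace (phase r m (INR n) y + -1 * y) with (phase r m (INR n) y - y) by ring.
  replace (phase r m (INR n) y + -2 * y) with (phase r m (INR n) y - 2 * y) by ring.
  rewrite !cos_plus, !cos_minus; match goal with |- ?u = ?v => change (@eq R u v) end; ring. }
assert (E0 : @eq R (RInt T 0 PI) (I (N + 0)%Z)).
{ transitivity (RInt (fun y => 1 * T y) 0 PI); [apply RInt_ext; intros; simpl; ring|].
  rewrite (Hform 1 0 0) by (intros; ring); ring. }
assert (C2 : forall y, cos (2 * y) = 2 * cos y * cos y - 1) by apply cos_2a_cos.
assert (S2 : forall y, sin y * sin y = 1 - cos y * cos y).
{ intros y; generalize (sin2_cos2 y); unfold Rsqr; lra. }
rewrite E0 in P0, P2.
rewrite (Hform 1 (- / 2) 0) in P2 by (intros; field).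
rewrite (Hform (3 / 2) (- 1) (/ 4)) in P2 by (intros; rewrite C2; field).
rewrite (Hform (/ 2) 0 (- / 4)) in P11 by (intros; rewrite S2, C2; field).
assert (Q := toeplitz_positive (I (N + -2)%Z) (I (N + -1)%Z) (I (N + 0)%Z) (I (N + 1)%Z) (I (N + 2)%Z)).
cbv zeta in Q.
assert (Q' := Q P0 ltac:(lra)); clear Q.
match type of Q' with ?A -> _ => assert (QA : A) end.
{ match type of P2 with ?u ^ 2 < ?v * ?w => match goal with |- ?u' ^ 2 < ?v * ?w' =>
    replace u' with u by field; replace w' with w by field end end; exact P2. }
specialize (Q' QA); clear QA P0 P2 P11 Hform Hlin HT HI E0.
pose (K := PI * r ^ (n - 2)).
assert (HK : 0 < K) by (apply Rmult_lt_0_compat; [apply PI_RGT_0|apply pow_lt; lra]).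
pose (c := fun k => cnt k (Z.of_nat k)).
assert (Ic : forall j, (j <= 4)%nat -> I (N + (Z.of_nat j - 2))%Z = K * r ^ j * IZR (c (n - 2 + j)%nat)).
{ intros j Hj; unfold I, K, c, N.
  replace (Z.to_nat (Z.of_nat n + (Z.of_nat j - 2))) with (n - 2 + j)%nat by lia.
  replace (Z.of_nat n + (Z.of_nat j - 2))%Z with (Z.of_nat (n - 2 + j)) by lia.
  rewrite pow_add; replace m with ((n - 2 + j) + (m - (n - 2 + j)))%nat by lia.
  rewrite cnt_stable by lia; ring. }
change (I (N + -2)%Z) with (I (N + (Z.of_nat 0 - 2))%Z) in Q'.
change (I (N + -1)%Z) with (I (N + (Z.of_nat 1 - 2))%Z) in Q'.
change (I (N + 0)%Z) with (I (N + (Z.of_nat 2 - 2))%Z) in Q'.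
change (I (N + 1)%Z) with (I (N + (Z.of_nat 3 - 2))%Z) in Q'.
change (I (N + 2)%Z) with (I (N + (Z.of_nat 4 - 2))%Z) in Q'.
rewrite !Ic in Q' by lia.
unfold two_log_concave_at; unfold c in Q'; clearbody K; clear Ic.
replace (n - 2 + 0)%nat with (n - 2)%nat in Q' by lia.
replace (n - 2 + 1)%nat with (n - 1)%nat in Q' by lia.
replace (n - 2 + 2)%nat with n in Q' by lia.
replace (n - 2 + 3)%nat with (n + 1)%nat in Q' by lia.
replace (n - 2 + 4)%nat with (n + 2)%nat in Q' by lia.
apply lt_IZR; rewrite !Z.pow_2_r, !mult_IZR, !minus_IZR, !mult_IZR.
(* The inequality is homogeneous: every product has degree 4 and total power r^8, so the radius
   drops out. *)
apply Rmult_lt_reg_l with (K ^ 4 * r ^ 8); [apply Rmult_lt_0_compat; apply pow_lt; lra|].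
match type of Q' with ?l < ?rr => match goal with |- ?l' < ?r' =>
  replace l' with l by ring; replace r' with rr by ring end end.
exact Q'.
Qed.

Close Scope R_scope.
Close Scope Z_scope.

(** * Subsets of an ordinal type *)

From HB Require Import structures.
From mathcomp Require Import all_boot all_order all_algebra.
From mathcomp Require Import zify.

Set Implicit Arguments.
Unset Strict Implicit.
Unset Printing Implicit Defensive.

Local Open Scope nat_scope.

(** The ambient ordinal stays fixed while the bound on the parts varies, so that induction on the
    bound can follow the recursion of [cnt]. *)
Definition bounded_partitions (N m k : nat) : {set {set 'I_N.+1}} :=
  [set A : {set 'I_N.+1} | [forall i in A, 0 < i <= m] && (\sum_(i in A) (i : nat) == k)].

(** Split by whether m + 1 is a part; sets containing it correspond to sets without it by removing
    that element. *)
Lemma card_bounded_partitionsS N m k : (m < N)%N ->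
  #|bounded_partitions N m.+1 k| = #|bounded_partitions N m k|
    + (if (m.+1 <= k)%N then #|bounded_partitions N m (k - m.+1)| else 0).
Proof.
move=> ltmN; pose x : 'I_N.+1 := inord m.+1.
have xE : x = m.+1 :> nat by rewrite inordK // ltnS.
have memP p l (A : {set 'I_N.+1}) : reflect ((forall i, i \in A -> 0 < i <= p) /\ \sum_(i in A) (i : nat) = l)
    (A \in bounded_partitions N p l).
  rewrite inE; apply: (iffP andP) => [[/forall_inP ? /eqP ?] //|[H ->]]; split=> //.
  exact/forall_inP.
have notx p l (A : {set 'I_N.+1}) : p < m.+1 -> A \in bounded_partitions N p l -> x \notin A.
  by move=> ltpm /memP[HA _]; apply/negP=> /HA; rewrite xE; lia.
rewrite -(cardsID [set A : {set 'I_N.+1} | x \notin A]); congr (_ + _).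
  congr #|pred_of_set _|; apply/setP=> A; rewrite !inE -andbA; apply/idP/idP.
    case/and3P=> /forall_inP HA sA xA; rewrite sA andbT; apply/forall_inP=> i iA.
    have /andP[-> /=] := HA _ iA; rewrite leq_eqVlt => /orP[/eqP ei|//].
    by case/negP: xA; suff <- : i = x by []; apply: val_inj; rewrite /= xE.
  move=> HA; have xA : x \notin A by apply: (@notx m k) => //; rewrite inE.
  case/andP: HA => /forall_inP HA ->; rewrite xA !andbT; apply/forall_inP=> i /HA; lia.
case: ifPn => [lemk|]; last first.
  move=> ltkm; apply/eqP; rewrite cards_eq0; apply/eqP/setP=> A; rewrite !inE negbK.
  apply/negP=> /andP[xA /andP[_ /eqP sA]]; move: ltkm.
  by rewrite -sA (bigD1 x) //= xE leq_addr.
transitivity #|[set x |: A | A in bounded_partitions N m (k - m.+1)]|; last first.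
  apply: card_in_imset => A B HA HB /(congr1 (fun A => A :\ x)).
  by rewrite !setU1K // (notx m _ _ (leqnn _) HA, notx m _ _ (leqnn _) HB).
congr #|pred_of_set _|; apply/setP=> A; apply/idP/imsetP.
  rewrite !inE negbK => /andP[xA /andP[/forall_inP HA /eqP sA]].
  exists (A :\ x); last by rewrite setD1K.
  apply/memP; split.
    move=> i; rewrite in_setD1 => /andP[ix /HA/andP[-> /=]]; rewrite leq_eqVlt => /orP[/eqP ei|//].
    by case/eqP: ix; apply: val_inj; rewrite /= xE.
  by move: sA; rewrite (big_setD1 x xA) /= xE => <-; rewrite addKn.
case=> B HB ->; have xB := notx _ _ _ (leqnn _) HB.
case/memP: HB => HB sB; apply/setDP; split; last by rewrite in_set negbK setU11.
apply/memP; split.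
  by move=> i; rewrite in_setU1 => /orP[/eqP->|/HB]; rewrite ?xE; lia.
by rewrite big_setU1 //= sB xE subnKC.
Qed.

Lemma card_bounded_partitions N m k : (m <= N)%N ->
  Z.of_nat #|bounded_partitions N m k| = cnt m (Z.of_nat k).
Proof.
elim: m k => [|m IH] k leqmN.
  rewrite [cnt _ _]/=.
  have -> : bounded_partitions N 0 k = if k == 0 then [set set0] else set0.
    apply/setP=> A; rewrite inE.
    have [->|[i iA]] := set_0Vmem A.
      rewrite big_set0; have -> : [forall i in set0, (0 < (i : 'I_N.+1) <= 0)%N] by apply/forall_inP=> i; rewrite inE.
      by rewrite eq_sym; case: (k == 0); rewrite inE ?eqxx.
    have -> : [forall i in A, 0 < i <= 0] = false.
      by apply/negP=> /forall_inP/(_ i iA); lia.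
    case: (k == 0); rewrite inE //; apply/esym/negP=> /eqP A0; by rewrite A0 inE in iA.
  by case: eqP => [->|/eqP k0]; rewrite ?cards1 ?cards0 //; case: Z.eqb_spec => //; lia.
rewrite card_bounded_partitionsS // Nat2Z.inj_add IH; last exact: ltnW.
rewrite -/(cnt m.+1 _) [RHS]/=; congr Z.add; case: ifPn => lemk.
  rewrite IH; last exact: ltnW. congr cnt; lia.
rewrite cnt_neg //; lia.
Qed.

Lemma q_cnt n : Z.of_nat (q n) = cnt n (Z.of_nat n).
Proof.
rewrite -(@card_bounded_partitions n n n) // /q; congr Z.of_nat; congr #|pred_of_set _|.
apply/setP=> A; rewrite !inE; congr (_ && _); apply: eq_forallb => i.
by rewrite (leq_ord i) andbT.
Qed.

Import Order.TTheory GRing.Theory Num.Theory.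
Local Open Scope ring_scope.

Theorem theorem1p6 (n : nat) (hn : (273 <= n)%N) :
  ((q n)%:Z ^+ 2 - (q (n - 1))%:Z * (q (n + 1))%:Z) ^+ 2 >
  ((q (n - 1))%:Z ^+ 2 - (q (n - 2))%:Z * (q n)%:Z) *
  ((q (n + 1))%:Z ^+ 2 - (q n)%:Z * (q (n + 2))%:Z).
Proof.
have H : two_log_concave_at (fun k => cnt k (Z.of_nat k)) n.
  case: (Z.le_gt_cases 9300 (Z.of_nat n)) => Hn; first exact: two_log_concave_large.
  by apply: two_log_concave_small; lia.
move: H; rewrite /two_log_concave_at -!q_cnt -!plusE -!minusE !expr2.
move: (q _) (q _) (q _) (q _) (q _) => a b c d e; lia.
Qed.
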